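(* Let $\mathcal I$ be a finite set with $|\mathcal I|=n$ (the edges of a compact time-graph), and for each $j\in\mathcal I$ let $a_j>0$, $I_j=(0,a_j)$, let $X_j$ be a complex Hilbert space and $A_j$ an operator in $X_j$ such that $-A_j$ is sectorial of angle $<\pi/2$. Let $\mathbb B\in\mathcal L(\mathcal K_A)$, where $\mathcal K_A=\bigoplus_{j\in\mathcal I}[X_j,D(A_j)]_{1/2}$, and consider the time-graph Cauchy problem $$\partial_t\psi_j-A_j\psi_j=f_j\ \text{ on }I_j\ (j\in\mathcal I),\qquad \underline\psi_--\mathbb B\underline\psi_+=\underline g .\tag{CP}$$ (a) (CP) is iteratively solvable as a sequence of Cauchy problems on intervals if and only if, up to permutation of the edges, $\mathbb B$ is block triangular, i.e. there exists an ordering $i_1,\dots,i_n$ of the edges such that $\mathbb B_{i_ki_l}=0$ for $l>k$. (b) (CP) is iteratively solvable as a sequence of initial value problems if and only if, up to permutation of the edges, $\mathbb B$ is block triangular with zero diagonal (i.e. there is an ordering as in (a) and $\mathbb B_{jj}=0$ for all $j\in\mathcal I$).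
   Context: Notation: $\mathbb B_{ij}$ is the block of $\mathbb B$ mapping the $j$-th component to the $i$-th component; $\underline\psi_-=\{\psi_j(0)\}_j$, $\underline\psi_+=\{\psi_j(a_j)\}_j$; $[\cdot,\cdot]_{1/2}$ is complex interpolation ($D(A_j)$ with graph norm). Data: $f\in\bigoplus_jL^2(I_j;X_j)$, $\underline g\in\mathcal K_A$; solutions are understood in $\bigoplus_jW^{1,2}(I_j;X_j)\cap\bigoplus_jL^2(I_j;D(A_j))$ (whose elements have boundary values in $\mathcal K_A$). Definition. (CP) is iteratively solvable as a sequence of Cauchy problems on intervals if there exists an ordering of the edges, written $1,\dots,n$ after relabelling, and linear functions $\varphi_j$, $1\le j\le n-1$ (not depending on the data $f$ nor on the particular solution), such that for all data $f,\underline g$ the solution $\psi$ of (CP) satisfies $$\partial_t\psi_n-A_n\psi_n=f_n,\qquad \psi_n(0)-\mathbb B_{nn}\psi_n(a_n)=g_n,$$ and, for every $1\le j\le n-1$, $$\partial_t\psi_j-A_j\psi_j=f_j,\qquad \psi_j(0)-\mathbb B_{jj}\psi_j(a_j)=\varphi_j(\psi_{j+1},\dots,\psi_n,\underline g).$$ (''The solution satisfies'' means that every solution of (CP) does.) If moreover $\mathbb B_{jj}=0$ for all $j$, (CP) is called iteratively solvable as a sequence of initial value problems. A closed densely defined operator $B$ is sectorial of angle $\omega\in(0,\pi)$ if $\sigma(B)\subset\overline{\Sigma_\omega}$, $\Sigma_\omega=\{\lambda\in\mathbb C\setminus\{0\}:|\arg\lambda|<\omega\}$, and $\sup\{\|\lambda(\lambda-B)^{-1}\|:\lambda\ne0,\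 \nu\le|\arg\lambda|\le\pi\}<\infty$ for all $\nu\in(\omega,\pi)$. *)

(* Defs.v *)
From HB Require Import structures.
From mathcomp Require Import all_boot all_order all_algebra.
From mathcomp Require Import all_classical all_reals all_analysis.
From mathcomp Require Export complex.

Set Implicit Arguments.
Unset Strict Implicit.
Unset Printing Implicit Defensive.

Import Order.TTheory GRing.Theory Num.Theory.
Import numFieldNormedType.Exports.

Local Open Scope classical_set_scope.
Local Open Scope ring_scope.
Local Open Scope complex_scope.

(* Norms of normed modules over R[i] take their values in R[i]; [rnorm] is the
   same norm as an element of R. *)
Definition rnorm (R : realType) (V : normedModType R[i]) (x : V) : R :=
  complex.Re `|x|.

Definition is_hilbert (R : realType) (V : completeNormedModType R[i]) : Prop :=
  exists ip : {dot V for (@Num.conj R[i])}, forall x : V, `|x| ^+ 2 = ip x x.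

(* A subspace of V carrying a norm of its own; [nrm] is only meaningful on
   [car]. *)
Record nsubspace (R : realType) (V : normedModType R[i]) : Type := NSubspace {
  car : set V;
  nrm : V -> R }.

Definition full (R : realType) (V : normedModType R[i]) : nsubspace V :=
  NSubspace setT (@rnorm R V).

Record linop (R : realType) (V : normedModType R[i]) : Type := LinOp {
  dom : set V;
  op :> V -> V;
  dom0 : dom 0;
  domP : forall (c : R[i]) (x y : V), dom x -> dom y -> dom (c *: x + y);
  opP : forall (c : R[i]) (x y : V), dom x -> dom y ->
    op (c *: x + y) = c *: op x + op y }.

Section Operators.
Context {R : realType} {V : normedModType R[i]}.
Implicit Types (A B : linop V) (z : R[i]) (theta omega : R).

Lemma opp_linopP B (c : R[i]) (x y : V) : dom B x -> dom B y ->
  - B (c *: x + y) = c *: - B x + - B y.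
Proof. by move=> Dx Dy; rewrite opP// opprD scalerN. Qed.

Definition opp_linop B : linop V :=
  LinOp (dom0 B) (@domP _ _ B) (@opp_linopP B).

Definition graph_space A : nsubspace V :=
  NSubspace (dom A) (fun x => rnorm x + rnorm (A x)).

Definition closed_op B : Prop :=
  closed [set p : V * V | dom B p.1 /\ p.2 = B p.1].

Definition densely_defined B : Prop := dense (dom B).

(* S = (z - B)^{-1} *)
Definition is_resolvent B z (S : V -> V) : Prop :=
  (forall y, dom B (S y) /\ z *: S y - B (S y) = y) /\
  (forall x, dom B x -> S (z *: x - B x) = x).

Definition resolvent_set B : set R[i] :=
  [set z | exists2 S, is_resolvent B z S &
           exists M : R, forall y, rnorm (S y) <= M * rnorm y].

Definition spectrum B : set R[i] := ~` resolvent_set B.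

Definition is_arg z theta : Prop :=
  - pi < theta <= pi /\ z = `|z| * (cos theta +i* sin theta).

Definition sector omega : set R[i]^o :=
  [set z | z != 0 /\ exists theta, is_arg z theta /\ `|theta| < omega].

Definition sectorial B omega : Prop :=
  [/\ 0 < omega < pi, closed_op B, densely_defined B,
      spectrum B `<=` closure (sector omega) &
      forall nu : R, omega < nu < pi ->
        exists M : R, forall z theta, z != 0 -> is_arg z theta ->
          nu <= `|theta| -> exists2 S, is_resolvent B z S &
            forall y, rnorm (z *: S y) <= M * rnorm y].

End Operators.

(* Complex interpolation [V, Y]_s of a couple (V, Y) in which Y embeds
   continuously into V (so that the sum space V + Y is V itself). *)
Section ComplexInterpolation.
Context {R : realType} {V : normedModType R[i]}.
Variable Y : nsubspace V.

Definition closed_strip : set R[i]^o := [set z | 0 <= complex.Re z <= 1].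
Definition open_strip : set R[i]^o := [set z | 0 < complex.Re z < 1].

Definition calderon (F : R[i]^o -> V) : Prop :=
  [/\ {within closed_strip, continuous F},
      exists M : R, forall z, closed_strip z -> rnorm (F z) <= M,
      forall z, open_strip z -> derivable F z 1,
      forall t : R, car Y (F (1 +i* t)) &
      (exists M : R, forall t : R, nrm Y (F (1 +i* t)) <= M) /\
      (forall t : R,
         nrm Y (F (1 +i* s) - F (1 +i* t)) @[s --> t] --> (0 : R))].

Definition calderon_bound (F : R[i]^o -> V) (M : R) : Prop :=
  forall t : R, rnorm (F (0 +i* t)) <= M /\ nrm Y (F (1 +i* t)) <= M.

Definition interp (s : R) : nsubspace V := NSubspace
  [set u | exists2 F, calderon F & F (s +i* 0) = u]
  (fun u => inf [set M | exists F,
     [/\ calderon F, F (s +i* 0) = u & calderon_bound F M]]).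

End ComplexInterpolation.

(* Bochner integration over ]0, a[.  A simple function is given by a finite
   list of pairs (E, x) standing for the sum of the functions 1_E x. *)
Section Bochner.
Context {R : realType} {V : normedModType R[i]}.
Variable a : R.
Implicit Types (Y : nsubspace V) (s : seq (set R * V)) (f psi h : R -> V).

Local Notation mu := (@lebesgue_measure R).

Definition simple_fun Y s : Prop := forall p, p \in s ->
  [/\ measurable (p.1 : set (measurableTypeR R)), p.1 `<=` `]0, a[
    & car Y p.2].

Definition simple_val s (t : R) : V :=
  \sum_(p <- s) (\1_(p.1) t : R)%:C *: p.2.

Definition simple_int s : V := \sum_(p <- s) (fine (mu p.1))%:C *: p.2.

Definition strongly_measurable Y f : Prop :=
  exists2 s : nat -> seq (set R * V), forall k, simple_fun Y (s k) &
    {ae mu, forall t : R, 0 < t < a -> car Y (f t) /\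
      nrm Y (f t - simple_val (s k) t) @[k --> \oo] --> (0 : R)}.

Definition L2 Y f : Prop := strongly_measurable Y f /\
  (\int[mu]_(t in `]0%R, a[) ((nrm Y (f t)) ^+ 2)%:E < +oo)%E.

Definition has_integral f (v : V) : Prop :=
  exists s : nat -> seq (set R * V),
  [/\ forall k, simple_fun (full V) (s k),
      {ae mu, forall t : R, 0 < t < a ->
        simple_val (s k) t @[k --> \oo] --> f t},
      (\int[mu]_(t in `]0%R, a[) (rnorm (f t - simple_val (s k) t))%:E)%E
        @[k --> \oo] --> 0%E &
      simple_int (s k) @[k --> \oo] --> v].

Definition test_fun (eta : R -> R) : Prop :=
  (forall (k : nat) (t : R), derivable (derive1n k eta) t 1) /\
  exists c d : R, [/\ 0 < c, c < d, d < a &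
    forall t, eta t != 0 -> c <= t <= d].

Definition weak_derivative psi h : Prop :=
  forall eta, test_fun eta -> exists2 v : V,
    has_integral (fun t => (derive1 eta t)%:C *: psi t) v &
    has_integral (fun t => (eta t)%:C *: h t) (- v).

Definition W12 psi : Prop := L2 (full V) psi /\
  exists2 h, L2 (full V) h & weak_derivative psi h.

(* The value at t of the continuous representative of psi on [0, a]. *)
Definition boundary_value psi (t : R) (u : V) : Prop :=
  exists c : R -> V, [/\ {within `[0, a], continuous c},
    {ae mu, forall r : R, 0 < r < a -> c r = psi r} & c t = u].

Definition sol_space (A : linop V) psi : Prop :=
  W12 psi /\ L2 (graph_space A) psi.

Definition evolution_eq (A : linop V) f psi : Prop := sol_space A psi /\
  exists2 h, L2 (full V) h & weak_derivative psi h /\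
    {ae mu, forall t : R, 0 < t < a -> h t - A (psi t) = f t}.

End Bochner.

Section TimeGraph.
Context {R : realType} {I : finType} (a : I -> R).
Context (X : I -> completeNormedModType R[i]).
Context (A : forall j, linop (X j)).

Definition K (j : I) : nsubspace (X j) := interp (graph_space (A j)) 2^-1.

Definition KA (u : forall j, X j) : Prop := forall j, car (K j) (u j).

Definition KA_norm (u : forall j, X j) : R :=
  Num.sqrt (\sum_j (nrm (K j) (u j)) ^+ 2).

(* B is in L(K_A); only its values on K_A matter. *)
Definition bounded_KA (B : (forall j, X j) -> forall j, X j) : Prop :=
  [/\ forall u, KA u -> KA (B u),
      forall (c : R[i]) u v, KA u -> KA v -> forall j,
        B (fun k => c *: u k + v k) j = c *: B u j + B v j &
      exists M : R, forall u, KA u -> KA_norm (B u) <= M * KA_norm u].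

Variable B : (forall j, X j) -> forall j, X j.

Definition block (i j : I) (u : X j) : X i :=
  B (@eqtype.dfwith I X (fun=> 0) j u) i.

Definition block_zero (i j : I) : Prop :=
  forall u : X j, car (K j) u -> block i u = 0.

Definition solution (f : forall j, R -> X j) (g : forall j, X j)
    (psi : forall j, R -> X j) : Prop :=
  (forall j, evolution_eq (a j) (A j) (f j) (psi j)) /\
  exists um up : forall j, X j, [/\ KA um, KA up,
    forall j, boundary_value (a j) (psi j) 0 (um j),
    forall j, boundary_value (a j) (psi j) (a j) (up j) &
    forall j, um j - B up j = g j].

Definition edge_solution (j : I) (f : R -> X j) (v : X j)
    (psi : R -> X j) : Prop :=
  evolution_eq (a j) (A j) f psi /\
  exists um up : X j, [/\ car (K j) um, car (K j) up,
    boundary_value (a j) psi 0 um,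
    boundary_value (a j) psi (a j) up &
    um - block j up = v].

Section Ordering.
Variables (n : nat) (e : 'I_n -> I) (i : 'I_n).

Definition tail_in (psi : forall j, R -> X j) : Prop :=
  forall k : 'I_n, (i < k)%N -> sol_space (a (e k)) (A (e k)) (psi (e k)).

Definition tail_eq (psi psi' : forall j, R -> X j) : Prop :=
  forall k : 'I_n, (i < k)%N -> {ae @lebesgue_measure R, forall t : R,
    0 < t < a (e k) -> psi (e k) t = psi' (e k) t}.

(* phi is a linear map into K_{e i}, defined on the product of the solution
   spaces (of classes modulo a.e. equality) of the edges after e i and K_A. *)
Definition linear_tail_map
    (phi : (forall j, R -> X j) -> (forall j, X j) -> X (e i)) : Prop :=
  [/\ forall psi g, tail_in psi -> KA g -> car (K (e i)) (phi psi g),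
      forall psi psi' g, tail_in psi -> tail_in psi' -> KA g ->
        tail_eq psi psi' -> phi psi g = phi psi' g &
      forall (c : R[i]) psi psi' g g', tail_in psi -> tail_in psi' ->
        KA g -> KA g' ->
        phi (fun j t => c *: psi j t + psi' j t) (fun j => c *: g j + g' j)
          = c *: phi psi g + phi psi' g'].

End Ordering.

(* The positions of the ordering are 0, ..., n - 1, the last one being solved
   first. *)
Definition iteratively_solvable (n : nat) : Prop :=
  exists2 e : 'I_n -> I, bijective e &
  exists2 phi : forall i : 'I_n,
      (forall j, R -> X j) -> (forall j, X j) -> X (e i),
    forall i : 'I_n, (i.+1 < n)%N -> linear_tail_map (e := e) (i := i) (phi i) &
    forall f g, (forall j, L2 (a j) (full (X j)) (f j)) -> KA g ->
    forall psi, solution f g psi ->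
      (forall i : 'I_n, i.+1 = n ->
         edge_solution (f (e i)) (g (e i)) (psi (e i))) /\
      (forall i : 'I_n, (i.+1 < n)%N ->
         edge_solution (f (e i)) (phi i psi g) (psi (e i))).

Definition iteratively_solvable_ivp (n : nat) : Prop :=
  iteratively_solvable n /\ forall j, block_zero j j.

Definition block_triangular_for (n : nat) (e : 'I_n -> I) : Prop :=
  forall k l : 'I_n, (k < l)%N -> block_zero (e k) (e l).

Definition block_triangular (n : nat) : Prop :=
  exists2 e : 'I_n -> I, bijective e & block_triangular_for e.

End TimeGraph.

(* Main.v *)
Require Import Defs.
From HB Require Import structures.
From mathcomp Require Import all_boot all_order all_algebra.
From mathcomp Require Import all_classical all_reals all_analysis.
From mathcomp Require Import measurable_realfun ring lra.

Set Implicit Arguments.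
Unset Strict Implicit.
Unset Printing Implicit Defensive.

Import Order.TTheory GRing.Theory Num.Theory.
Import numFieldNormedType.Exports.

Local Open Scope classical_set_scope.
Local Open Scope ring_scope.
Local Open Scope complex_scope.

(* The key point is a lifting: every u in [X, D(A)]_(1/2) is the initial value
   of some psi in W^{1,2}(0, a; X) and L^2(0, a; D(A)) with psi(a) = 0, and the
   final value of some psi with psi(0) = 0.  Neither the semigroup of A nor a
   trace theorem is needed.

   Let F be holomorphic on the strip with F(1/2) = u and put
   E(z) = exp(2 pi (z - 1/2)), which has period i.  Cauchy's formula with the
   kernel E^k / (z - 1/2) writes u = p_k + q_k, where p_k in D(A) is an integral
   over Re z = 1 and q_k, up to a truncation, an integral over Re z = 0.  Cut
   into pieces of length 1, these are sums of k-th Fourier coefficients, so that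
   Bessel's inequality in the Hilbert space X gives that e^(- pi k) |p_k|_X, e^(- pi k) |A p_k|_X and
   e^(pi k) |q_k|_X are square summable.  With t_k = a e^(- 2 pi k), the
   function equal to p_k at t_k and interpolating in between by C^1 ramps is
   the desired psi.

   If B is triangular, the transmission condition at an edge only involves the
   final values at this edge and at the edges solved before; they depend
   linearly on psi, which gives the maps phi.  Conversely, for l < i and u in K,
   let v be the column B e_l u.  Lift u to a final value at l: this solves (CP)
   with g = - v and vanishes at i.  Lift v to initial values: this solves (CP)
   with g = v, has v_i as initial value at i and, by induction, vanishes after
   i.  Hence phi_i(0, - v) = 0 and phi_i(0, v) = v_i, and v_i = 0 by linearity. *)

(** The weights are dictated by scaling. On the k-th gap, of length comparable to t_k, the squared
    L^2 norm of A psi is about t_k |A p_k|^2 and that of the derivative about |q_k|^2 / t_k, because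
    the increments of p and of q are opposite. With t_k = a e^(- 2 pi k) these are, up to constants,
    the squares of e^(- pi k) |A p_k| and e^(pi k) |q_k|, and e^pi, e^(- pi) are the moduli of E on
    the two sides of the strip. Estimating the boundary integrals by suprema of F would only bound
    these quantities, which characterises a real interpolation space of second index infinity. The
    square summability that L^2 in time demands comes from the orthogonality of the characters,
    hence from the Hilbert structure. The period of E matches windows of length 1, so the same
    windows serve all k.

    The lifting solves no equation: f is defined as what psi leaves. This is legitimate because the
    maps phi must not depend on f, and it lets the converse compare solutions belonging to unrelated
    f. *)

Section Norm.
Context {R : realType}.
Implicit Types (V W : normedModType R[i]) (c z : R[i]).

Lemma rnormE V (x : V) : `|x| = (rnorm x)%:C.
Proof. by rewrite /rnorm RRe_real// normr_real. Qed.

Lemma rnorm_ge0 V (x : V) : 0 <= rnorm x.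
Proof. by rewrite -ler0c -rnormE. Qed.

Lemma rnorm0 V : rnorm (0 : V) = 0.
Proof. by rewrite /rnorm normr0. Qed.

Lemma rnorm_eq0 V (x : V) : (rnorm x == 0) = (x == 0).
Proof. by rewrite -[RHS]normr_eq0 rnormE (inj_eq (@complexI R)). Qed.

Lemma rnormN V (x : V) : rnorm (- x) = rnorm x.
Proof. by rewrite /rnorm normrN. Qed.

Lemma rnormD V (x y : V) : rnorm (x + y) <= rnorm x + rnorm y.
Proof. by rewrite -lecR rmorphD/= -!rnormE ler_normD. Qed.

Lemma rnormB V (x y : V) : rnorm (x - y) <= rnorm x + rnorm y.
Proof. by rewrite -(rnormN y) rnormD. Qed.

Lemma rdistC V (x y : V) : rnorm (x - y) = rnorm (y - x).
Proof. by rewrite -rnormN opprB. Qed.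

Lemma rnorm_sum V (J : Type) (r : seq J) (P : pred J) (F : J -> V) :
  rnorm (\sum_(i <- r | P i) F i) <= \sum_(i <- r | P i) rnorm (F i).
Proof.
elim/big_ind2: _ => [|x a y b xa yb|//]; first by rewrite rnorm0.
by rewrite (le_trans (rnormD _ _))// lerD.
Qed.

Lemma rnormZ V c (x : V) : rnorm (c *: x) = rnorm (c : R[i]^o) * rnorm x.
Proof. by apply: complexI; rewrite rmorphM/= -!rnormE normrZ. Qed.

Lemma cabsE c : rnorm (c : R[i]^o) =
  Num.sqrt (complex.Re c ^+ 2 + complex.Im c ^+ 2).
Proof. by rewrite /rnorm normc_def. Qed.

Lemma cabsM c z : rnorm (c * z : R[i]^o) = rnorm (c : R[i]^o) * rnorm (z : R[i]^o).
Proof. exact: (rnormZ (c : R[i]) (z : R[i]^o)). Qed.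

Lemma cabsX c n : rnorm (c ^+ n : R[i]^o) = rnorm (c : R[i]^o) ^+ n.
Proof. by elim: n => [|n IH]; rewrite ?expr0 ?exprS ?cabsM ?IH// /rnorm normr1. Qed.

Lemma cabsV c : rnorm (c^-1 : R[i]^o) = (rnorm (c : R[i]^o))^-1.
Proof.
apply: complexI; rewrite -rnormE normfV rnormE.
by rewrite /= -[in RHS]/(real_complex R _) fmorphV.
Qed.

Lemma cabsR (x : R) : rnorm (x%:C : R[i]^o) = `|x|.
Proof. by rewrite cabsE/= expr0n addr0 sqrtr_sqr. Qed.

Lemma cabsi : rnorm ('i%C : R[i]^o) = 1.
Proof. by rewrite cabsE/= expr0n add0r expr1n sqrtr1. Qed.

Lemma cabs_Re c : `|complex.Re c| <= rnorm (c : R[i]^o).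
Proof. by rewrite -lecR -rnormE normc_ge_Re. Qed.

Lemma cabs_Im c : `|complex.Im c| <= rnorm (c : R[i]^o).
Proof.
have := cabs_Re (c * 'i%C); rewrite ReiNIm normrN cabsM cabsi mulr1; exact.
Qed.

Lemma cabs_le c : rnorm (c : R[i]^o) <= `|complex.Re c| + `|complex.Im c|.
Proof.
rewrite {1}[c]complexE (le_trans (rnormD _ _))//.
by rewrite cabsM cabsi mul1r !cabsR.
Qed.

(** In [R[i]] the relation [0 < e] forces [e] to be real, so the complex radii of the norm filter
    can be traded for real ones. *)
Lemma rcvgP V {T : Type} {F : set_system T} {FF : Filter F} (f : T -> V) (l : V) :
  f x @[x --> F] --> l <->
  forall e : R, 0 < e -> \forall x \near F, rnorm (f x - l) < e.
Proof.
split=> [/cvgrPdist_lt fl e e0|fl].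
  have := fl e%:C; rewrite ltcR => /(_ e0).
  by apply: filterS => x; rewrite rnormE ltcR rdistC.
apply/cvgrPdist_lt => e; rewrite ltcE => /andP[/eqP ei e0].
apply: filterS (fl _ e0) => x; rewrite rdistC rnormE ltcE/= => ->.
by move: ei => /= ->; rewrite eqxx.
Qed.

Lemma cvg_rnorm V {T : Type} {F : set_system T} {FF : Filter F}
    (f : T -> V) (l : V) :
  f x @[x --> F] --> l -> rnorm (f x) @[x --> F] --> rnorm l.
Proof.
move=> /rcvgP fl; apply/cvgrPdist_lt => e e0; apply: filterS (fl _ e0) => x.
apply: le_lt_trans; rewrite ler_norml; apply/andP; split.
  rewrite lerNl opprB lerBlDr.
  by rewrite -{1}(subrK l (f x)) rnormD.
rewrite lerBlDr rdistC.
by rewrite -{1}(subrK (f x) l) rnormD.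
Qed.

Lemma rballE V (x y : V) (e : R) : ball x e%:C y = (rnorm (x - y) < e) :> Prop.
Proof. by rewrite -ball_normE /ball_/mkset rnormE ltcR. Qed.

(** Real and imaginary parts are 1-Lipschitz, so a Cauchy filter has Cauchy images in [R]; the two
    limits are then glued. *)
Lemma complex_complete : forall F : set_system R[i]^o, ProperFilter F ->
  cauchy F -> cvg F.
Proof.
move=> F FF Fc.
have FCx (p : R[i]^o -> R) : (forall a b, `|p a - p b| <= rnorm (a - b)) ->
    cvg (p x @[x --> F]).
  move=> pl; apply/cauchy_cvgP/cauchy_exP => e e0.
  have /cauchyP /(_ (e%:C)) := Fc.
  rewrite ltcR => /(_ e0)[z Fz]; exists (p z).
  apply: (@filterS _ F _ (ball z e%:C)) Fz => a.
  rewrite rballE => za.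
  by rewrite -ball_normE/=; exact: le_lt_trans za.
have /FCx Rc : forall a b : R[i]^o, `|complex.Re a - complex.Re b| <= rnorm (a - b).
  by move=> [a1 a2] [b1 b2]; exact: (cabs_Re ((a1 - b1) +i* (a2 - b2))).
have /FCx Ic : forall a b : R[i]^o, `|complex.Im a - complex.Im b| <= rnorm (a - b).
  by move=> [a1 a2] [b1 b2]; exact: (cabs_Im ((a1 - b1) +i* (a2 - b2))).
apply/cvg_ex; exists ((lim (complex.Re x @[x --> F])) +i* (lim (complex.Im x @[x --> F]))).
apply/(@rcvgP R[i]^o) => e e0.
have e20 : 0 < e / 2 by rewrite divr_gt0.
move/cvgrPdist_lt: Rc => /(_ _ e20); move/cvgrPdist_lt: Ic => /(_ _ e20).
apply: filterS2 => z zi zr; rewrite (le_lt_trans (cabs_le _))//.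
case: z zi zr => a b /= zi zr; rewrite [e]splitr.
by rewrite ltrD//= -normrN opprB.
Qed.

End Norm.

HB.instance Definition _ (R : realType) :=
  Uniform_isComplete.Build (R[i]^o) (@complex_complete R).
(* An alias that inherits completeness, so that the lemmas on functions with
   values in a Banach space apply to scalar functions. *)
Definition Cx (R : realType) : Type := R[i]^o.
HB.instance Definition _ (R : realType) := NormedModule.copy (Cx R) (R[i]^o).
HB.instance Definition _ (R : realType) :=
  Uniform_isComplete.Build (Cx R) (@complex_complete R).

(** * Dyadic integrals and Cauchy's theorem *)

Section RiemannSum.
Context {R : realType}.

(* The mean of f over the points k / 2^n of [0, 1[; its limit is the only
   integral of vector-valued functions used for Cauchy's theorem. *)
Fixpoint RS {W : lmodType R[i]} (n : nat) (f : R -> W) : W :=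
  if n is n.+1 then
    2^-1 *: (RS n (fun s => f (s / 2)) + RS n (fun s => f ((1 + s) / 2)))
  else f 0.

Section Lmodule.
Context {W : lmodType R[i]}.
Implicit Types (f g : R -> W) (n : nat).

(** Each mean is an iterated midpoint of values of [f]. Equality, norm bounds and the graph of an
    operator are stable under midpoints, and all pass from the values to the means through this one
    induction. *)
Lemma RS_ind2 {W' : lmodType R[i]} (P : W -> W' -> Prop) :
  (forall x x' y y', P x x' -> P y y' -> P (2^-1 *: (x + y)) (2^-1 *: (x' + y'))) ->
  forall n f (g : R -> W'), (forall s, 0 <= s < 1 -> P (f s) (g s)) ->
    P (RS n f) (RS n g).
Proof.
move=> PD; elim=> [|n IH] f g fg /=; first by apply: fg; lra.
by apply: PD; apply: IH => s s01; apply: fg; lra.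
Qed.

Lemma RS_ind (P : W -> Prop) :
  (forall x y, P x -> P y -> P (2^-1 *: (x + y))) ->
  forall n f, (forall s, 0 <= s < 1 -> P (f s)) -> P (RS n f).
Proof.
move=> PD n f Pf; apply: (@RS_ind2 W (fun x _ => P x) _ n f f) => // x x' y y'.
exact: PD.
Qed.

Lemma eq_RS n f g : (forall s, 0 <= s < 1 -> f s = g s) -> RS n f = RS n g.
Proof. by apply: RS_ind2 => x x' y y' -> ->. Qed.

Lemma RS_cst n (x : W) : RS n (fun=> x) = x.
Proof.
apply: (@RS_ind (fun y => y = x)) => // y z -> ->.
by rewrite -{1 2}[x]scale1r -scalerDl scalerA mulVf ?scale1r// pnatr_eq0.
Qed.

Lemma RSD n f g : RS n (fun s => f s + g s) = RS n f + RS n g.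
Proof.
elim: n f g => [//|n IH] f g /=.
by rewrite !IH -scalerDr; congr (_ *: _); rewrite addrACA.
Qed.

Lemma RSZ n (c : R[i]) f : RS n (fun s => c *: f s) = c *: RS n f.
Proof.
by elim: n f => [//|n IH] f /=; rewrite !IH -scalerDr !scalerA mulrC.
Qed.

Lemma RSB n f g : RS n (fun s => f s - g s) = RS n f - RS n g.
Proof.
rewrite -[X in _ - X]scale1r -scaleNr -RSZ -RSD; apply: eq_RS => s _.
by rewrite scaleN1r.
Qed.

Lemma RS_scale n (k : R -> R[i]) (x : W) :
  RS n (fun s => k s *: x) = RS n (k : R -> R[i]^o) *: x.
Proof.
elim: n k => [//|n IH] k /=.
rewrite (IH (fun s => k (s / 2))) (IH (fun s => k ((1 + s) / 2))).
by rewrite -scalerDl scalerA.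
Qed.

End Lmodule.

Section Normed.
Context {W : normedModType R[i]}.
Implicit Types (f g : R -> W) (n : nat).

Lemma rnorm_half (x y : W) : rnorm (2^-1 *: (x + y)) <= (rnorm x + rnorm y) / 2.
Proof.
have -> : 2^-1 = (2^-1)%:C :> R[i] by rewrite fmorphV rmorphD.
by rewrite rnormZ cabsR ger0_norm ?invr_ge0// mulrC ler_pM2r ?invr_gt0 ?rnormD.
Qed.

Lemma RS_norm n f (M : R) : (forall s, 0 <= s < 1 -> rnorm (f s) <= M) ->
  rnorm (RS n f) <= M.
Proof.
apply: (@RS_ind W (fun x => rnorm x <= M)) => x y xM yM.
by rewrite (le_trans (rnorm_half _ _))// ler_pdivrMr//; lra.
Qed.

Lemma RS_dist n f g (M : R) : (forall s, 0 <= s < 1 -> rnorm (f s - g s) <= M) ->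
  rnorm (RS n f - RS n g) <= M.
Proof. by move=> fgM; rewrite -RSB; exact: RS_norm. Qed.

(** Induction on [n]: each half is rescaled to [0, 1], which turns oscillation at scale 2^-(n+1)
    into oscillation at scale 2^-n. At [n] = 0 every value is compared with [f 0]. *)
Lemma RS_osc n m f (e : R) :
  (forall s t, 0 <= s <= 1 -> 0 <= t <= 1 -> `|s - t| <= 2^-1 ^+ n ->
    rnorm (f s - f t) <= e) ->
  rnorm (RS (n + m) f - RS n f) <= e.
Proof.
elim: n f => [|n IH] f fe.
  rewrite add0n -(RS_cst m (RS 0 f)); apply: RS_dist => s s01 /=; apply: fe.
  - lra.
  - lra.
  - by rewrite subr0 expr0 ger0_norm; lra.
rewrite addSn/= -scalerBr opprD addrACA (le_trans (rnorm_half _ _))//.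
have e2 : forall n, 2^-1 ^+ n.+1 = 2^-1 ^+ n / 2 :> R by move=> k; rewrite exprS mulrC.
have h1 := IH (fun s => f (s / 2)); have h2 := IH (fun s => f ((1 + s) / 2)).
rewrite ler_pdivrMr// mulrDr mulr1 lerD//; [apply: h1|apply: h2] => s t s01 t01 st.
- apply: fe; [lra|lra|].
  by rewrite e2 -mulrBl normrM (@ger0_norm _ 2^-1)// ler_pM2r.
- apply: fe; [lra|lra|].
  rewrite e2 -mulrBl normrM (@ger0_norm _ 2^-1)// ler_pM2r//.
  by rewrite opprD addrACA subrr add0r.
Qed.

Lemma within01_unif f : {within `[0, 1], continuous f} -> forall e : R, 0 < e ->
  \forall n \near \oo, forall s t, 0 <= s <= 1 -> 0 <= t <= 1 ->
    `|s - t| <= 2^-1 ^+ n -> rnorm (f s - f t) <= e.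
Proof.
move=> fc e e0.
have /compact_near_coveringP/near_covering_withinP :=
  @segment_compact R 0 1.
move=> /(_ nat \oo (fun n s => forall t, 0 <= t <= 1 -> `|s - t| <= 2^-1 ^+ n ->
    rnorm (f s - f t) <= e)) H.
have {}H : \forall n \near \oo, `[0%R, 1%R] `<=` (fun s => forall t, 0 <= t <= 1 ->
   `|s - t| <= 2^-1 ^+ n -> rnorm (f s - f t) <= e).
  apply: H => x x01.
  move/subspace_continuousP : fc => /(_ x x01)/rcvgP => /(_ (e / 2)).
  rewrite divr_gt0// => /(_ isT) [d/= d0 fd].
  have /cvgrPdist_lt : 2^-1 ^+ n @[n --> \oo] --> (0 : R).
    by apply: cvg_expr; rewrite ger0_norm; lra.
  move=> /(_ (d / 2)); rewrite divr_gt0// => /(_ isT) nd.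
  exists (ball x (d / 2), [set n | 2^-1 ^+ n < d / 2]).
    split; first by apply: nbhsx_ballx; rewrite divr_gt0.
    move: nd; apply: filterS => n /=; rewrite sub0r normrN.
    exact: le_lt_trans (ler_norm _).
  move=> [y n]/= [xy nn] y01 t t01 yt.
  have fxy : rnorm (f y - f x) < e / 2.
    by apply: fd y01 => /=; rewrite (lt_trans xy)// ltr_pdivrMr//; lra.
  have fxt : rnorm (f t - f x) < e / 2.
    apply: fd => /=; last by rewrite /= in_itv.
    have -> : x - t = (x - y) + (y - t) by rewrite addrA subrK.
    by rewrite /= (le_lt_trans (ler_normD _ _))// [d]splitr ltrD// (le_lt_trans yt).
  have -> : f y - f t = (f y - f x) - (f t - f x) by rewrite opprB addrA subrK.
  by rewrite (le_trans (rnormB _ _))// [e]splitr lerD// ltW.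
by apply: filterS H => n Hn s t s01; apply: Hn; rewrite /= in_itv.
Qed.

End Normed.
End RiemannSum.

Section Integral.
Context {R : realType} {V : completeNormedModType R[i]}.
Implicit Types (f g : R -> V).

(** [lim] has a default value; [RS_cvg] shows that the limit exists when [f] is continuous on
    [0, 1]. *)
Definition Iv f : V := lim (RS n f @[n --> \oo]).

Lemma cvg_Iv f (l : V) : RS n f @[n --> \oo] --> l -> Iv f = l.
Proof. by move=> fl; exact: (cvg_lim (@norm_hausdorff _ V) fl). Qed.

Lemma RS_cvg f : {within `[0, 1], continuous f} -> RS n f @[n --> \oo] --> Iv f.
Proof.
move=> /within01_unif fu; apply/cauchy_cvgP/cauchyP => e.
rewrite ltcE => /andP[/eqP /= ei e0].
have [N _ fN] := fu _ (divr_gt0 e0 (@ltr0n R 2)).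
have -> : e = (complex.Re e)%:C by case: e ei {e0 fN} => x y /= ->.
exists (RS N f); exists N => // n /= Nn; rewrite rballE rdistC.
rewrite -(subnKC Nn) (le_lt_trans (@RS_osc _ _ N _ f (complex.Re e / 2) _))//.
  exact: (fN N (leqnn N)).
by rewrite ltr_pdivrMr//; move: e0 => /=; lra.
Qed.

Lemma eq_Iv f g : (forall s, 0 <= s < 1 -> f s = g s) -> Iv f = Iv g.
Proof.
move=> fg; rewrite /Iv; suff -> : RS ^~ f = RS ^~ g by [].
by apply/funext => n; exact: eq_RS.
Qed.

Lemma Iv_cst (x : V) : Iv (fun=> x) = x.
Proof.
by apply: cvg_Iv; under eq_fun do rewrite RS_cst; exact: cvg_cst.
Qed.

Lemma IvD f g : {within `[0, 1], continuous f} -> {within `[0, 1], continuous g} ->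
  Iv (fun s => f s + g s) = Iv f + Iv g.
Proof.
move=> fc gc; apply: cvg_Iv; under eq_fun do rewrite RSD.
by apply: cvgD; exact: RS_cvg.
Qed.

Lemma IvB f g : {within `[0, 1], continuous f} -> {within `[0, 1], continuous g} ->
  Iv (fun s => f s - g s) = Iv f - Iv g.
Proof.
move=> fc gc; apply: cvg_Iv; under eq_fun do rewrite RSB.
by apply: cvgB; exact: RS_cvg.
Qed.

Lemma IvZ c f : {within `[0, 1], continuous f} -> Iv (fun s => c *: f s) = c *: Iv f.
Proof.
move=> fc; apply: cvg_Iv; under eq_fun do rewrite RSZ.
by apply: cvgZl_tmp; exact: RS_cvg.
Qed.

(** [RS n.+1 f] is by definition the average of the two half means, and a shifted sequence has the
    same limit. *)
Lemma Iv_half f : {within `[0, 1], continuous f} ->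
  Iv f = 2^-1 *: (Iv (fun s => f (s / 2)) + Iv (fun s => f ((1 + s) / 2))).
Proof.
move=> fc; apply: cvg_Iv; rewrite -(cvg_shiftS (RS ^~ f)) /=.
have sub (h : R -> R) : continuous h -> (forall s, 0 <= s <= 1 -> 0 <= h s <= 1) ->
    {within `[0, 1], continuous (fun s => f (h s))}.
  move=> hc h01; apply/subspace_continuousP => s s01.
  move/subspace_continuousP : fc => /(_ (h s)).
  rewrite /= in_itv/= => /(_ (h01 _ s01)) fc.
  apply: cvg_trans fc => U /= [e /= e0 fU].
  have [d /= d0 hd] : \forall x \near s, ball (h s) e (h x).
    by apply: hc; exact: nbhsx_ballx.
  exists d => // t st; rewrite /= in_itv/= => t01; apply: fU; first exact: hd.
  by rewrite /= in_itv/=; exact: h01.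
apply: cvgZl_tmp; apply: cvgD; apply: RS_cvg; apply: sub.
- by move=> x; apply: cvgM; [exact: cvg_id|exact: cvg_cst].
- by move=> s; lra.
- move=> x; apply: cvgM; last exact: cvg_cst.
  by apply: cvgD; [exact: cvg_cst|exact: cvg_id].
- by move=> s; lra.
Qed.

Lemma Iv_norm f (M : R) : {within `[0, 1], continuous f} ->
  (forall s, 0 <= s < 1 -> rnorm (f s) <= M) -> rnorm (Iv f) <= M.
Proof.
move=> /RS_cvg/cvg_rnorm fc fM; apply: (closed_cvg (fun x => x <= M) _ _ _ fc).
  exact: closed_le.
by apply: nearW => n; exact: RS_norm.
Qed.

End Integral.

(** * Contour integrals over squares *)

Section Goursat.
Context {R : realType}.

Lemma within_comp {T1 T2 T3 : topologicalType} (A : set T1) (D : set T2)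
    (f : T1 -> T2) (g : T2 -> T3) :
  {within D, continuous g} -> {within A, continuous f} ->
  (forall s, A s -> D (f s)) -> {within A, continuous (g \o f)}.
Proof.
move=> /subspace_continuousP gc /subspace_continuousP fc fAD.
apply/subspace_continuousP => s As U /(gc _ (fAD _ As)) gU.
have H : nbhs s (fun t => A t -> D (f t) -> U (g (f t))) := fc s As _ gU.
by apply: filterS H => t /= H /[dup] At /H; apply; exact: fAD.
Qed.

Lemma continuous_real_complex : continuous (fun s : R => s%:C : R[i]^o).
Proof.
move=> s; apply/(@rcvgP _ R[i]^o) => e e0; exists e => //= t st.
by rewrite -rmorphB/= cabsR distrC.
Qed.

Lemma continuous_affine_path (z d : R[i]^o) :
  continuous (fun s : R => z + s%:C * d : R[i]^o).
Proof.
move=> s; apply: cvgD; first exact: cvg_cst.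
apply: (@cvgM R[i]); last exact: cvg_cst.
exact: continuous_real_complex.
Qed.

Context {V : completeNormedModType R[i]}.
Implicit Types (g : R[i]^o -> V) (z d w : R[i]^o) (r : R).

(* The integral of g along the segment from z to z + d. *)
Definition edge g z d : V := d *: Iv (fun s : R => g (z + s%:C * d)).

Lemma within_edge g (D : set R[i]^o) z d : {within D, continuous g} ->
  (forall s : R, 0 <= s <= 1 -> D (z + s%:C * d)) ->
  {within `[0, 1], continuous (fun s : R => g (z + s%:C * d))}.
Proof.
move=> gc zD; apply: (within_comp gc) => [|s].
  by apply: continuous_subspaceT; exact: continuous_affine_path.
by rewrite /= in_itv/= => /zD.
Qed.

Lemma edge_half g (D : set R[i]^o) z d : {within D, continuous g} ->
  (forall s : R, 0 <= s <= 1 -> D (z + s%:C * d)) ->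
  edge g z d = edge g z (d / 2) + edge g (z + d / 2) (d / 2).
Proof.
move=> gc zD; rewrite /edge Iv_half; last exact: within_edge zD.
rewrite scalerA scalerDr; congr (_ *: _ + _ *: _); apply: eq_Iv => s _; congr g.
  by rewrite rmorphM/= fmorphV/= rmorph_nat; by field.
by rewrite rmorphM/= fmorphV/= rmorph_nat rmorphD/=; field.
Qed.

Lemma edge_affine (a b : V) p z d :
  edge (fun w => a + (w - p) *: b) z d = d *: a + (d * (z - p + d / 2)) *: b.
Proof.
pose f (s : R) := s%:C *: b.
have fc : {within `[0, 1], continuous f}.
  apply: continuous_subspaceT => s; apply: cvgZr_tmp.
  exact: continuous_real_complex.
(* Self-similarity determines this integral x: halving gives x = (x / 2 + (b / 2 + x / 2)) / 2, a
   linear equation for x. *)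
have fI : Iv f = 2^-1 *: b.
  have := Iv_half fc.
  have -> : Iv (fun s => f (s / 2)) = 2^-1 *: Iv f.
    rewrite -IvZ//; apply: eq_Iv => s _; rewrite /f scalerA; congr (_ *: _).
    by rewrite rmorphM/= fmorphV/= rmorph_nat mulrC.
  have -> : Iv (fun s => f ((1 + s) / 2)) = 2^-1 *: b + 2^-1 *: Iv f.
    rewrite -IvZ// -[2^-1 *: b]Iv_cst -IvD; last 2 first.
    - by apply: continuous_subspaceT => ?; exact: cvg_cst.
    - apply: continuous_subspaceT => s; apply: cvgZl_tmp; apply: cvgZr_tmp.
      exact: continuous_real_complex.
    apply: eq_Iv => s _; rewrite /f scalerA -scalerDl; congr (_ *: _).
    by rewrite rmorphM/= fmorphV/= rmorph_nat rmorphD/=; field.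
  move=> H.
  have {}H : (1 - 2^-1 * 2^-1 - 2^-1 * 2^-1) *: Iv f = (2^-1 * 2^-1) *: b.
    rewrite 2!scalerBl scale1r {1}H !scalerDr !scalerA.
    by rewrite addrCA addrA !addrK.
  have /scalerI : 1 - 2^-1 * 2^-1 - 2^-1 * 2^-1 != 0 :> R[i].
    have -> : 1 - 2^-1 * 2^-1 - 2^-1 * 2^-1 = 2^-1 :> R[i] by field.
    by rewrite invr_eq0 pnatr_eq0.
  apply; rewrite H scalerA; congr (_ *: _); by field.
rewrite /edge -scalerA -scalerDr; congr (_ *: _).
rewrite (_ : Iv _ = Iv (fun s => (a + (z - p) *: b) + d *: f s)); last first.
  apply: eq_Iv => s _; rewrite -[RHS]addrA /f scalerA -scalerDl.
  by congr (_ + _ *: _); ring.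
rewrite IvD; last 2 first.
- by apply: continuous_subspaceT => ?; exact: cvg_cst.
- apply: continuous_subspaceT => s; apply: cvgZl_tmp; apply: cvgZr_tmp.
  exact: continuous_real_complex.
by rewrite Iv_cst IvZ// fI scalerA -[LHS]addrA -scalerDl.
Qed.

Definition square z r : set R[i]^o := [set w |
  (complex.Re z <= complex.Re w <= complex.Re z + r) /\
  (complex.Im z <= complex.Im w <= complex.Im z + r)].

(** [z] is the lower left corner. The top and left edges enter with a minus sign because the
    boundary runs counterclockwise. *)
Definition contour g z r : V :=
  edge g z r%:C + edge g (z + r%:C) (r *i)
  - edge g (z + r *i) r%:C - edge g z (r *i).

Lemma square_edges z r (s : R) : 0 <= r -> 0 <= s <= 1 ->
  [/\ square z r (z + s%:C * r%:C), square z r (z + r%:C + s%:C * r *i),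
      square z r (z + r *i + s%:C * r%:C) & square z r (z + s%:C * r *i)].
Proof.
move=> r0 /andP[s0 s1]; have sr : s * r <= r by rewrite ler_piMl.
have sr0 : 0 <= s * r by rewrite mulr_ge0.
case: z => x y; rewrite /square.
by split => /=; rewrite ?mul0r ?mulr0 ?addr0 ?subr0 ?add0r; split; lra.
Qed.

Lemma contour_within g z r : 0 <= r -> {within square z r, continuous g} ->
  [/\ {within `[0, 1], continuous (fun s : R => g (z + s%:C * r%:C))},
      {within `[0, 1], continuous (fun s : R => g (z + r%:C + s%:C * r *i))},
      {within `[0, 1], continuous (fun s : R => g (z + r *i + s%:C * r%:C))} &
      {within `[0, 1], continuous (fun s : R => g (z + s%:C * r *i))}].
Proof.
by move=> r0 gc; split; apply: (within_edge gc) => s /(square_edges z r0)[].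
Qed.

Lemma contourB (g h : R[i]^o -> V) z r : 0 <= r ->
  {within square z r, continuous g} -> {within square z r, continuous h} ->
  contour (fun w => g w - h w) z r = contour g z r - contour h z r.
Proof.
move=> r0 /(contour_within r0)[g1 g2 g3 g4] /(contour_within r0)[h1 h2 h3 h4].
rewrite /contour /edge !IvB// !scalerBr !opprD !opprK !addrA.
by rewrite [LHS](ACl (1*3*5*7*2*4*6*8)).
Qed.

Lemma contour_norm g z r (M : R) : 0 <= r -> {within square z r, continuous g} ->
  (forall w, square z r w -> rnorm (g w) <= M) ->
  rnorm (contour g z r) <= 4 * r * M.
Proof.
move=> r0 /(contour_within r0)[g1 g2 g3 g4] gM.
have en (z' d : R[i]) : {within `[0, 1], continuous (fun s : R => g (z' + s%:C * d))} ->
    (forall s : R, 0 <= s <= 1 -> square z r (z' + s%:C * d)) ->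
    rnorm (d : R[i]^o) = r -> rnorm (edge g z' d) <= r * M.
  move=> gc zd dr; rewrite /edge rnormZ dr ler_wpM2l// Iv_norm// => s s01.
  by apply/gM/zd; lra.
have dr1 : rnorm (r%:C : R[i]^o) = r by rewrite cabsR ger0_norm.
have dr2 : rnorm (r *i : R[i]^o) = r.
  by rewrite cabsE/= expr0n/= add0r sqrtr_sqr ger0_norm.
have e1 := en z r%:C g1 (fun s h => let: And4 a _ _ _ := square_edges z r0 h in a) dr1.
have e2 := en _ _ g2 (fun s h => let: And4 _ a _ _ := square_edges z r0 h in a) dr2.
have e3 := en _ _ g3 (fun s h => let: And4 _ _ a _ := square_edges z r0 h in a) dr1.
have e4 := en _ _ g4 (fun s h => let: And4 _ _ _ a := square_edges z r0 h in a) dr2.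
rewrite /contour (le_trans (rnormB _ _))// (le_trans (lerD (rnormB _ _) (lexx _)))//.
rewrite (le_trans (lerD (lerD (rnormD _ _) (lexx _)) (lexx _)))//.
by rewrite (le_trans (lerD (lerD (lerD e1 e2) e3) e4))//; lra.
Qed.

Lemma contour_affine (a b : V) p z r :
  contour (fun w => a + (w - p) *: b) z r = 0.
Proof.
rewrite /contour !edge_affine !opprD !addrA.
rewrite [LHS](ACl ((1*5)*(3*7)*(2*4*6*8)))/= !subrr !add0r.
rewrite -!scaleNr -!scalerDl -[RHS](scale0r b); congr (_ *: _).
have -> : r *i = 'i%C * r%:C :> R[i] by simpc.
by rewrite /GRing.scale/=; field.
Qed.

Lemma contour_half g z r : 0 <= r -> {within square z r, continuous g} ->
  contour g z r =
    contour g z (r / 2) + contour g (z + (r / 2)%:C) (r / 2) +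
    (contour g (z + (r / 2) *i) (r / 2) +
     contour g (z + (r / 2)%:C + (r / 2) *i) (r / 2)).
Proof.
move=> r0 gc.
have hE (x : R[i]) : x + (r / 2)%:C + (r / 2)%:C = x + r%:C.
  by rewrite -addrA -rmorphD/= -splitr.
have hiE (x : R[i]) : x + (r / 2) *i + (r / 2) *i = x + r *i.
  by rewrite -addrA; congr (_ + _); simpc; rewrite -splitr.
have hC (x : R[i]) : x + (r / 2) *i + (r / 2)%:C = x + (r / 2)%:C + (r / 2) *i.
  by rewrite addrAC.
have hC' (x : R[i]) : x + (r / 2)%:C + (r / 2) *i + (r / 2)%:C = x + r%:C + (r / 2) *i.
  by rewrite addrAC hE.
have hiC (x : R[i]) : x + (r / 2)%:C + (r / 2) *i + (r / 2) *i = x + r *i + (r / 2)%:C.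
  by rewrite hiE addrAC.
have re2 : r%:C / 2 = (r / 2)%:C by rewrite rmorphM/= fmorphV/= rmorph_nat.
have im2 : r *i / 2 = (r / 2) *i.
  by rewrite -[2]/(2%:R) -(rmorph_nat (real_complex R)) -fmorphV/=; simpc.
have E1 := edge_half gc (fun s h => let: And4 a _ _ _ := square_edges z r0 h in a).
have E2 := edge_half gc (fun s h => let: And4 _ a _ _ := square_edges z r0 h in a).
have E3 := edge_half gc (fun s h => let: And4 _ _ a _ := square_edges z r0 h in a).
have E4 := edge_half gc (fun s h => let: And4 _ _ _ a := square_edges z r0 h in a).
rewrite /contour {}E1 {}E2 {}E3 {}E4 re2 im2 !hiC !hC' !hC !hE !hiE.
rewrite !opprD !addrA.
(* The four pairs are the inner edges, each traversed once in either direction; the remaining eight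
   terms are the half edges of the outer boundary. *)
rewrite [RHS](ACl (((2*8)*(3*9)*(7*13)*(10*16)) * (1*5*6*14*11*15*4*12)))/=.
by rewrite !subrr !addNr !add0r.
Qed.
End Goursat.

Section GoursatTheorem.
Context {R : realType} {V : completeNormedModType R[i]}.
Implicit Types (g : R[i]^o -> V) (z d w : R[i]^o) (r : R).

(** Complex differentiability with real radii and without a quotient, the form in which Goursat's
    estimate uses it; [cdiffP] relates it to difference quotients. *)
Definition cdiff g w := exists b : V, forall e : R, 0 < e -> exists2 d : R, 0 < d &
  forall h : R[i]^o, rnorm h < d ->
    rnorm (g (w + h) - g w - h *: b) <= e * rnorm h.

Lemma cdiff_continuous g w : cdiff g w -> {for w, continuous g}.
Proof.
move=> [b /(_ 1 ltr01)[d d0 gd]].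
apply/(@rcvgP _ _ _ (nbhs w)) => e e0.
have b1 : 0 < 1 + rnorm b by rewrite ltr_pwDl// rnorm_ge0.
have m0 : 0 < Num.min d (e / (1 + rnorm b)) by rewrite lt_min d0 divr_gt0.
have /rcvgP /(_ _ m0) : x @[x --> w] --> w by exact: cvg_id.
apply: filterS => x; rewrite lt_min => /andP[xd xe].
have := gd _ xd; rewrite mul1r [w + _]addrC subrK => gx.
have : rnorm (g x - g w) <= rnorm (x - w) + rnorm (x - w) * rnorm b.
  rewrite -rnormZ -[g x - g w](subrK ((x - w) *: b)).
  by rewrite (le_trans (rnormD _ _))// lerD.
move=> /le_lt_trans; apply; rewrite -{1}[rnorm _]mulr1 -mulrDr.
by rewrite -ltr_pdivlMr.
Qed.

Lemma square_sub z z' r r' : (forall w, square z' r' w -> square z r w) ->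
  forall g : R[i]^o -> V, {within square z r, continuous g} ->
  {within square z' r', continuous g}.
Proof. by move=> zz g; apply: continuous_subspaceW. Qed.

(** If every quarter had less than a fourth of the norm of the whole, [contour_half] would
    contradict the triangle inequality. *)
Lemma contour_bisect g z r : 0 <= r -> {within square z r, continuous g} ->
  exists2 z' : R[i]^o, (forall w, square z' (r / 2) w -> square z r w) &
    rnorm (contour g z r) <= 4 * rnorm (contour g z' (r / 2)).
Proof.
move=> r0 gc; apply: contrapT => /forall2NP H.
have {H} K z' : (forall w, square z' (r / 2) w -> square z r w) ->
    4 * rnorm (contour g z' (r / 2)) < rnorm (contour g z r).
  by move=> zz; have [//|/negP] := H z'; rewrite -ltNge.
have := contour_half r0 gc => E.
have k1 := K z; have k2 := K (z + (r / 2)%:C).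
have k3 := K (z + (r / 2) *i); have k4 := K (z + (r / 2)%:C + (r / 2) *i).
have {}k1 : 4 * rnorm (contour g z (r / 2)) < rnorm (contour g z r).
  by apply: k1 => -[u v]; case: (z) => x y; rewrite /square/=; lra.
have {}k2 : 4 * rnorm (contour g (z + (r / 2)%:C) (r / 2)) < rnorm (contour g z r).
  by apply: k2 => -[u v]; case: (z) => x y; rewrite /square/=; lra.
have {}k3 : 4 * rnorm (contour g (z + (r / 2) *i) (r / 2)) < rnorm (contour g z r).
  by apply: k3 => -[u v]; case: (z) => x y; rewrite /square/=; lra.
have {}k4 : 4 * rnorm (contour g (z + (r / 2)%:C + (r / 2) *i) (r / 2)) < rnorm (contour g z r).
  by apply: k4 => -[u v]; case: (z) => x y; rewrite /square/=; lra.
have : rnorm (contour g z r) <= rnorm (contour g z (r / 2))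
    + rnorm (contour g (z + (r / 2)%:C) (r / 2))
    + (rnorm (contour g (z + (r / 2) *i) (r / 2))
       + rnorm (contour g (z + (r / 2)%:C + (r / 2) *i) (r / 2))).
  by rewrite {1}E (le_trans (rnormD _ _))// lerD// rnormD.
lra.
Qed.

Lemma square_dist z r w w' : 0 <= r -> square z r w -> square z r w' ->
  rnorm (w - w') <= 2 * r.
Proof.
case: z w w' => [x y] [u v] [u' v']; rewrite /square/= => r0 [h1 h2] [h3 h4].
rewrite (le_trans (cabs_le _))//=.
have a : `|u - u'| <= r by rewrite ler_norml; lra.
have b : `|v - v'| <= r by rewrite ler_norml; lra.
lra.
Qed.

Theorem goursat g z r : 0 < r -> (forall w, square z r w -> cdiff g w) ->
  contour g z r = 0.
Proof.
move=> r0 gd.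
have gc : {within square z r, continuous g}.
  apply: continuous_in_subspaceT => w; rewrite inE => zw.
  exact/cdiff_continuous/gd.
(* The guards make bisection a total function on pairs of a corner and a side length, which can then
   be iterated. *)
have /choice[step stepP] : forall p : R[i]^o * R, exists q : R[i]^o * R,
    0 < p.2 -> {within square p.1 p.2, continuous g} -> [/\ q.2 = p.2 / 2,
      forall w, square q.1 q.2 w -> square p.1 p.2 w &
      rnorm (contour g p.1 p.2) <= 4 * rnorm (contour g q.1 q.2)].
  move=> [p s]/=.
  have [s0|] := pselect (0 < s); last by exists (p, s).
  have [pc|] := pselect {within square p s, continuous g}; last by exists (p, s).
  have [p' pp' gp'] := contour_bisect (ltW s0) pc.
  by exists (p', s / 2).
pose q n := iter n step (z, r).
have qP n : [/\ (q n).2 = r * 2^-1 ^+ n,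
    forall m, (m <= n)%N -> forall w, square (q n).1 (q n).2 w -> square (q m).1 (q m).2 w &
    rnorm (contour g z r) <= 4 ^+ n * rnorm (contour g (q n).1 (q n).2)].
  elim: n => [|n [IH1 IH2 IH3]].
    by rewrite !expr0 !mulr1 mul1r; split => // m; rewrite leqn0 => /eqP ->.
  have [||s1 s2 s3] := stepP (q n).
  - by rewrite IH1 mulr_gt0// exprn_gt0.
  - by apply: square_sub gc; exact: (IH2 0).
  split; first by rewrite [q n.+1]/= s1 IH1 exprSr mulrA.
    move=> m; rewrite leq_eqVlt => /predU1P[-> //|mn] w /s2.
    by apply: IH2; rewrite -ltnS.
  by rewrite (le_trans IH3)// exprSr -mulrA ler_wpM2l// exprn_ge0.
have qr0 n : 0 < (q n).2 by have [-> _ _] := qP n; rewrite mulr_gt0// exprn_gt0.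
have corner n : square (q n).1 (q n).2 (q n).1.
  by rewrite /square/=; have := qr0 n; lra.
(* The common point of the nested squares: in each coordinate, the supremum over the lower left
   corners, which the upper end of every square bounds. *)
have [w wq] : exists w, forall n, square (q n).1 (q n).2 w.
  have lim1 (p : R[i]^o -> R) :
      (forall z' s w, square z' s w -> p z' <= p w <= p z' + s) ->
      exists x, forall n, p (q n).1 <= x <= p (q n).1 + (q n).2.
    move=> pP; pose E := [set p (q n).1 | n in setT].
    have Eub m : ubound E (p (q m).1 + (q m).2).
      move=> _ [n _ <-]; have [mn|nm] := leqP m n.
        have [_ /(_ m mn) h _] := qP n.
        by have /pP := h _ (corner n); lra.
      have [_ /(_ n (ltnW nm)) h _] := qP m.
      by have /pP := h _ (corner m); have := qr0 m; lra.
    have Es : has_sup E.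
      split; first by exists (p (q 0).1), 0%N.
      by exists (p (q 0).1 + (q 0).2); exact: Eub.
    exists (sup E) => n; apply/andP; split.
      by apply: sup_upper_bound => //; exists n.
    by apply: sup_le_ub => //; case: Es.
  have [x xP] := lim1 (@complex.Re R) (fun _ _ _ h => proj1 h).
  have [y yP] := lim1 (@complex.Im R) (fun _ _ _ h => proj2 h).
  by exists (x +i* y) => n; split; [exact: xP|exact: yP].
have [b gb] := gd _ (wq 0).
apply/eqP; rewrite -rnorm_eq0 eq_le rnorm_ge0 andbT.
apply/ler_addgt0Pr => e e0; rewrite add0r.
(* A square of side s has perimeter 4 s and its points lie within 2 s of [w], so the remainder of
   the affine approximation contributes at most 8 e' s^2. For s = r / 2^n this absorbs the factor
   4^n exactly. *)
have e' : 0 < e / (8 * r ^+ 2) by rewrite divr_gt0// mulr_gt0// exprn_gt0.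
have [dl dl0 gdl] := gb _ e'.
have [n rn] : exists n, 2 * (q n).2 < dl.
  have /cvgrPdist_lt : 2^-1 ^+ n @[n --> \oo] --> (0 : R).
    by apply: cvg_expr; rewrite ger0_norm; lra.
  have d2 : 0 < dl / (2 * r) by rewrite divr_gt0// mulr_gt0.
  move=> /(_ _ d2)[n _ /(_ n (leqnn n))]; rewrite /= sub0r normrN => nd.
  exists n; have [-> _ _] := qP n; rewrite mulrA mulrC -ltr_pdivlMr ?mulr_gt0//.
  exact: le_lt_trans (ler_norm _) nd.
have [qn nw qc] := qP n.
have qgc : {within square (q n).1 (q n).2, continuous g}.
  by apply: square_sub gc; exact: (nw 0).
have affc : {within square (q n).1 (q n).2, continuous (fun w' => g w + (w' - w) *: b)}.
  apply: continuous_subspaceT => x; apply: (@cvgD _ _ _ (nbhs x) _ (fun=> g w));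
    first exact: cvg_cst.
  by apply: cvgZr_tmp; apply: (@cvgB _ R[i]^o); [exact: cvg_id|exact: cvg_cst].
have E : contour g (q n).1 (q n).2 =
    contour (fun w' => g w' - (g w + (w' - w) *: b)) (q n).1 (q n).2.
  by rewrite contourB ?contour_affine ?subr0// ltW.
have : rnorm (contour g (q n).1 (q n).2) <=
    4 * (q n).2 * (e / (8 * r ^+ 2) * (2 * (q n).2)).
  rewrite E contour_norm ?ltW//.
    move=> x; apply: cvgB; [exact: qgc|exact: affc].
  move=> x qx; have xw := square_dist (ltW (qr0 n)) qx (wq n).
  have := gdl (x - w) (le_lt_trans xw rn).
  rewrite [w + _]addrC subrK opprD addrA => /le_trans; apply.
  by rewrite ler_wpM2l// ltW.
move=> h; rewrite (le_trans qc)//.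
have {h} := ler_wpM2l (exprn_ge0 n (ler0n R 4)) h => /le_trans; apply.
rewrite qn le_eqVlt; apply/orP; left; apply/eqP.
have -> : 4 = 2 * 2 :> R by rewrite -natrM.
rewrite exprMn exprVn.
have r1 : r != 0 by rewrite gt_eqF.
have p2 : (2:R) ^+ n != 0 by rewrite expf_neq0.
by field; rewrite r1 p2.
Qed.

End GoursatTheorem.

Section GoursatClosed.
Context {R : realType} {V : completeNormedModType R[i]}.
Implicit Types (g : R[i]^o -> V) (z d w : R[i]^o) (r : R).

Lemma nbhs_rnormP {U : normedModType R[i]} (w : U) (P : set U) :
  nbhs w P <-> exists2 d : R, 0 < d & forall x, rnorm (x - w) < d -> P x.
Proof.
split=> [/(@nbhs_ballP _ U)[d /= + dP]|[d d0 dP]].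
  rewrite ltcE => /andP[/eqP /= di d0].
  have dE : d = (complex.Re d)%:C by case: d di {d0 dP} => a b /= ->.
  by exists (complex.Re d) => // x xw; apply: dP; rewrite dE rballE rdistC.
apply/(@nbhs_ballP _ U); exists d%:C; first by rewrite /= ltcR.
by move=> x; rewrite rballE rdistC => /dP.
Qed.

Lemma compact_square z r : 0 <= r -> compact (square z r).
Proof.
move=> r0.
pose f (z : R[i]^o) (p : R * R) : R[i]^o := z + (r * p.1)%:C + 'i%C * (r * p.2)%:C.
have -> : square z r = f z @` (`[0, 1] `*` `[0, 1]).
  apply/seteqP; split => [w|_ [[s t]/= [+ +] <-]]; rewrite /f/square/=.
    case: z w => [x y] [u v]/= [h1 h2].
    have [rE|rn0] := eqVneq r 0.
      exists (0, 0) => /=; first by rewrite in_itv/= lexx ler01.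
      by rewrite !mulr0; simpc; congr (_ +i* _); lra.
    have rp : 0 < r by rewrite lt_neqAle eq_sym rn0.
    exists ((u - x) / r, (v - y) / r) => /=.
      have h3 : 0 <= (u - x) / r <= 1.
        by rewrite ler_pdivrMr// mul1r divr_ge0 ?(ltW rp)//=; lra.
      have h4 : 0 <= (v - y) / r <= 1.
        by rewrite ler_pdivrMr// mul1r divr_ge0 ?(ltW rp)//=; lra.
      by rewrite !in_itv.
    by rewrite ![r * _]mulrC !divfK//; simpc; congr (_ +i* _); lra.
  rewrite !in_itv/= => /andP[s0 s1] /andP[t0 t1].
  have rs : 0 <= r * s <= r by rewrite mulr_ge0//= ler_piMr.
  have rt : 0 <= r * t <= r by rewrite mulr_ge0//= ler_piMr.
  by case: z => x y /=; split; lra.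
apply: continuous_compact; last by apply: compact_setX; exact: segment_compact.
apply: continuous_subspaceT => p; apply: (@cvgD _ R[i]^o); last first.
  apply: (@cvgM R[i]); first exact: cvg_cst.
  apply: (@continuous_comp _ _ _ (fun p : R * R => r * p.2) (fun s : R => s%:C : R[i]^o)).
    by apply: cvgM; [exact: cvg_cst|exact: cvg_snd].
  exact: continuous_real_complex.
apply: (@cvgD _ R[i]^o); first exact: cvg_cst.
apply: (@continuous_comp _ _ _ (fun p : R * R => r * p.1) (fun s : R => s%:C : R[i]^o)).
  by apply: cvgM; [exact: cvg_cst|exact: cvg_fst].
exact: continuous_real_complex.
Qed.

Lemma compact_unif {U : normedModType R[i]} (K : set U) (g : U -> V) :
  compact K -> {within K, continuous g} -> forall e : R, 0 < e ->
  exists2 d : R, 0 < d & forall w w' : U, K w -> K w' -> rnorm (w - w') < d ->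
    rnorm (g w - g w') <= e.
Proof.
move=> /compact_near_coveringP/near_covering_withinP Kc gc e e0.
have H : \forall d \near (0:R)^'+, K `<=` (fun w : U => forall w' : U, K w' ->
   rnorm (w - w') < d -> rnorm (g w - g w') <= e).
  apply: (Kc _ _ (fun (d : R) (w : U) => forall w' : U, K w' ->
     rnorm (w - w') < d -> rnorm (g w - g w') <= e)) => x Kx.
  move/subspace_continuousP : gc => /(_ x Kx)/rcvgP => /(_ (e / 2)).
  rewrite divr_gt0// => /(_ isT).
  move=> /nbhs_rnormP [d0 d00 gd].
  exists (ball x (d0 / 2)%:C, [set d : R | d < d0 / 2]).
    split; first by apply: nbhsx_ballx; rewrite ltcR divr_gt0.
    by apply: nbhs_right_lt; rewrite divr_gt0.
  move=> [w d] [/=]; rewrite rballE rdistC => wx dd Kw w' Kw' ww'.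
  have gw : rnorm (g w - g x) < e / 2.
    by apply: gd => //; rewrite (lt_trans wx)// ltr_pdivrMr//; lra.
  have gw' : rnorm (g w' - g x) < e / 2.
    apply: gd => //; rewrite -[w' - x](subrKA w) addrC.
    rewrite (le_lt_trans (rnormD _ _))// [d0]splitr ltrD// rdistC.
    exact: lt_trans ww' dd.
  have -> : g w - g w' = (g w - g x) - (g w' - g x) by rewrite opprB addrA subrK.
  by rewrite (le_trans (rnormB _ _))// [e]splitr lerD// ltW.
have [d [d0 dP]] := filter_ex (filterI (nbhs_right_gt (0:R)) H).
by exists d => // w w' Kw Kw'; exact: dP.
Qed.

(** Composing with a contraction [m] towards the centre gives a function that is differentiable on
    the closed square, so its contour integral vanishes. By uniform continuity it is as close to [g]
    as desired. *)
Theorem goursat_closed g z r : 0 < r -> {within square z r, continuous g} ->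
  (forall w, complex.Re z < complex.Re w < complex.Re z + r ->
     complex.Im z < complex.Im w < complex.Im z + r -> cdiff g w) ->
  contour g z r = 0.
Proof.
move=> r0 gc gd; apply/eqP; rewrite -rnorm_eq0 eq_le rnorm_ge0 andbT.
apply/ler_addgt0Pr => e e0; rewrite add0r.
have e' : 0 < e / (4 * r) by rewrite divr_gt0// mulr_gt0.
have [d d0 gu] := compact_unif (@compact_square z r (ltW r0)) gc e'.
pose c : R[i]^o := z + (r / 2)%:C + (r / 2) *i.
(* Points of the square lie within 2 r of the centre, so [m] with this ratio moves them by less than
   [d]. *)
have [q [q0 q1 qd]] : exists q : R, [/\ 0 < q, q < 1 & (1 - q) * (2 * r) < d].
  have r2 : 0 < 2 * r by rewrite mulr_gt0.
  exists (1 - Num.min 2^-1 (d / (2 * r) / 2)); split.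
  - by rewrite subr_gt0 gt_min; apply/orP; left; lra.
  - by rewrite ltrBlDr ltrDl lt_min !divr_gt0//; apply/andP; split; lra.
  - rewrite opprB addrCA subrr addr0 -ltr_pdivlMr// gt_min; apply/orP; right.
    by rewrite ltr_pdivrMr// ltr_pMr ?divr_gt0//; lra.
pose m (w : R[i]^o) : R[i]^o := c + q%:C * (w - c).
have mint w : square z r w ->
    complex.Re z < complex.Re (m w) < complex.Re z + r /\
    complex.Im z < complex.Im (m w) < complex.Im z + r.
  rewrite /m /c /square; case: (z) w => [x y] [u v] /= [h1 h2].
  by split; nra.
have msq w : square z r w -> square z r (m w).
  by move=> /mint; rewrite /square/=; lra.
have cz : square z r c.
  by rewrite /c /square; case: (z) => [x y] /=; split; lra.
have md w : square z r w -> cdiff (g \o m) w.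
  move=> zw; have [m1 m2] := mint _ zw; have [b bP] := gd _ m1 m2.
  exists (q%:C *: b) => e1 e10; have [d1 d10 bd] := bP _ e10.
  exists d1 => // h hd.
  have qh : rnorm (q%:C * h : R[i]^o) = q * rnorm h.
    by rewrite cabsM cabsR ger0_norm// ltW.
  have qh1 : q * rnorm h <= rnorm h by rewrite ler_piMl ?rnorm_ge0// ltW.
  have := bd (q%:C * h); rewrite qh => /(_ (le_lt_trans qh1 hd)) H.
  rewrite scalerA [h * _]mulrC /=.
  have -> : m (w + h) = m w + q%:C * h by rewrite /m; ring.
  by rewrite (le_trans H)// ler_wpM2l// ltW.
have mc : {within square z r, continuous (g \o m)}.
  by apply: continuous_in_subspaceT => w; rewrite inE => /md/cdiff_continuous.
have -> : contour g z r = contour (fun w => g w - (g \o m) w) z r.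
  by rewrite contourB ?(goursat r0 md) ?subr0// ltW.
have -> : e = 4 * r * (e / (4 * r)) by field; rewrite gt_eqF.
apply: contour_norm; [exact: ltW| |move=> w zw; apply: gu => //; first exact: msq].
  by move=> x; apply: cvgB; [exact: gc|exact: mc].
have -> : w - m w = (1 - q)%:C * (w - c) by rewrite /m rmorphB/=; ring.
rewrite cabsM cabsR ger0_norm; last by rewrite subr_ge0 ltW.
apply: le_lt_trans qd; rewrite ler_wpM2l ?subr_ge0 ?(ltW q1)//.
exact: square_dist (ltW r0) zw cz.
Qed.

End GoursatClosed.

(** * Complex derivatives of products, inverses and powers *)

Section ComplexDerivative.
Context {R : realType}.
Local Notation C := (R[i]^o).

Section Vector.
Context {V : completeNormedModType R[i]}.
Implicit Types (g F : C -> V) (w p : C).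

Lemma cdiffP g w : cdiff g w <->
  exists b : V, h^-1 *: (g (w + h) - g w) @[h --> (0 : C)^'] --> b.
Proof.
split=> -[b bP]; exists b.
  apply/(@rcvgP _ V _ ((0 : C)^')) => e e0.
  have [d d0 gd] := bP (e / 2) (divr_gt0 e0 (ltr0n _ 2)).
  apply/(@nbhs_rnormP _ C); exists d => // h; rewrite subr0 => hd h0.
  have hp : 0 < rnorm h by rewrite lt_neqAle rnorm_ge0 andbT eq_sym rnorm_eq0.
  have -> : h^-1 *: (g (w + h) - g w) - b = h^-1 *: (g (w + h) - g w - h *: b).
    by rewrite [RHS]scalerBr scalerA mulVf ?scale1r//.
  rewrite rnormZ cabsV mulrC ltr_pdivrMr// (le_lt_trans (gd _ hd))//.
  by rewrite ltr_pM2r//; lra.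
move=> e e0; move/(@rcvgP _ V _ ((0 : C)^')) : bP => /(_ _ e0).
move=> /(@nbhs_rnormP _ C)[d d0 gd]; exists d => // h hd.
have [->|h0] := eqVneq h 0.
  by rewrite addr0 subrr scale0r subr0 !rnorm0 mulr0.
have := gd h; rewrite subr0 => /(_ hd h0)/ltW H.
have -> : g (w + h) - g w - h *: b = h *: (h^-1 *: (g (w + h) - g w) - b).
  by rewrite scalerBr scalerA divff ?scale1r.
by rewrite rnormZ mulrC ler_wpM2r ?rnorm_ge0.
Qed.

(** The scalars are [R[i]], so in the derivative along 1 the increment already runs through all
    complex numbers. *)
Lemma derivable_cdiff g w : derivable g w 1 -> cdiff g w.
Proof.
move=> gd; apply/cdiffP; exists ('D_1 g w).
have -> : (fun h : C => h^-1 *: (g (w + h) - g w)) =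
    (fun h => h^-1 *: ((g \o shift w) (h *: 1) - g w)).
  by apply/funext => h /=; rewrite -[_%:A]/(h * 1) mulr1 [w + h]addrC.
exact: gd.
Qed.

Lemma cdiff_sub_cst F (u : V) w : cdiff F w -> cdiff (fun z => F z - u) w.
Proof.
move=> [b bP]; exists b => e /bP[d d0 H]; exists d => // h /H.
by rewrite opprB addrA subrK.
Qed.

Lemma eq_cdiff F g w : (\forall z \near w, F z = g z) -> cdiff F w -> cdiff g w.
Proof.
move=> /nbhs_rnormP[d1 d10 Fg] [b bP]; exists b => e /bP[d d0 H].
exists (Num.min d d1); first by rewrite lt_min d0 d10.
move=> h; rewrite lt_min => /andP[/H + hd1].
by rewrite -!Fg ?subrr ?rnorm0// [w + h]addrC addrK.
Qed.

End Vector.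

Section Scalar.
Implicit Types (w p : C).

Lemma cvg_shift_scalar (k : C -> Cx R) w : cdiff k w ->
  (k (w + h) : C) @[h --> (0 : C)^'] --> (k w : C).
Proof.
move=> /cdiff_continuous kc.
have H : w + h @[h --> (0 : C)^'] --> w.
  rewrite -{2}[w]addr0; apply: cvgD; first exact: cvg_cst.
  exact: (@nbhs_dnbhs C).
exact: (cvg_comp _ _ H kc).
Qed.

Lemma cdiff_scale {V : completeNormedModType R[i]} (k : C -> Cx R) (F : C -> V) w :
  cdiff k w -> cdiff F w ->
  cdiff (fun z => (k z : R[i]) *: F z) w.
Proof.
move=> kd Fd; have kc := cvg_shift_scalar kd.
move/cdiffP: kd => [k' kP]; move/cdiffP: Fd => [F' FP].
apply/cdiffP; exists ((k w : R[i]) *: F' + (k' : R[i]) *: F w).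
rewrite (_ : (fun h : C => _) = (fun h : C =>
    (k (w + h) : R[i]) *: (h^-1 *: (F (w + h) - F w)) +
    ((h^-1 : R[i]) * ((k (w + h) : R[i]) - k w)) *: F w)); last first.
  apply/funext => h; rewrite -[(h^-1 * _) *: _]scalerA.
  rewrite [k (w + h) *: (_ *: _)]scalerA [_ * h^-1]mulrC -scalerA -scalerDr.
  by congr (_ *: _); rewrite scalerBr scalerBl addrA subrK.
have kP' : ((h^-1 : R[i]) * ((k (w + h) : R[i]) - k w) : C) @[h --> (0 : C)^'] -->
    (k' : C) by exact: kP.
exact: (cvgD (cvgZ kc FP) (cvgZr_tmp (a := F w) kP')).
Qed.

Lemma cdiff_inv (p w : C) : w != p -> cdiff (fun z => (z - p)^-1 : Cx R) w.
Proof.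
move=> wp; apply/cdiffP; exists (- ((w - p) * (w - p))^-1 : Cx R).
have wp0 : w - p != 0 by rewrite subr_eq0.
have H : (w + h - p : C) @[h --> (0 : C)^'] --> (w - p : C).
  apply: cvgB; last exact: cvg_cst.
  rewrite -{2}[w]addr0; apply: cvgD; first exact: cvg_cst.
  exact: (@nbhs_dnbhs C).
have H2 : - ((w + h - p) * (w - p))^-1 @[h --> (0 : C)^'] --> - ((w - p) * (w - p))^-1.
  apply: (@cvgN _ C); apply: (@cvgV R[i]); first by rewrite mulf_neq0.
  by apply: (@cvgM R[i]) => //; exact: cvg_cst.
apply: cvg_trans H2; apply: near_eq_cvg.
have N : \forall h \near (0 : C)^', w + h - p != 0.
  have : \forall h \near (0 : C)^', rnorm ((w + h - p) - (w - p) : C) < rnorm (w - p : C).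
    by move/rcvgP : H; apply; rewrite lt_neqAle rnorm_ge0 andbT eq_sym rnorm_eq0.
  apply: filterS => h; apply: contraTneq => ->.
  by rewrite sub0r rnormN ltxx.
have N0 : \forall h \near (0 : C)^', h != 0 by exact: nbhs_dnbhs_neq.
apply: filterS2 N N0 => h hp h0.
by rewrite /GRing.scale/=; field; rewrite wp0 hp h0.
Qed.

Lemma cdiff_exp_scalar (k : C -> Cx R) n w : cdiff k w ->
  cdiff (fun z => (k z : R[i]) ^+ n : Cx R) w.
Proof.
move=> kd; elim: n => [|n IH].
  exists 0 => e e0; exists 1 => // h _.
  by rewrite scaler0 subrr subr0 rnorm0 mulr_ge0 ?rnorm_ge0 ?ltW.
have -> : (fun z => (k z : R[i]) ^+ n.+1 : Cx R) =
    (fun z => (k z : R[i]) *: ((k z : R[i]) ^+ n : Cx R)).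
  by apply/funext => z; rewrite exprS.
exact: cdiff_scale.
Qed.

End Scalar.
End ComplexDerivative.

(** * The exponential and Bessel's inequality *)

Section ComplexExponential.
Context {R : realType}.
Local Notation C := (R[i]^o).

Definition cis (x : R) : C := cos x +i* sin x.

Definition cexp (z : C) : C := (expR (complex.Re z))%:C * cis (complex.Im z).

Lemma cisD x y : cis (x + y) = cis x * cis y.
Proof. by rewrite /cis cosD sinD; simpc; rewrite [sin x * _]mulrC [_ + cos x * _]addrC. Qed.

Lemma cabs_cis x : rnorm (cis x) = 1.
Proof. by rewrite cabsE/= cos2Dsin2 sqrtr1. Qed.

Lemma cexpD z w : cexp (z + w) = cexp z * cexp w.
Proof.
case: z w => [x y] [u v]; rewrite /cexp/= expRD cisD rmorphM/=; ring.
Qed.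

Lemma cexp0 : cexp 0 = 1.
Proof. by rewrite /cexp/cis/= expR0 cos0 sin0 mul1r. Qed.

Lemma derive_expand (f : R -> R) (x d : R) : is_derive x 1 f d ->
  forall e : R, 0 < e -> exists2 r : R, 0 < r & forall h : R, `|h| < r ->
    `|f (x + h) - f x - d * h| <= e * `|h|.
Proof.
move=> [fd <-] e e0.
have /cvgrPdist_lt /(_ _ e0) := fd.
move=> /(@nbhs_ballP _ R)[r/= r0 H]; exists r => // h hr.
have [->|h0] := eqVneq h 0.
  by rewrite addr0 mulr0 subrr subr0 normr0 mulr0.
have := H h; rewrite /ball/= sub0r normrN => /(_ hr h0)/ltW.
rewrite -/('D_1 f x) => {}H.
have -> : f (x + h) - f x - 'D_1 f x * h =
    - (h * ('D_1 f x - h^-1 *: (f (h *: 1 + x) - f x))).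
  by rewrite /GRing.scale/= mulr1 [h + x]addrC; field.
by rewrite normrN normrM mulrC ler_wpM2r.
Qed.

Lemma cexp_derive0 : exists2 K : R, 0 < K & forall e : R, 0 < e ->
  exists2 r : R, 0 < r & forall h : C, rnorm h < r ->
    rnorm (cexp h - 1 - h) <= K * e * rnorm h.
Proof.
(* Any constant from 9 on would do: the four estimates below contribute 3, 1, 3 and 2. Capping [e]
   at 1 keeps the increment below 1, whence [expR a <= 3]. *)
exists 20 => // e e0.
have e1 : 0 < Num.min e 1 by rewrite lt_min e0/=.
have [r1 r10 H1] := derive_expand (is_derive_expR (0:R)) e1.
have [r2 r20 H2] := derive_expand (is_derive_cos (0:R)) e1.
have [r3 r30 H3] := derive_expand (is_derive_sin (0:R)) e1.
exists (Num.min (Num.min e 1) (Num.min r1 (Num.min r2 r3))).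
  by rewrite lt_min e1 !lt_min r10 r20 r30.
move=> h; rewrite lt_min => /andP[h1]; rewrite !lt_min => /andP[hr1 /andP[hr2 hr3]].
have ah := cabs_Re h; have bh := cabs_Im h.
move: h1 hr1 hr2 hr3 ah bh; set n := rnorm h; set a := complex.Re h; set b := complex.Im h.
move=> n1 nr1 nr2 nr3 an bn.
have := H1 a (le_lt_trans an nr1); have := H2 b (le_lt_trans bn nr2).
have := H3 b (le_lt_trans bn nr3).
rewrite !add0r expR0 cos0 sin0 oppr0 mul1r mul0r !subr0 !addr0 mul1r => S3 S2 S1.
set m := Num.min e 1 in n1 S1 S2 S3.
have me : m <= e by rewrite /m ge_min lexx.
have m1 : m <= 1 by rewrite /m ge_min lexx orbT.
have T1 : `|expR a - 1| <= 2 * n.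
  have -> : expR a - 1 = (expR a - 1 - a) + a by rewrite subrK.
  rewrite (le_trans (ler_normD _ _))// (le_trans (lerD S1 an))//.
  have : m * `|a| <= 1 * n by apply: ler_pM => //; exact: ltW.
  lra.
have T2 : expR a <= 3.
  by move: T1; rewrite ler_norml; lra.
have E : cexp h - 1 - h = (expR a * (cos b - 1) + (expR a - 1 - a)) +i*
    (expR a * (sin b - b) + (expR a - 1) * b).
  rewrite /cexp /cis -/a -/b [X in _ - X]complexE -/a -/b; simpc.
  by congr (_ +i* _); ring.
rewrite E (le_trans (cabs_le _))//=.
have n0 : 0 <= n by exact: rnorm_ge0.
have mb : m * `|b| <= m * n by rewrite ler_wpM2l// ltW.
have ma : m * `|a| <= m * n by rewrite ler_wpM2l// ltW.
have U1 : `|expR a * (cos b - 1)| <= 3 * (m * n).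
  rewrite normrM ger0_norm ?expR_ge0//.
  by apply: ler_pM => //; exact: le_trans S2 mb.
have U2 : `|expR a * (sin b - b)| <= 3 * (m * n).
  rewrite normrM ger0_norm ?expR_ge0//.
  by apply: ler_pM => //; exact: le_trans S3 mb.
have U3 : `|(expR a - 1) * b| <= 2 * (m * n).
  rewrite normrM (le_trans (ler_pM _ _ T1 bn))// -mulrA.
  by rewrite ler_pM2l// ler_wpM2r// ltW.
have W1 := ler_normD (expR a * (cos b - 1)) (expR a - 1 - a).
have W2 := ler_normD (expR a * (sin b - b)) ((expR a - 1) * b).
have W3 : m * n <= e * n by rewrite ler_wpM2r.
have W4 : 0 <= m * n by rewrite mulr_ge0// ltW.
have -> : 20 * e * n = 20 * (e * n) by rewrite mulrA.
have W5 := le_trans S1 ma.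
lra.
Qed.

(** The functional equation carries the expansion at 0 over to every point. *)
Lemma cdiff_cexp_scaled (c p w : C) : cdiff (fun z => cexp (c * (z - p)) : Cx R) w.
Proof.
have [K K0 HK] := cexp_derive0.
set y := cexp (c * (w - p)).
exists (y * c : Cx R) => e e0.
have ny : 0 <= rnorm (y : C) by exact: rnorm_ge0.
have nc : 0 <= rnorm (c : C) by exact: rnorm_ge0.
pose D := K * (rnorm (y : C) + 1) * (rnorm (c : C) + 1).
have D0 : 0 < D by rewrite !mulr_gt0// ltr_wpDl.
have [r r0 H] := HK (e / D) (divr_gt0 e0 D0).
have c1 : 0 < rnorm (c : C) + 1 by rewrite ltr_wpDl.
exists (r / (rnorm (c : C) + 1)); first by rewrite divr_gt0.
move=> h; rewrite ltr_pdivlMr// => hr.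
have nh : 0 <= rnorm h by exact: rnorm_ge0.
have ch : rnorm (c * h : C) <= (rnorm (c : C) + 1) * rnorm h.
  by rewrite cabsM ler_wpM2r// lerDl.
have {}H := H (c * h) (le_lt_trans ch _).
have {}H := H ltac:(by rewrite mulrC).
have -> : c * (w + h - p) = c * (w - p) + c * h by ring.
rewrite cexpD -/y.
have -> : (y * cexp (c * h) : Cx R) - y - h *: (y * c : Cx R) =
   y * (cexp (c * h) - 1 - c * h).
  by rewrite /GRing.scale/=; ring.
rewrite -[rnorm _]/(rnorm (y * (cexp (c * h) - 1 - c * h) : C)) cabsM.
have -> : e * rnorm (h : Cx R) =
    (rnorm (y : C) + 1) * (K * (e / D) * ((rnorm (c : C) + 1) * rnorm h)).
  rewrite /D -/(rnorm (h : C)); field.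
  by rewrite !gt_eqF// ltr_wpDl.
apply: ler_pM => //; [exact: rnorm_ge0|by rewrite lerDl|].
rewrite (le_trans H)// ler_wpM2l// mulr_ge0 ?(ltW K0)// ltW// divr_gt0//.
Qed.

End ComplexExponential.

Section Bessel.
Context {R : realType}.

Definition e1 (s : R) : R[i]^o := cis (pi *+ 2 * s).

Lemma cabs_e1 s : rnorm (e1 s) = 1.
Proof. exact: cabs_cis. Qed.

Lemma e1_half s : e1 (s / 2) ^+ 2 = e1 s :> R[i].
Proof. by rewrite expr2 /e1 -cisD; congr cis; field. Qed.

Lemma e1_halfS s : e1 ((1 + s) / 2) = - e1 (s / 2).
Proof.
rewrite /e1; have -> : pi *+ 2 * ((1 + s) / 2) = pi *+ 2 * (s / 2) + pi by field.
by rewrite /cis cosDpi sinDpi.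
Qed.

Lemma sum_double {W : zmodType} N (F : nat -> W) :
  \sum_(k < N.*2) F k = \sum_(l < N) (F l.*2 + F l.*2.+1).
Proof.
by elim: N => [|N IH]; rewrite ?big_ord0// doubleS !big_ord_recr/= IH addrA.
Qed.

Section Parseval.
Context {V : normedModType R[i]}.
Hypothesis parallelogram : forall x y : V,
  rnorm (x + y) ^+ 2 + rnorm (x - y) ^+ 2 = 2 * (rnorm x ^+ 2 + rnorm y ^+ 2).

(* One step of the fast Fourier transform: the even and odd frequencies of f
   are those of f0 + f1 and of a modulation of f0 - f1 on the two halves. *)
Lemma RS_parseval n (f : R -> V) :
  (\sum_(k < 2 ^ n) rnorm (RS n (fun s => e1 s ^+ k *: f s)) ^+ 2)%:C =
  RS n (fun s => (rnorm (f s) ^+ 2)%:C : R[i]^o).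
Proof.
elim: n f => [|n IH] f.
  by rewrite expn0 big_ord1/= expr0 scale1r.
pose f0 s := f (s / 2); pose f1 s := f ((1 + s) / 2).
pose p s := 2^-1 *: (f0 s + f1 s).
pose q s := (2^-1 * e1 (s / 2)) *: (f0 s - f1 s).
have even l : RS n.+1 (fun s => e1 s ^+ l.*2 *: f s) = RS n (fun s => e1 s ^+ l *: p s).
  rewrite /= -RSD -RSZ; apply: eq_RS => s _.
  rewrite e1_halfS -muln2 mulnC !exprM sqrrN !e1_half -scalerDr scalerA.
  by rewrite mulrC -scalerA.
have odd l : RS n.+1 (fun s => e1 s ^+ l.*2.+1 *: f s) = RS n (fun s => e1 s ^+ l *: q s).
  rewrite /= -RSD -RSZ; apply: eq_RS => s _.
  rewrite e1_halfS -muln2 mulnC !exprS !exprM sqrrN !e1_half mulNr scaleNr -scalerBr.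
  by rewrite /q !scalerA; congr (_ *: _); ring.
rewrite expnS mul2n (sum_double (2 ^ n)
  (fun k => rnorm (RS n.+1 (fun s => e1 s ^+ k *: f s)) ^+ 2)).
under eq_bigr do rewrite even odd.
rewrite big_split/= rmorphD/= !IH -!RSD -RSZ; apply: eq_RS => s _.
have h2 : rnorm (2^-1 : R[i]^o) = 2^-1 by rewrite cabsV -[2]/(2%:R) -(rmorph_nat (real_complex R)) cabsR normr_nat.
rewrite -!rmorphD/= /p /q !rnormZ cabsM cabs_e1 mulr1 h2 !exprMn -mulrDr parallelogram.
rewrite /GRing.scale/= -[2^-1 in RHS](_ : (2^-1)%:C = _); last first.
  by rewrite fmorphV/= rmorph_nat.
by rewrite -rmorphM/=; congr (_%:C); rewrite /f0 /f1; field.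
Qed.

Lemma RS_bessel n (f : R -> V) (M : R) : (forall s, 0 <= s < 1 -> rnorm (f s) <= M) ->
  \sum_(k < 2 ^ n) rnorm (RS n (fun s => e1 s ^+ k *: f s)) ^+ 2 <= M ^+ 2.
Proof.
move=> fM; have := RS_parseval n f; set S := \sum_(_ < _) _ => SE.
have S0 : 0 <= S by apply: sumr_ge0 => k _; rewrite exprn_ge0 ?rnorm_ge0.
have -> : S = rnorm (S%:C : R[i]^o) by rewrite cabsR ger0_norm.
rewrite SE; apply: RS_norm => s s01; rewrite cabsR ger0_norm ?exprn_ge0 ?rnorm_ge0//.
by rewrite ler_sqr ?nnegrE ?rnorm_ge0 ?fM// (le_trans _ (fM _ s01)) ?rnorm_ge0.
Qed.

End Parseval.

Lemma continuous_e1 : continuous e1.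
Proof.
move=> s; apply/(@rcvgP _ R[i]^o _ (nbhs s)).
have c1 : cos (pi *+ 2 * t) @[t --> s] --> cos (pi *+ 2 * s).
  apply: (@continuous_comp _ _ _ (fun t : R => pi *+ 2 * t) cos).
    by apply: cvgM; [exact: cvg_cst|exact: cvg_id].
  exact: continuous_cos.
have s1 : sin (pi *+ 2 * t) @[t --> s] --> sin (pi *+ 2 * s).
  apply: (@continuous_comp _ _ _ (fun t : R => pi *+ 2 * t) sin).
    by apply: cvgM; [exact: cvg_cst|exact: cvg_id].
  exact: continuous_sin.
move=> e e0; have e2 : 0 < e / 2 by rewrite divr_gt0.
move/cvgrPdist_lt : c1 => /(_ _ e2); move/cvgrPdist_lt : s1 => /(_ _ e2).
apply: filterS2 => t st ct; rewrite (le_lt_trans (cabs_le _))// [e]splitr.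
by rewrite ltrD//= distrC.
Qed.

Lemma continuous_e1X k : continuous (fun s => e1 s ^+ k : R[i]^o).
Proof.
elim: k => [|k IH] s; first by under eq_fun do rewrite expr0; exact: cvg_cst.
have -> : (fun s => e1 s ^+ k.+1 : R[i]^o) = (fun s => e1 s * e1 s ^+ k).
  by apply/funext => t; rewrite exprS.
exact: (@cvgM R[i] R (nbhs s) _ e1 (fun t => e1 t ^+ k) _ _ (@continuous_e1 s) (IH s)).
Qed.

Lemma within_scale {T : topologicalType} {V : normedModType R[i]} (A : set T)
    (k : T -> R[i]^o) (f : T -> V) :
  {within A, continuous k} -> {within A, continuous f} ->
  {within A, continuous (fun s => (k s : R[i]) *: f s)}.
Proof. by move=> kc fc s; exact: (cvgZ (kc s) (fc s)). Qed.

Lemma within_modulated {V : completeNormedModType R[i]} k (f : R -> V) :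
  {within `[0, 1], continuous f} ->
  {within `[0, 1], continuous (fun s => e1 s ^+ k *: f s)}.
Proof.
by move=> fc; apply: within_scale fc; apply: continuous_subspaceT; exact: continuous_e1X.
Qed.

(** The first [K] coefficients are among the 2^n ones of the discrete Parseval identity as soon as
    [K <= n]; the number of terms stays fixed while [n] tends to infinity. *)
Theorem bessel {V : completeNormedModType R[i]} (f : R -> V) (M : R) :
  (forall x y : V,
    rnorm (x + y) ^+ 2 + rnorm (x - y) ^+ 2 = 2 * (rnorm x ^+ 2 + rnorm y ^+ 2)) ->
  {within `[0, 1], continuous f} -> (forall s, 0 <= s < 1 -> rnorm (f s) <= M) ->
  forall K, \sum_(k < K) rnorm (Iv (fun s => e1 s ^+ k *: f s)) ^+ 2 <= M ^+ 2.
Proof.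
move=> par fc fM K.
have lim : \sum_(k < K) rnorm (RS n (fun s => e1 s ^+ k *: f s)) ^+ 2 @[n --> \oo]
    --> \sum_(k < K) rnorm (Iv (fun s => e1 s ^+ k *: f s)) ^+ 2.
  apply: cvg_big => [|k _]; first exact: add_continuous.
  apply: cvgM; apply: cvg_rnorm; apply: RS_cvg;
    exact: within_modulated.
apply: (closed_cvg (fun x => x <= M ^+ 2) _ _ _ lim); first exact: closed_le.
exists K => // n /= Kn; apply: le_trans (RS_bessel par n fM).
have Kn2 : (K <= 2 ^ n)%N by rewrite (leq_trans Kn)// ltnW// ltn_expl.
rewrite (big_ord_widen _ (fun k : nat => rnorm (RS n (fun s => e1 s ^+ k *: f s)) ^+ 2) Kn2).
rewrite [leRHS](bigID (fun k : 'I_(2 ^ n) => (k < K)%N))/= lerDl.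
by apply: sumr_ge0 => k _; rewrite exprn_ge0 ?rnorm_ge0.
Qed.

End Bessel.

(** * Cauchy's formula on the strip and the decomposition of u *)

Section LinearOperator.
Context {R : realType} {V : completeNormedModType R[i]}.
Variable A : linop V.

Lemma domD x y : dom A x -> dom A y -> dom A (x + y).
Proof. by move=> dx dy; rewrite -[x]scale1r; exact: domP. Qed.

Lemma domZ (c : R[i]) x : dom A x -> dom A (c *: x).
Proof. by move=> dx; rewrite -[_ *: _]addr0; apply: domP => //; exact: dom0. Qed.

Lemma opD x y : dom A x -> dom A y -> A (x + y) = A x + A y.
Proof. by move=> dx dy; rewrite -{1}[x]scale1r opP// scale1r. Qed.

Lemma op0 : A 0 = 0.
Proof.
by have := opD (dom0 A) (dom0 A); rewrite addr0 => /eqP; rewrite -{1}[A 0]addr0 (inj_eq (addrI _)) eq_sym => /eqP.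
Qed.

Lemma opZ (c : R[i]) x : dom A x -> A (c *: x) = c *: A x.
Proof. by move=> dx; rewrite -[_ *: x]addr0 opP//; [rewrite op0 addr0|exact: dom0]. Qed.

Lemma domN x : dom A x -> dom A (- x).
Proof. by rewrite -scaleN1r; exact: domZ. Qed.

Lemma opN x : dom A x -> A (- x) = - A x.
Proof. by move=> dx; rewrite -scaleN1r opZ// scaleN1r. Qed.

Lemma domB x y : dom A x -> dom A y -> dom A (x - y).
Proof. by move=> dx dy; apply: domD => //; exact: domN. Qed.

Lemma opB x y : dom A x -> dom A y -> A (x - y) = A x - A y.
Proof. by move=> dx dy; rewrite opD ?opN//; exact: domN. Qed.

Lemma dom_sum (J : Type) (r : seq J) (P : pred J) (f : J -> V) :
  (forall j, P j -> dom A (f j)) -> dom A (\sum_(j <- r | P j) f j).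
Proof.
by move=> df; elim/big_ind: _ => //; [exact: dom0|exact: domD].
Qed.

Lemma op_sum (J : Type) (r : seq J) (P : pred J) (f : J -> V) :
  (forall j, P j -> dom A (f j)) ->
  A (\sum_(j <- r | P j) f j) = \sum_(j <- r | P j) A (f j).
Proof.
move=> df; suff : dom A (\sum_(j <- r | P j) f j) /\
  A (\sum_(j <- r | P j) f j) = \sum_(j <- r | P j) A (f j) by case.
elim/big_ind2: _ => [|x x' y y' [dx <-] [dy <-]|j Pj].
- by split; [exact: dom0|exact: op0].
- by split; [exact: domD|exact: opD].
- by split; [exact: df|].
Qed.

Hypothesis Acl : closed_op (opp_linop A).

Lemma closed_cvg_dom {T : Type} {F : set_system T} {FF : ProperFilter F}
    (f : T -> V) (x y : V) : (forall t, dom A (f t)) ->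
  f t @[t --> F] --> x -> A (f t) @[t --> F] --> y -> dom A x /\ A x = y.
Proof.
move=> fd fx Afy.
have H : (f t, - A (f t)) @[t --> F] --> (x, - y).
  by apply: cvg_pair => //; exact: cvgN.
suff [/= dx /oppr_inj <-] : [set p | dom A p.1 /\ p.2 = - A p.1] (x, - y) by [].
apply: (closed_cvg _ Acl _ _ H).
by apply: nearW => t /=; split => //; exact: fd.
Qed.

(** [A] commutes with dyadic means. Closedness gives the limit because the means and their images
    both converge. *)
Lemma op_Iv (f : R -> V) : (forall s, 0 <= s < 1 -> dom A (f s)) ->
  {within `[0, 1], continuous f} -> {within `[0, 1], continuous (A \o f)} ->
  dom A (Iv f) /\ A (Iv f) = Iv (A \o f).
Proof.
move=> fd /RS_cvg fc /RS_cvg Afc.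
have fA n : dom A (RS n f) /\ A (RS n f) = RS n (A \o f).
  apply: (@RS_ind2 _ V V (fun x y => dom A x /\ A x = y)).
    move=> x x' y y' [dx <-] [dy <-]; split; first by apply/domZ/domD.
    by rewrite opZ ?opD//; exact: domD.
  by move=> s /fd.
apply: (@closed_cvg_dom _ \oo _ (RS ^~ f)) => //; first by move=> n; case: (fA n).
by under eq_fun do rewrite (proj2 (fA _)).
Qed.

End LinearOperator.

(** * Square-summable sequences and sums over windows *)

Section SquareSummable.
Context {R : realType}.
Implicit Types x y z : nat -> R.

Definition sqsum x := exists C : R, forall K, \sum_(k < K) x k ^+ 2 <= C.

Lemma sqsum_le2 (c : R) x y z : 0 <= c ->
  (forall k, 0 <= z k <= c * (x k + y k)) -> sqsum x -> sqsum y -> sqsum z.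
Proof.
move=> c0 zxy [Cx xC] [Cy yC]; exists (c ^+ 2 * (2 * Cx + 2 * Cy)) => K.
rewrite (@le_trans _ _ (c ^+ 2 * (2 * \sum_(k < K) x k ^+ 2 + 2 * \sum_(k < K) y k ^+ 2)))//.
  rewrite 2!(mulr_sumr _ _ _ 2) -big_split/= mulr_sumr; apply: ler_sum => k _.
  have /andP[z0 zk] := zxy k.
  have : z k ^+ 2 <= (c * (x k + y k)) ^+ 2 by rewrite ler_sqr// nnegrE (le_trans z0).
  move=> /le_trans; apply; rewrite exprMn ler_wpM2l ?exprn_ge0//.
  by have := sqr_ge0 (x k - y k); lra.
by rewrite ler_wpM2l ?exprn_ge0// lerD// ler_wpM2l.
Qed.

(** The kernel on the m-th unit window decays like the inverse of this weight, up to a constant; the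
    inverses telescope to a sum of at most 1. *)
Definition weight (m : nat) : R := (m.+1 * m.+2)%:R.

Lemma weight_gt0 m : 0 < weight m.
Proof. by rewrite ltr0n. Qed.

Lemma sum_weightV N : \sum_(m < N) (weight m)^-1 <= 1.
Proof.
suff -> : \sum_(m < N) (weight m)^-1 = 1 - (N.+1%:R)^-1 by rewrite gerBl invr_ge0.
elim: N => [|N IH]; first by rewrite big_ord0 invr1 subrr.
rewrite big_ord_recr/= IH /weight natrM; field.
by rewrite -natrD nat1r !pnatr_eq0.
Qed.

Lemma sqsum_weightV x : (forall k, 0 <= x k <= (weight k)^-1) -> sqsum x.
Proof.
move=> xw; exists 1 => K; apply: le_trans (sum_weightV K); apply: ler_sum => k _.
have /andP[x0 xk] := xw k; apply: le_trans xk; rewrite expr2 ler_piMl//.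
have /andP[_ /le_trans] := xw k; apply; rewrite invf_le1 ?weight_gt0//.
by rewrite ler1n.
Qed.

(** Cauchy-Schwarz for the factors weight^(-1/2) and weight^(1/2) x. The induction needs the sharper
    right-hand side that keeps the factor [\sum (weight m)^-1], which is at most 1. *)
Lemma weighted_cauchy_schwarz N x : (forall m, 0 <= x m) ->
  (\sum_(m < N) x m) ^+ 2 <= \sum_(m < N) weight m * x m ^+ 2.
Proof.
move=> x0; set B := \sum_(_ < N) _ * _.
have B0 M : 0 <= \sum_(m < M) weight m * x m ^+ 2.
  by apply: sumr_ge0 => m _; rewrite mulr_ge0 ?exprn_ge0// ltW// weight_gt0.
suff H : (\sum_(m < N) x m) ^+ 2 <= (\sum_(m < N) (weight m)^-1) * B.
  by apply: (le_trans H); apply: ler_piMl; [exact: B0|exact: sum_weightV].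
rewrite /B => {B}; elim: N => [|N IH]; first by rewrite !big_ord0 expr0n mul0r.
rewrite !big_ord_recr/=; move: IH (B0 N).
have A0 : 0 <= \sum_(m < N) (weight m)^-1.
  by apply: sumr_ge0 => m _; rewrite invr_ge0 ltW// weight_gt0.
have S0 : 0 <= \sum_(m < N) x m by apply: sumr_ge0.
move: A0 S0 (x0 N) (weight_gt0 N).
set S := \sum_(m < N) x m; set a := \sum_(_ < N) _^-1; set B := \sum_(_ < N) _.
set t := x N; set l := weight N => a0 S0 t0 l0 SaB BB0.
clearbody S a B t l.
(* Arithmetic-geometric mean: the product of the two terms on the right is a B t^2, which is at
   least S^2 t^2 by the induction hypothesis. *)
have key : 2 * S * t <= B / l + a * l * t ^+ 2.
  rewrite -ler_sqr ?nnegrE; last 2 first.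
  - by rewrite !mulr_ge0.
  - by rewrite addr_ge0 ?divr_ge0 ?mulr_ge0 ?exprn_ge0// ltW.
  apply: (@le_trans _ _ (4 * (a * B) * t ^+ 2)).
    have -> : (2 * S * t) ^+ 2 = 4 * S ^+ 2 * t ^+ 2 by ring.
    by rewrite ler_wpM2r ?exprn_ge0// ler_wpM2l.
  have <- : 4 * ((B / l) * (a * l * t ^+ 2)) = 4 * (a * B) * t ^+ 2.
    by field; rewrite lt0r_neq0.
  by have := sqr_ge0 (B / l - a * l * t ^+ 2); lra.
have -> : (S + t) ^+ 2 = S ^+ 2 + 2 * S * t + t ^+ 2 by ring.
have -> : (a + l^-1) * (B + l * t ^+ 2) = a * B + (B / l + a * l * t ^+ 2) + t ^+ 2.
  by field; rewrite lt0r_neq0.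
lra.
Qed.

(** Bessel bounds the coefficients of window [m] by (c / weight m)^2. Summing over windows by the
    weighted Cauchy-Schwarz inequality costs one factor [weight m], and c^2 / weight m is still
    summable. The height [T k] may vary with [k], since the bound is uniform up to the largest
    height. *)
Lemma sqsum_windows {V : completeNormedModType R[i]}
    (G : nat -> R -> V) (c : R) (T : nat -> nat) :
  (forall x y : V,
    rnorm (x + y) ^+ 2 + rnorm (x - y) ^+ 2 = 2 * (rnorm x ^+ 2 + rnorm y ^+ 2)) ->
  (forall m, {within `[0, 1], continuous (G m)}) ->
  (forall m s, 0 <= s < 1 -> rnorm (G m s) <= c / weight m) ->
  sqsum (fun k => rnorm (\sum_(m < T k) Iv (fun s => e1 s ^+ k *: G m s))).
Proof.
move=> par Gc Gb; exists (c ^+ 2) => K.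
pose b k m := rnorm (Iv (fun s => e1 s ^+ k *: G m s)).
have b0 k m : 0 <= b k m by exact: rnorm_ge0.
pose N := \max_(k < K) T k.
apply: (@le_trans _ _ (\sum_(k < K) \sum_(m < N) weight m * b k m ^+ 2)).
  apply: ler_sum => k _; apply: (@le_trans _ _ ((\sum_(m < T k) b k m) ^+ 2)).
    rewrite ler_sqr ?nnegrE ?rnorm_ge0//; last by apply: sumr_ge0.
    exact: rnorm_sum.
  apply: (le_trans (weighted_cauchy_schwarz _ (b0 k))).
  have TN : (T k <= N)%N by rewrite /N (leq_bigmax_cond (F := fun k : 'I_K => T k)).
  rewrite (big_ord_widen _ (fun m => weight m * b k m ^+ 2) TN).
  rewrite [leRHS](bigID (fun m : 'I_N => (m < T k)%N))/= lerDl.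
  by apply: sumr_ge0 => m _; rewrite mulr_ge0 ?exprn_ge0// ltW// weight_gt0.
rewrite exchange_big/=; apply: (@le_trans _ _ (\sum_(m < N) c ^+ 2 * (weight m)^-1)).
  apply: ler_sum => m _; rewrite -mulr_sumr.
  have := bessel par (Gc m) (Gb m) K; rewrite -/(b _ m) => H.
  rewrite (le_trans (ler_wpM2l (ltW (weight_gt0 m)) H))//.
  rewrite le_eqVlt; apply/orP; left; apply/eqP.
  by field; rewrite -natrD nat1r !pnatr_eq0.
by rewrite -mulr_sumr ler_piMr ?sqr_ge0// sum_weightV.
Qed.

End SquareSummable.

(** * Integrals along the boundary of a truncated strip *)

Section Tower.
Context {R : realType}.
Local Notation C := (R[i]^o).
Local Notation z0 := (2^-1 +i* 0 : C).

(* The boundary integral over [0, 1] x [- T, T], each vertical side being cut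
   at the integer heights; [e z d] stands for the integral from z to z + d. *)
Definition tower {W : zmodType} (e : C -> C -> W) (T : nat) : W :=
  e (0 +i* (- T%:R)) 1 - e (0 +i* T%:R) 1
  + \sum_(m < T) (e (1 +i* m%:R) (1 *i) + e (1 +i* (- m.+1%:R)) (1 *i))
  - \sum_(m < T) (e (0 +i* m%:R) (1 *i) + e (0 +i* (- m.+1%:R)) (1 *i)).

Definition punctured_strip : set C := [set z | 0 <= complex.Re z <= 1 /\ z != z0].

Definition tower_side (T : nat) (z d : C) : Prop :=
  [\/ z = 0 +i* (- T%:R) /\ d = 1, z = 0 +i* T%:R /\ d = 1,
      exists y, z = 1 +i* y /\ d = 1 *i | exists y, z = 0 +i* y /\ d = 1 *i].

Lemma neq_half (x y : R) : (x != 2^-1) || (y != 0) -> x +i* y != z0 :> C.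
Proof. by rewrite eq_complex/= negb_and. Qed.

Lemma tower_edges (T : nat) (z d : C) : (0 < T)%N -> tower_side T z d ->
  forall s : R, 0 <= s <= 1 -> punctured_strip (z + s%:C * d).
Proof.
move=> T0 zd s s01; have Tn0 : (T%:R : R) != 0 by rewrite pnatr_eq0 -lt0n.
case: zd => [[-> ->]|[-> ->]|[y [-> ->]]|[y [-> ->]]].
- rewrite mulr1/=; simpc; split=> //=; apply: neq_half.
  by rewrite oppr_eq0 Tn0 orbT.
- rewrite mulr1/=; simpc; split=> //=; apply: neq_half.
  by rewrite Tn0 orbT.
- simpc; split; first by rewrite /= ler01 lexx.
  by apply: neq_half; apply/orP; left; apply/eqP; lra.
- simpc; split; first by rewrite /= ler01 lexx.
  by apply: neq_half; apply/orP; left; apply/eqP; lra.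
Qed.

Lemma edgeB {V : completeNormedModType R[i]} (D : set C) (f g h : C -> V) z d :
  {within D, continuous f} -> {within D, continuous g} ->
  (forall w, D w -> h w = f w - g w) ->
  (forall s : R, 0 <= s <= 1 -> D (z + s%:C * d)) ->
  edge h z d = edge f z d - edge g z d.
Proof.
move=> fc gc hfg zD; rewrite /edge -scalerBr -IvB.
- by congr (_ *: _); apply: eq_Iv => s s01; apply/hfg/zD; lra.
- exact: within_edge zD.
- exact: within_edge zD.
Qed.

Lemma eq_tower {W : zmodType} (e e' : C -> C -> W) T :
  (forall z d, tower_side T z d -> e z d = e' z d) -> tower e T = tower e' T.
Proof.
move=> ee; rewrite /tower; congr (_ - _ + _ - _); try by apply: ee; constructor.
  apply: eq_bigr => m _; congr (_ + _); apply: ee; apply: Or43.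
    by exists m%:R.
  by exists (- m.+1%:R).
apply: eq_bigr => m _; congr (_ + _); apply: ee; apply: Or44.
  by exists m%:R.
by exists (- m.+1%:R).
Qed.

Lemma tower_morph {W W' : zmodType} (phi : W -> W') (e : C -> C -> W) T :
  {morph phi : x y / x + y} -> {morph phi : x / - x} -> phi 0 = 0 ->
  phi (tower e T) = tower (fun z d => phi (e z d)) T.
Proof.
move=> phiD phiN phi0; rewrite /tower 3!phiD !phiN !(big_morph phi phiD phi0).
by under eq_bigr do rewrite phiD; under [X in _ - X = _]eq_bigr do rewrite phiD.
Qed.

Lemma towerB {W : zmodType} (e e' : C -> C -> W) T :
  tower (fun z d => e z d - e' z d) T = tower e T - tower e' T.
Proof.
rewrite /tower.
under eq_bigr do rewrite addrACA -opprD.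
under [X in _ - X = _]eq_bigr do rewrite addrACA -opprD.
rewrite !sumrB !opprD !opprK !addrA.
by rewrite [LHS](ACl (1*3*5*7*2*4*6*8)).
Qed.

Lemma tower_scale {V : completeNormedModType R[i]} (k : C -> Cx R) (v : V) T :
  (0 < T)%N -> {within punctured_strip, continuous k} ->
  tower (edge (fun z => (k z : R[i]) *: v)) T = (tower (edge k) T : R[i]) *: v.
Proof.
move=> T0 kc; pose phi (x : Cx R) := (x : R[i]) *: v.
rewrite -[RHS]/(phi (tower (edge k) T)) tower_morph.
- apply: eq_tower => z d H.
  have /RS_cvg kE := within_edge kc (@tower_edges T z d T0 H).
  transitivity (d *: phi (Iv (fun s : R => k (z + s%:C * d)))); last exact: scalerA.
  congr (_ *: _); apply: cvg_Iv.
  under eq_fun do rewrite RS_scale.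
  exact: (cvgZr_tmp (a := v) kE).
- by move=> x y; exact: scalerDl.
- by move=> x; exact: scaleNr.
- exact: scale0r.
Qed.

(** Unit squares are stacked and their horizontal edges telescope. Cutting at integer heights puts
    the point 1/2 on the common edge of two squares and inside none, so [goursat_closed] will only
    need continuity there. *)
Lemma tower_eq0 {V : completeNormedModType R[i]} (g : C -> V) T :
  (forall y : R, 0 <= y \/ y + 1 <= 0 -> contour g (0 +i* y) 1 = 0) ->
  tower (edge g) T = 0.
Proof.
move=> gc; pose b (y : R) := edge g (0 +i* y) 1.
pose r (y : R) := edge g (1 +i* y) (1 *i).
pose l (y : R) := edge g (0 +i* y) (1 *i).
have H y : 0 <= y \/ y + 1 <= 0 -> r y - l y = b (y + 1) - b y.
  move=> /gc; rewrite /contour; simpc; rewrite -/(b _) -/(r _) -/(b _) -/(l _) => E.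
  have -> : r y - l y = (b y + r y - b (y + 1) - l y) + (b (y + 1) - b y).
    rewrite !addrA [RHS](ACl ((1 * 6) * (3 * 5) * 2 * 4))/=.
    by rewrite subrr addNr !add0r.
  by rewrite E add0r.
have up : \sum_(m < T) (r m%:R - l m%:R) = b T%:R - b 0.
  elim: T => [|T IH]; first by rewrite big_ord0 subrr.
  rewrite big_ord_recr/= IH H; last by left.
  by rewrite natr1 addrC addrA subrK.
have down : \sum_(m < T) (r (- m.+1%:R) - l (- m.+1%:R)) = b 0 - b (- T%:R).
  elim: (T) => [|N IH]; first by rewrite big_ord0 oppr0 subrr.
  rewrite big_ord_recr/= IH H; last by right; rewrite -natr1 opprD addrNK oppr_le0.
  by rewrite -natr1 opprD addrNK addrA subrK.
have -> : tower (edge g) T = b (- T%:R) - b T%:R + \sum_(m < T) (r m%:R - l m%:R)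
    + \sum_(m < T) (r (- m.+1%:R) - l (- m.+1%:R)).
  rewrite /tower -/(b _) -/(b _) -[LHS]addrA -[RHS]addrA; congr (_ + _).
  rewrite !big_split/= !sumrN opprD !addrA.
  by rewrite [LHS](ACl (1*3*2*4)).
rewrite up down; rewrite !addrA [LHS](ACl ((1 * 6) * (2 * 3) * (4 * 5)))/=.
by rewrite subrr addNr addNr !addr0.
Qed.
End Tower.

(** * The kernel and its winding constant *)

Section CauchyFormula.
Context {R : realType}.
Local Notation C := (R[i]^o).
Local Notation z0 := (2^-1 +i* 0 : C).

(* [E2pi] has period i and modulus e^pi on Re z = 1, e^(- pi) on Re z = 0;
   [decay] makes the kernel decay like 1 / y^2 on vertical lines. *)
Definition pole (z : C) : Cx R := (z - z0)^-1.
Definition decay (z : C) : Cx R := (z - (-1))^-1.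
Definition E2pi (z : C) : Cx R := cexp ((pi *+ 2)%:C * (z - z0)).

Lemma punctured_within {V : completeNormedModType R[i]} (g : C -> V) (D : set C) :
  (forall w, D w -> cdiff g w) -> {within D, continuous g}.
Proof.
move=> gd; apply: continuous_in_subspaceT => w; rewrite inE => Dw.
exact/cdiff_continuous/gd.
Qed.

Lemma cdiff_pole w : w != z0 -> cdiff pole w.
Proof. exact: cdiff_inv. Qed.

Lemma within_pole : {within @punctured_strip R, continuous pole}.
Proof. by apply: punctured_within => w [_ /cdiff_pole]. Qed.

Lemma cdiff_decay w : 0 <= complex.Re w -> cdiff decay w.
Proof.
move=> w0; apply: cdiff_inv; apply: contraTneq w0 => ->.
by rewrite /= oppr_ge0 -ltNge.
Qed.

Lemma E2pi_z0 : E2pi z0 = (1 : R[i]).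
Proof. by rewrite /E2pi subrr mulr0 cexp0. Qed.

Lemma E2pi_split (x y : R) :
  E2pi (x +i* y) = (expR (pi *+ 2 * (x - 2^-1)))%:C * e1 y :> R[i].
Proof. by rewrite /E2pi /cexp /e1; simpc. Qed.

Lemma Iv_ge (p : Cx R -> R) (k : R -> Cx R) (a : R) :
  {within `[0, 1], continuous k} -> continuous p ->
  (forall x y, p (2^-1 *: (x + y)) = (p x + p y) / 2) ->
  (forall s, 0 <= s < 1 -> a <= p (k s)) -> a <= p (Iv k).
Proof.
move=> /RS_cvg kc pc pD ak.
apply: (closed_cvg (fun x => a <= x) _ _ _ (cvg_comp _ _ kc (pc _))).
  exact: closed_ge.
apply: nearW => n /=; apply: (@RS_ind _ (Cx R) (fun x => a <= p x)) => // x y ax ay.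
by rewrite pD; lra.
Qed.

Lemma continuous_Re : continuous (@complex.Re R : Cx R -> R).
Proof.
move=> z; apply/(@cvgrPdist_lt R R _ (nbhs z)) => e e0.
apply/(@nbhs_rnormP _ (Cx R)); exists e => // x; rewrite rdistC.
by apply: le_lt_trans; case: z x => [a b] [c d]; exact: (cabs_Re ((a - c) +i* (b - d))).
Qed.

Lemma continuous_Im : continuous (@complex.Im R : Cx R -> R).
Proof.
move=> z; apply/(@cvgrPdist_lt R R _ (nbhs z)) => e e0.
apply/(@nbhs_rnormP _ (Cx R)); exists e => // x; rewrite rdistC.
by apply: le_lt_trans; case: z x => [a b] [c d]; exact: (cabs_Im ((a - c) +i* (b - d))).
Qed.

Lemma two_inv_re : 2^-1 = (2^-1)%:C :> R[i].
Proof. by rewrite fmorphV/= rmorph_nat. Qed.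

Lemma pole_ReIm (x y : R) :
  complex.Re (pole (x +i* y)) = (x - 2^-1) / ((x - 2^-1) ^+ 2 + y ^+ 2) /\
  complex.Im (pole (x +i* y)) = - y / ((x - 2^-1) ^+ 2 + y ^+ 2).
Proof. by rewrite /pole/= subr0; split => //; rewrite mulNr. Qed.

(** Every edge has the sign that its orientation favours, so the single edge from 1 to 1 + i already
    gives a bound that is uniform in [T]. *)
Lemma tower_ge (e : C -> C -> R) T (a : R) : (0 < T)%N ->
  0 <= e (0 +i* (- T%:R)) 1 -> e (0 +i* T%:R) 1 <= 0 ->
  (forall y, 0 <= e (1 +i* y) (1 *i)) -> (forall y, e (0 +i* y) (1 *i) <= 0) ->
  a <= e (1 +i* 0%:R) (1 *i) -> a <= tower e T.
Proof.
case: T => // T _ b1 b2 r l ar; rewrite /tower big_ord_recl.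
set S1 := \sum_(_ < T) _; set S2 := \sum_(_ < T.+1) _.
have S10 : 0 <= S1 by apply: sumr_ge0 => i _; rewrite addr_ge0.
have S20 : S2 <= 0.
  by rewrite -oppr_ge0 -sumrN; apply: sumr_ge0 => i _; rewrite oppr_ge0 -[leRHS]addr0 lerD.
have := r (- (@ord0 T).+1%:R); move: ar b1 b2; rewrite [nat_of_ord _]/=.
move: (e _ _) (e _ _) (e _ _) (e _ _) => x1 x2 x3 x4.
by clearbody S1 S2; clear r l; lra.
Qed.

(* The exact value is 2 pi i; a bound that is uniform in T suffices. *)
Lemma tower_pole T : (0 < T)%N -> 2 / 5 <= complex.Im (tower (edge pole) T).
Proof.
move=> T0; have Tn0 : 0 < (T%:R : R) by rewrite ltr0n.
have wi z d H := within_edge within_pole (@tower_edges _ T z d T0 H).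
have ReD (x y : Cx R) : complex.Re (2^-1 *: (x + y)) = (complex.Re x + complex.Re y) / 2.
  by case: x y => [a b] [c d]; rewrite two_inv_re /GRing.scale/= mul0r subr0 mulrC.
have ImD (x y : Cx R) : complex.Im (2^-1 *: (x + y)) = (complex.Im x + complex.Im y) / 2.
  by case: x y => [a b] [c d]; rewrite two_inv_re /GRing.scale/= mul0r addr0 mulrC.
have Imi (x : Cx R) : complex.Im ((1 *i : R[i]) *: x : Cx R) = complex.Re x.
  by case: x => a b; rewrite /GRing.scale/= mul0r mul1r add0r.
(* Here is the constant: between 1 and 1 + i the real part of [pole] is (1/2) / (1/4 + s^2), at
   least (1/2) / (5/4). *)
have bound (s : R) : 0 <= s -> s < 1 -> 2 / 5 <= 2^-1 / (2^-1 ^+ 2 + s ^+ 2).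
  move=> s0 s1; rewrite ler_pdivlMr; last by rewrite ltr_pwDl ?exprn_gt0 ?sqr_ge0.
  have : s ^+ 2 <= 1 by rewrite expr_le1// ltW.
  by lra.
have half1 : 1 - 2^-1 = 2^-1 :> R by field.
have b1 : 0 <= complex.Im (edge pole (0 +i* (- T%:R)) 1).
  rewrite /edge scale1r; apply: (Iv_ge _ continuous_Im ImD).
    by apply: wi; apply: Or41.
  move=> s _; have -> : 0 +i* (- T%:R) + s%:C * 1 = s +i* (- T%:R) :> C.
    by rewrite mulr1; simpc.
  have [_ ->] := pole_ReIm s (- T%:R).
  by rewrite opprK divr_ge0 ?addr_ge0 ?sqr_ge0.
have b2 : complex.Im (edge pole (0 +i* T%:R) 1) <= 0.
  rewrite -oppr_ge0 /edge scale1r.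
  apply: (@Iv_ge (fun x => - complex.Im x)).
  - by apply: wi; apply: Or42.
  - by move=> x; exact: (cvgN (@continuous_Im x)).
  - by move=> x y; rewrite ImD -mulNr opprD.
  move=> s _; have -> : 0 +i* T%:R + s%:C * 1 = s +i* T%:R :> C.
    by rewrite mulr1; simpc.
  have [_ ->] := pole_ReIm s T%:R.
  by rewrite mulNr opprK divr_ge0 ?addr_ge0 ?sqr_ge0.
have r (y a : R) : (forall s, 0 <= s < 1 -> a <= 2^-1 / (2^-1 ^+ 2 + (y + s) ^+ 2)) ->
    a <= complex.Im (edge pole (1 +i* y) (1 *i)).
  move=> H; rewrite /edge Imi; apply: (Iv_ge _ continuous_Re ReD).
    by apply: wi; apply: Or43; exists y.
  move=> s s01; have -> : 1 +i* y + s%:C * 1 *i = 1 +i* (y + s) :> C by simpc.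
  have [-> _] := pole_ReIm 1 (y + s).
  rewrite half1.
  exact: H.
have l (y : R) : complex.Im (edge pole (0 +i* y) (1 *i)) <= 0.
  rewrite -oppr_ge0 /edge Imi; apply: (@Iv_ge (fun x => - complex.Re x)).
  - by apply: wi; apply: Or44; exists y.
  - by move=> x; exact: (cvgN (@continuous_Re x)).
  - by move=> x x'; rewrite ReD -mulNr opprD.
  move=> s s01; have -> : 0 +i* y + s%:C * 1 *i = 0 +i* (y + s) :> C by simpc.
  have [-> _] := pole_ReIm 0 (y + s).
  by rewrite sub0r mulNr opprK divr_ge0 ?addr_ge0 ?sqr_ge0.
have rge0 y : 0 <= complex.Im (edge pole (1 +i* y) (1 *i)).
  by apply: r => s _; rewrite divr_ge0 ?addr_ge0 ?sqr_ge0.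
have r1 : 2 / 5 <= complex.Im (edge pole (1 +i* 0%:R) (1 *i)).
  by apply: r => s /andP[s0 s1]; rewrite add0r; exact: bound.
pose im (x : Cx R) := complex.Im x.
rewrite -/(im _) (@tower_morph _ _ _ im); last 3 first.
- by move=> [a b] [c d].
- by move=> [a b].
- by [].
exact: tower_ge.
Qed.

End CauchyFormula.

Section KMethod.
Context {R : realType} {V : completeNormedModType R[i]}.
Local Notation C := (R[i]^o).
Local Notation z0 := (2^-1 +i* 0 : C).

Section Identity.
Variable F : C -> V.
Hypothesis Fc : {within closed_strip, continuous F}.
Hypothesis Fd : forall z, open_strip z -> derivable F z 1.

Definition damped k (z : C) : V := (E2pi z ^+ k : R[i]) *: ((decay z : R[i]) *: F z).

(** [E2pi] equals 1 at 1/2: varying [k] shifts the weight between the two sides of the strip while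
    the represented vector stays the same. *)
Lemma damped_z0 k : damped k z0 = (decay z0 : R[i]) *: F z0.
Proof. by rewrite /damped E2pi_z0 expr1n scale1r. Qed.

Lemma cdiff_E2pi k w : cdiff (fun z => (E2pi z : R[i]) ^+ k : Cx R) w.
Proof. by apply: cdiff_exp_scalar; exact: cdiff_cexp_scaled. Qed.

Lemma cdiff_damped k w : open_strip w -> cdiff (damped k) w.
Proof.
move=> ow; apply: cdiff_scale; first exact: cdiff_E2pi.
apply: cdiff_scale; first by apply: cdiff_decay; case/andP: ow => /ltW.
exact/derivable_cdiff/Fd.
Qed.

Lemma within_damped k : {within closed_strip, continuous (damped k)}.
Proof.
apply: within_scale.
  by apply: (@punctured_within _ (Cx R)) => w _; exact: cdiff_E2pi.
apply: within_scale Fc.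
by apply: (@punctured_within _ (Cx R)) => w /andP[w0 _]; exact: cdiff_decay.
Qed.

(* b is the value at the removable singularity. *)
Definition quotient k (b : V) (z : C) : V :=
  if z == z0 then b else (pole z : R[i]) *: (damped k z - damped k z0).

Lemma quotientE k b z : z != z0 ->
  quotient k b z = (pole z : R[i]) *: (damped k z - damped k z0).
Proof. by rewrite /quotient => /negbTE ->. Qed.

Lemma near_neq (w z : C) : w != z -> \forall x \near w, x != z.
Proof.
move=> wz; apply/nbhs_rnormP; exists (rnorm (w - z)).
  by rewrite lt_neqAle rnorm_ge0 andbT eq_sym rnorm_eq0 subr_eq0.
by move=> x; apply: contraTneq => ->; rewrite rdistC ltxx.
Qed.

Lemma cdiff_quotient k b w : open_strip w -> w != z0 -> cdiff (quotient k b) w.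
Proof.
move=> ow wz.
apply: (@eq_cdiff _ _ (fun z => (pole z : R[i]) *: (damped k z - damped k z0))).
  by apply: filterS (near_neq wz) => x /quotientE ->.
apply: cdiff_scale; first exact: cdiff_pole.
by apply: cdiff_sub_cst; exact: cdiff_damped.
Qed.

(** The value [b] is the derivative of [damped k] at 1/2; at the other points the quotient is a
    product of continuous functions. *)
Lemma within_quotient k : exists b, {within closed_strip, continuous (quotient k b)}.
Proof.
have oz : open_strip z0 by rewrite /open_strip/=; apply/andP; split; lra.
have /cdiffP[b bP] := cdiff_damped k oz; exists b.
apply/subspace_continuousP => w cw.
change (quotient k b x @[x --> within closed_strip (nbhs w)] --> quotient k b w).
have [->|wz] := eqVneq w z0.
  apply/(@rcvgP _ V _ (within closed_strip (nbhs z0))) => e e0.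
  move/(@rcvgP _ V _ ((0 : C)^')) : bP => /(_ _ e0).
  move=> /(@nbhs_rnormP _ C)[d d0 H].
  apply/(@nbhs_rnormP _ C); exists d => // x xd _.
  have q0 : quotient k b z0 = b by rewrite /quotient eqxx.
  rewrite q0; have [->|xz] := eqVneq x z0.
    by rewrite q0 subrr rnorm0.
  have := H (x - z0); rewrite subr0 subr_eq0 => /(_ xd xz).
  by rewrite quotientE// [z0 + _]addrC subrK.
have H : (pole x : C) @[x --> within closed_strip (nbhs w)] --> (pole w : C).
  apply: cvg_within_filter; exact: (cdiff_continuous (cdiff_pole wz)).
have H2 : damped k x - damped k z0 @[x --> within closed_strip (nbhs w)] -->
    damped k w - damped k z0.
  apply: cvgB; last exact: cvg_cst.
  by have /subspace_continuousP := @within_damped k; exact.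
rewrite quotientE//; apply: cvg_trans (cvgZ H H2).
apply: near_eq_cvg; apply: cvg_within.
by apply: filterS (near_neq wz) => x /(quotientE k b) ->.
Qed.

Lemma tower_quotient k b T : {within closed_strip, continuous (quotient k b)} ->
  tower (edge (quotient k b)) T = 0.
Proof.
move=> qc; apply: tower_eq0 => y y0; apply: goursat_closed => //.
  apply: continuous_subspaceW qc => w [/= w1 _]; rewrite /closed_strip/=.
  by rewrite add0r in w1.
move=> w /=; rewrite add0r => w1 w2; apply: cdiff_quotient; first exact: w1.
apply: contraTneq w2 => -> /=.
by case: y0 => y0; apply/negP => /andP[]; lra.
Qed.

(** The difference quotient has zero boundary integral, so [damped k] may be replaced by its value
    at 1/2. The winding constant is left as the tower of [pole], which [tower_pole] keeps away from
    0. *)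
Lemma tower_cauchy k T : (0 < T)%N ->
  tower (edge (fun z => (pole z : R[i]) *: damped k z)) T =
  (tower (edge (@pole R)) T : R[i]) *: damped k z0.
Proof.
move=> T0; have [b qc] := within_quotient k.
apply/eqP; rewrite -subr_eq0 -tower_scale//; last exact: within_pole.
rewrite -towerB -(tower_quotient T qc); apply/eqP/eq_tower => z d zd.
have pw : {within @punctured_strip R, continuous (damped k)}.
  by apply: continuous_subspaceW (@within_damped k) => w [].
rewrite -(@edgeB _ _ (@punctured_strip R) _ _ (quotient k b)) //.
- by apply: within_scale pw; exact: within_pole.
- apply: within_scale; first exact: within_pole.
  by apply: continuous_subspaceT; exact: cst_continuous.
- by move=> w [_ wz]; rewrite quotientE// scalerBr.
- exact: tower_edges zd.
Qed.

End Identity.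
End KMethod.

(** * Square-summable decompositions of an element of the interpolation space *)

Section KDecomposition.
Context {R : realType} {V : completeNormedModType R[i]}.
Local Notation C := (R[i]^o).
Local Notation z0 := (2^-1 +i* 0 : C).
Variable A : linop V.
Hypothesis Acl : closed_op (opp_linop A).
Hypothesis par : forall x y : V,
  rnorm (x + y) ^+ 2 + rnorm (x - y) ^+ 2 = 2 * (rnorm x ^+ 2 + rnorm y ^+ 2).
Variable F : C -> V.
Hypothesis FC : calderon (graph_space A) F.

(** The integrand on a vertical side without the power of [E2pi]: there that power is a real
    constant times [e1 s ^+ k], and the integral becomes a Fourier coefficient. *)
Definition side (x y s : R) : V :=
  (pole (x +i* (y + s)) : R[i]) *:
    ((decay (x +i* (y + s)) : R[i]) *: F (x +i* (y + s))).

(** The two distances are at least (m + 1) / 3 and (m + 2) / 3: for [m] = 0 by the real parts, at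
    least 1/2 and 1, and otherwise by the imaginary part, which is at least [m]. *)
Lemma side_kernel_bound (x y : R) m : (x = 0) \/ (x = 1) -> m%:R <= `|y| ->
  rnorm (pole (x +i* y) : C) * rnorm (decay (x +i* y) : C) <= 9 / weight m.
Proof.
move=> x01 my; rewrite /pole /decay !cabsV.
have -> : (9 : R) / weight m = (3 / m.+1%:R) * (3 / m.+2%:R).
  by rewrite /weight natrM; field; rewrite -natrD nat1r !pnatr_eq0.
have b1 : m.+1%:R / 3 <= rnorm (x +i* y - z0 : C).
  have := cabs_Re (x +i* y - z0); have := cabs_Im (x +i* y - z0).
  rewrite /= subr0 => h1 h2.
  case: m my => [|m] my.
    apply: le_trans h2; rewrite ler_pdivrMr//.
    by case: x01 => ->; [rewrite sub0r normrN|]; rewrite ger0_norm; lra.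
  apply: le_trans h1; apply: le_trans my; rewrite ler_pdivrMr//.
  by rewrite -!natr1; have := ler0n R m; lra.
have b2 : m.+2%:R / 3 <= rnorm (x +i* y - (-1) : C).
  have -> : x +i* y - (-1) = (x + 1) +i* y :> C.
    by apply/eqP; rewrite eq_complex/= !opprK addr0 !eqxx.
  have /= h2 := cabs_Re ((x + 1) +i* y); have /= h1 := cabs_Im ((x + 1) +i* y).
  case: m my {b1} => [|m] my.
    apply: le_trans h2; rewrite ler_pdivrMr//.
    by case: x01 => ->; rewrite ger0_norm; lra.
  apply: le_trans h1; apply: le_trans my; rewrite ler_pdivrMr//.
  by rewrite -!natr1; have := ler0n R m; lra.
apply: ler_pM; rewrite ?invr_ge0 ?rnorm_ge0//.
  rewrite -[3 / _]invf_div lef_pV2 ?posrE ?divr_gt0//.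
  by apply: lt_le_trans b1; rewrite divr_gt0.
rewrite -[3 / _]invf_div lef_pV2 ?posrE ?divr_gt0//.
by apply: lt_le_trans b2; rewrite divr_gt0.
Qed.

Lemma within_vertical {W : topologicalType} (g : C -> W) (D : set C) (x y : R) :
  {within D, continuous g} -> (forall t, D (x +i* t)) ->
  {within `[0, 1], continuous (fun s => g (x +i* (y + s)))}.
Proof.
move=> gc xD.
have -> : (fun s => g (x +i* (y + s))) = g \o (fun s : R => x +i* y + s%:C * (1 *i) : C).
  by apply/funext => s /=; congr g; simpc.
apply: (within_comp gc) => [|s _].
  by apply: continuous_subspaceT; exact: continuous_affine_path.
by have := xD (y + s); simpc.
Qed.

Lemma punctured_side (x t : R) : (x = 0) \/ (x = 1) -> @punctured_strip R (x +i* t).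
Proof.
case=> ->; (split; first by rewrite /= ?lexx ?ler01);
  by apply: neq_half; apply/orP; left; apply/eqP; lra.
Qed.

Lemma strip_side (x t : R) : (x = 0) \/ (x = 1) -> @closed_strip R (x +i* t).
Proof. by case=> ->; rewrite /closed_strip/= ?lexx ?ler01. Qed.

Lemma within_decay : {within @closed_strip R, continuous (@decay R)}.
Proof. by apply: (@punctured_within _ (Cx R)) => w /andP[w0 _]; exact: cdiff_decay. Qed.

Lemma within_side x y : (x = 0) \/ (x = 1) -> {within `[0, 1], continuous (side x y)}.
Proof.
move=> x01; have [Fc _ _ _ _] := FC; apply: within_scale.
  apply: (@within_vertical (Cx R) _ _ _ _ (@within_pole R)) => t.
  exact: punctured_side.
apply: within_scale.
  by apply: (@within_vertical (Cx R) _ _ _ _ within_decay) => t; exact: strip_side.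
by apply: (within_vertical Fc) => t; exact: strip_side.
Qed.

Lemma calderon_bounds : exists M : R,
  [/\ 0 <= M, forall z, closed_strip z -> rnorm (F z) <= M &
      forall t, rnorm (A (F (1 +i* t))) <= M].
Proof.
have [_ [M1 H1] _ _ [[M2 H2] _]] := FC.
exists (Num.max M1 M2); split.
- by rewrite le_max (le_trans (rnorm_ge0 _) (H1 z0 _))// /closed_strip/=; lra.
- by move=> z /H1 h; rewrite le_max h.
- move=> t; rewrite le_max (le_trans _ (H2 t)) ?orbT//=.
  by rewrite lerDr rnorm_ge0.
Qed.

Lemma continuous_Aline : continuous (fun t : R => A (F (1 +i* t))).
Proof.
have [_ _ _ Fdom [_ FA]] := FC => t.
apply/(@rcvgP _ V _ (nbhs t)) => e e0.
have /cvgrPdist_lt /(_ _ e0) := FA t; apply: filterS => s /=.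
rewrite sub0r normrN opB; [apply: le_lt_trans|exact: Fdom|exact: Fdom].
by rewrite (le_trans _ (ler_norm _))// lerDr rnorm_ge0.
Qed.

Lemma side_dom y s : dom A (side 1 y s) /\
  A (side 1 y s) = (pole (1 +i* (y + s)) : R[i]) *:
    ((decay (1 +i* (y + s)) : R[i]) *: A (F (1 +i* (y + s)))).
Proof.
have [_ _ _ Fdom _] := FC; have dF := Fdom (y + s).
split; first by do 2 apply: domZ.
by rewrite !opZ//; exact: domZ.
Qed.

Lemma within_Aside y : {within `[0, 1], continuous (A \o side 1 y)}.
Proof.
have -> : A \o side 1 y = fun s => (pole (1 +i* (y + s)) : R[i]) *:
    ((decay (1 +i* (y + s)) : R[i]) *: A (F (1 +i* (y + s)))).
  by apply/funext => s; rewrite /= (proj2 (side_dom y s)).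
apply: within_scale.
  apply: (@within_vertical (Cx R) _ _ _ _ (@within_pole R)) => t.
  by apply: punctured_side; right.
apply: within_scale.
  apply: (@within_vertical (Cx R) _ _ _ _ within_decay) => t.
  by apply: strip_side; right.
apply: continuous_subspaceT => s.
apply: (@continuous_comp _ _ _ (fun s : R => y + s) (fun t : R => A (F (1 +i* t)))).
  by apply: cvgD; [exact: cvg_cst|exact: cvg_id].
exact: continuous_Aline.
Qed.

(** Bottoms of the windows [m, m + 1] and [- m - 1, - m]. Both stay at distance at least [m] from
    height 0, and being integers they do not affect [e1]. *)
Definition heights (up : bool) (m : nat) : R := if up then m%:R else - m.+1%:R.

Lemma heights_bound up m (s : R) : 0 <= s < 1 -> m%:R <= `|heights up m + s|.
Proof.
move=> s01; have := ler0n R m; rewrite /heights; case: up => m0.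
  by rewrite ger0_norm; lra.
by rewrite -natr1 ler0_norm; lra.
Qed.

Lemma e1_height up m s : e1 (heights up m + s) = e1 s :> R[i].
Proof.
have e1D (x y : R) : e1 (x + y) = e1 x * e1 y :> R[i] by rewrite /e1 mulrDr cisD.
have e11 : e1 1 = 1 :> R[i].
  by rewrite /e1 mulr1 /cis cos2pi -[pi *+ 2]add0r sinD2pi sin0.
have e1N : e1 (- 1) = 1 :> R[i].
  have := e1D 1 (-1); rewrite subrr e11 mul1r => <-.
  by rewrite /e1 mulr0 /cis cos0 sin0.
rewrite e1D; suff -> : e1 (heights up m) = 1 :> R[i] by rewrite mul1r.
rewrite /heights; case: up.
  elim: m => [|m IH]; first by rewrite /e1 mulr0 /cis cos0 sin0.
  by rewrite -natr1 e1D IH e11 mul1r.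
elim: m => [//|m IH]; by rewrite -natr1 opprD e1D IH e1N mul1r.
Qed.

Lemma side_bound (M : R) x up m s : (x = 0) \/ (x = 1) -> 0 <= s < 1 ->
  (forall z, closed_strip z -> rnorm (F z) <= M) ->
  rnorm (side x (heights up m) s) <= 9 * M / weight m.
Proof.
move=> x01 s01 FM; rewrite /side !rnormZ mulrA [leRHS]mulrAC.
apply: ler_pM; rewrite ?mulr_ge0 ?rnorm_ge0//.
  by apply: side_kernel_bound => //; exact: heights_bound.
by apply: FM; exact: strip_side.
Qed.

Lemma Aside_bound (M : R) up m s : 0 <= s < 1 ->
  (forall t, rnorm (A (F (1 +i* t))) <= M) ->
  rnorm (A (side 1 (heights up m) s)) <= 9 * M / weight m.
Proof.
move=> s01 AM; rewrite (proj2 (side_dom _ _)) !rnormZ mulrA [leRHS]mulrAC.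
apply: ler_pM; rewrite ?mulr_ge0 ?rnorm_ge0//.
by apply: side_kernel_bound; [right|exact: heights_bound].
Qed.

Definition fourier (x : R) (up : bool) (k m : nat) : V :=
  Iv (fun s => e1 s ^+ k *: side x (heights up m) s).

Lemma fourier_dom up k m : dom A (fourier 1 up k m) /\
  A (fourier 1 up k m) = Iv (fun s => e1 s ^+ k *: A (side 1 (heights up m) s)).
Proof.
have E : (fun s => e1 s ^+ k *: A (side 1 (heights up m) s)) =
    A \o (fun s => e1 s ^+ k *: side 1 (heights up m) s).
  by apply/funext => s; apply/esym/opZ; exact: (proj1 (side_dom _ _)).
rewrite E; apply: op_Iv => //.
- by move=> s _; apply: domZ; case: (side_dom (heights up m) s).
- by apply: within_modulated; apply: within_side; right.
- by rewrite -E; apply: (@within_modulated _ _ k (A \o side 1 (heights up m))); exact: within_Aside.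
Qed.

Definition damped_pole k (z : C) : V := (pole z : R[i]) *: damped F k z.

(** By the period of [E2pi] the character does not see the integer height; only the modulus e^(pi k)
    or e^(- pi k) of the side comes out. *)
Lemma edge_vertical x up k m : (x = 0) \/ (x = 1) ->
  edge (damped_pole k) (x +i* heights up m) (1 *i) =
  ((1 *i : R[i]) * ((expR (pi *+ 2 * (x - 2^-1))) ^+ k)%:C) *: fourier x up k m.
Proof.
move=> x01; rewrite /edge -scalerA; congr (_ *: _).
rewrite /fourier -IvZ; last by apply: within_modulated; exact: within_side.
apply: eq_Iv => s _.
have -> : x +i* heights up m + s%:C * (1 *i) = x +i* (heights up m + s) :> C by simpc.
rewrite /damped_pole /damped /side E2pi_split e1_height exprMn rmorphXn/=.
by rewrite !scalerA; congr (_ *: _); ring.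
Qed.

Lemma E2pi_bound k (x y : R) : 0 <= x <= 1 ->
  rnorm ((E2pi (x +i* y) : R[i]) ^+ k : C) <= expR pi ^+ k.
Proof.
move=> /andP[x0 x1]; rewrite cabsX lerXn2r ?nnegrE ?rnorm_ge0 ?expR_ge0//.
rewrite E2pi_split cabsM cabs_e1 mulr1 cabsR ger0_norm ?expR_ge0// ler_expR.
have p0 := pi_gt0 R; have px : pi * x <= pi :> R by rewrite ler_piMr// ltW.
by rewrite mulr2n; lra.
Qed.

Lemma within_damped_pole k : {within @punctured_strip R, continuous (damped_pole k)}.
Proof.
have [Fc _ _ _ _] := FC.
have pw : {within @punctured_strip R, continuous (damped F k)}.
  by apply: continuous_subspaceW (@within_damped _ _ _ Fc k) => w [].
by apply: within_scale pw; exact: within_pole.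
Qed.

(** [pole] is at most 1 / T on these edges and [decay] at most 1, while [E2pi ^+ k] may reach e^(pi
    k); hence the truncation height has to depend on [k]. *)
Lemma edge_horizontal (M : R) k T (y : R) : (0 < T)%N -> y = T%:R \/ y = - T%:R ->
  (forall z, closed_strip z -> rnorm (F z) <= M) ->
  rnorm (edge (damped_pole k) (0 +i* y) 1) <= expR pi ^+ k * M / T%:R.
Proof.
move=> T0 yT FM; have Tn0 : 0 < (T%:R : R) by rewrite ltr0n.
have ty : tower_side T (0 +i* y) 1 by case: yT => ->; [apply: Or42|apply: Or41].
have yn : `|y| = T%:R by case: yT => ->; rewrite ?normrN ger0_norm// ltW.
rewrite /edge scale1r; apply: Iv_norm.
  exact: (within_edge (@within_damped_pole k) (tower_edges T0 ty)).
move=> s s01; have -> : 0 +i* y + s%:C * 1 = s +i* y :> C by rewrite mulr1; simpc.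
have cs : @closed_strip R (s +i* y) by rewrite /closed_strip/=; lra.
rewrite /damped_pole /damped !rnormZ mulrC.
have h1 : rnorm (pole (s +i* y) : C) <= T%:R^-1.
  rewrite /pole cabsV lef_pV2 ?posrE//.
    by rewrite -yn; have := cabs_Im (s +i* y - z0); rewrite /= subr0.
  apply: (lt_le_trans Tn0).
  by rewrite -yn; have := cabs_Im (s +i* y - z0); rewrite /= subr0.
have h2 : rnorm (decay (s +i* y) : C) <= 1.
  have h : 1 <= rnorm (s +i* y - (-1) : C).
    have -> : s +i* y - (-1) = (s + 1) +i* y :> C.
      by apply/eqP; rewrite eq_complex/= !opprK addr0 !eqxx.
    by have /= := cabs_Re ((s + 1) +i* y); rewrite ger0_norm; lra.
  by rewrite /decay cabsV invf_le1// (lt_le_trans ltr01).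
have h3 := FM _ cs.
have h4 : rnorm (E2pi (s +i* y) ^+ k : C) <= expR pi ^+ k by apply: E2pi_bound; lra.
apply: ler_pM; rewrite ?mulr_ge0 ?rnorm_ge0//.
apply: ler_pM; rewrite ?mulr_ge0 ?rnorm_ge0//.
by rewrite -[leRHS]mul1r; apply: ler_pM; rewrite ?rnorm_ge0.
Qed.

Lemma tower_sum {W : zmodType} (e : C -> C -> W) T (r1 r2 l1 l2 : nat -> W) :
  (forall m, e (1 +i* heights true m) (1 *i) = r1 m) ->
  (forall m, e (1 +i* heights false m) (1 *i) = r2 m) ->
  (forall m, e (0 +i* heights true m) (1 *i) = l1 m) ->
  (forall m, e (0 +i* heights false m) (1 *i) = l2 m) ->
  tower e T = e (0 +i* (- T%:R)) 1 - e (0 +i* T%:R) 1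
  + (\sum_(m < T) r1 m + \sum_(m < T) r2 m) - (\sum_(m < T) l1 m + \sum_(m < T) l2 m).
Proof.
move=> er1 er2 el1 el2; rewrite /tower -!big_split/=; congr (_ + _ - _).
  by apply: eq_bigr => m _; rewrite -er1 -er2.
by apply: eq_bigr => m _; rewrite -el1 -el2.
Qed.

Theorem K_decomposition : exists p q : nat -> V,
  [/\ forall k, dom A (p k), forall k, F z0 = p k + q k,
      sqsum (fun k => expR (- pi) ^+ k * rnorm (p k)),
      sqsum (fun k => expR (- pi) ^+ k * rnorm (A (p k))) &
      sqsum (fun k => expR pi ^+ k * rnorm (q k))].
Proof.
have [M [M0 FM AM]] := calderon_bounds.
(* The height is such that a horizontal edge, bounded by e^(pi k) M / T, is still summable after the
   multiplication by e^(pi k) that the estimate of q_k requires. *)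
pose T k := (Num.truncn (M * expR pi ^+ k * expR pi ^+ k * weight k)).+1.
have TM k : expR pi ^+ k * (expR pi ^+ k * M / (T k)%:R) <= (weight k)^-1.
  have : M * expR pi ^+ k * expR pi ^+ k * weight k <= (T k)%:R.
    have x0 : 0 <= M * expR pi ^+ k * expR pi ^+ k * weight k.
      by rewrite !mulr_ge0 ?exprn_ge0 ?expR_ge0// ltW// weight_gt0.
    by have /andP[_ /ltW] := truncn_itv x0.
  move=> H; rewrite mulrA ler_pdivrMr ?ltr0n// [leRHS]mulrC ler_pdivlMr ?weight_gt0//.
  by apply: le_trans H; rewrite le_eqVlt; apply/orP; left; apply/eqP; ring.
have Tgt0 k : (0 < T k)%N by [].
pose c k : Cx R := tower (edge (@pole R)) (T k).
have c25 k : 2 / 5 <= rnorm (c k : C).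
  rewrite (le_trans (tower_pole (Tgt0 k)))// (le_trans (ler_norm _))//.
  exact: (cabs_Im (c k)).
have cn0 k : (c k : R[i]) != 0.
  by rewrite -(@rnorm_eq0 _ C) gt_eqF// (lt_le_trans _ (c25 k))//; lra.
pose d : C := z0 - (-1).
have dn0 : d != 0.
  by apply/eqP => /(congr1 (@complex.Re R))/=; rewrite opprK; lra.
(* [a k] undoes the winding constant and the factor [decay z0], the inverse of d = 3/2. Its modulus
   is at most (5/2)(3/2), hence at most 4. *)
pose a k : R[i] := (c k : R[i])^-1 * d.
have a4 k : rnorm (a k : C) <= 4.
  rewrite /a cabsM cabsV.
  have h1 : (rnorm (c k : C))^-1 <= 5 / 2.
    by rewrite -[5 / 2]invf_div lef_pV2 ?posrE// (lt_le_trans _ (c25 k)).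
  have h2 : rnorm (d : C) <= 3 / 2.
    rewrite (le_trans (cabs_le _))// /d /= !oppr0 opprK.
    by rewrite addr0 normr0 addr0 ger0_norm; lra.
  apply: (le_trans (ler_pM _ _ h1 h2)); rewrite ?invr_ge0 ?rnorm_ge0//; lra.
have ad k (v : V) : a k *: ((c k : R[i]) *: ((decay z0 : R[i]) *: v)) = v.
  rewrite !scalerA -[RHS]scale1r; congr (_ *: _).
  rewrite /a /decay -/d; move: (c k : R[i]) (d : R[i]) (cn0 k) dn0 => x y x0 y0.
  by field; rewrite x0 y0.
(* [P] collects the right side, where F takes values in the domain of [A], [L] the left side, and
   [H] the horizontal edges. *)
pose P k := \sum_(m < T k) fourier 1 true k m + \sum_(m < T k) fourier 1 false k m.
pose L k := \sum_(m < T k) fourier 0 true k m + \sum_(m < T k) fourier 0 false k m.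
pose H k := edge (damped_pole k) (0 +i* (- (T k)%:R)) 1
  - edge (damped_pole k) (0 +i* (T k)%:R) 1.
pose K1 k : R[i] := (1 *i : R[i]) * (expR pi ^+ k)%:C.
pose K0 k : R[i] := (1 *i : R[i]) * (expR (- pi) ^+ k)%:C.
have cauchy k : (c k : R[i]) *: ((decay z0 : R[i]) *: F z0) =
    H k + K1 k *: P k - K0 k *: L k.
  have [Fc _ Fd _ _] := FC.
  rewrite -(damped_z0 F k) -(tower_cauchy Fc Fd k (Tgt0 k)).
  have e1 : pi *+ 2 * (1 - 2^-1) = pi :> R by rewrite -mulr_natr; field.
  have e0 : pi *+ 2 * (0 - 2^-1) = - pi :> R by rewrite -mulr_natr; field.
  have v1 up m := edge_vertical up k m (or_intror (erefl (1 : R))).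
  have v0 up m := edge_vertical up k m (or_introl (erefl (0 : R))).
  have := @tower_sum V (edge (damped_pole k)) (T k) _ _ _ _ (v1 true) (v1 false)
    (v0 true) (v0 false).
  by rewrite e1 e0 -!scaler_sumr -!scalerDr => ->.
have K1n k : rnorm (K1 k : C) = expR pi ^+ k.
  by rewrite /K1 cabsM cabsi mul1r cabsR ger0_norm// exprn_ge0// expR_ge0.
have K0n k : rnorm (K0 k : C) = expR (- pi) ^+ k.
  by rewrite /K0 cabsM cabsi mul1r cabsR ger0_norm// exprn_ge0// expR_ge0.
have KK k : expR (- pi) ^+ k * expR pi ^+ k = 1 :> R.
  by rewrite -exprMn -expRD addNr expR0 expr1n.
have dP x up k m : x = 1 -> dom A (fourier x up k m).
  by move=> ->; case: (fourier_dom up k m).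
have Pdom k : dom A (P k) by apply: domD; apply: dom_sum => m _; exact: dP.
have sP x up : x = 0 \/ x = 1 ->
    sqsum (fun k => rnorm (\sum_(m < T k) fourier x up k m)).
  move=> x01; apply: (@sqsum_windows _ _ (fun m => side x (heights up m)) (9 * M)) => //.
    by move=> m; exact: within_side.
  by move=> m s s01; exact: side_bound.
have sAP up : sqsum (fun k => rnorm (A (\sum_(m < T k) fourier 1 up k m))).
  have -> : (fun k => rnorm (A (\sum_(m < T k) fourier 1 up k m))) =
      (fun k => rnorm (\sum_(m < T k) Iv (fun s => e1 s ^+ k *: A (side 1 (heights up m) s)))).
    apply/funext => k; rewrite op_sum; last by move=> m _; exact: dP.
    by congr rnorm; apply: eq_bigr => m _; rewrite (proj2 (fourier_dom _ _ _)).
  apply: (@sqsum_windows _ _ (fun m => A \o side 1 (heights up m)) (9 * M)) => //.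
    by move=> m; exact: within_Aside.
  by move=> m s s01; exact: Aside_bound.
(* Only the right side enters p_k; the truncation error [H] joins the left side in q_k, having been
   made small enough for the stronger weight. *)
exists (fun k => (a k * K1 k) *: P k), (fun k => a k *: (H k - K0 k *: L k)).
have em0 k : 0 <= expR (- pi) ^+ k :> R by rewrite exprn_ge0 ?expR_ge0.
have ep0 k : 0 <= expR pi ^+ k :> R by rewrite exprn_ge0 ?expR_ge0.
have scaled k (v : V) : expR (- pi) ^+ k * rnorm ((a k * K1 k) *: v) <= 4 * rnorm v.
  rewrite rnormZ cabsM K1n.
  have -> : expR (- pi) ^+ k * (rnorm (a k : C) * expR pi ^+ k * rnorm v) =
      (expR (- pi) ^+ k * expR pi ^+ k) * (rnorm (a k : C) * rnorm v) by ring.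
  by rewrite KK mul1r ler_wpM2r ?rnorm_ge0.
split.
- by move=> k; exact: domZ.
- move=> k; rewrite -{1}[F z0](ad k) cauchy -[(a k * _) *: _]scalerA -scalerDr.
  by congr (_ *: _); rewrite addrAC addrC.
- apply: (sqsum_le2 (c := 4) _ _ (sP 1 true _) (sP 1 false _)) => //; try by right.
  move=> k; rewrite mulr_ge0 ?rnorm_ge0//= (le_trans (scaled _ _))//.
  by rewrite ler_wpM2l// rnormD.
- apply: (sqsum_le2 (c := 4) _ _ (sAP true) (sAP false)) => // k.
  rewrite mulr_ge0 ?rnorm_ge0//= opZ// (le_trans (scaled _ _))// ler_wpM2l//.
  rewrite opD; first exact: rnormD.
    by apply: dom_sum => m _; exact: dP.
  by apply: dom_sum => m _; exact: dP.
pose y1 k := rnorm (\sum_(m < T k) fourier 0 true k m).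
pose y2 k := rnorm (\sum_(m < T k) fourier 0 false k m).
have hs : sqsum (fun k => y1 k + y2 k).
  apply: (sqsum_le2 (c := 1) _ _ (sP 0 true _) (sP 0 false _)) => //; try by left.
  by move=> k; rewrite mul1r lexx addr_ge0 ?rnorm_ge0.
have ws : sqsum (fun k => (@weight R k)^-1).
  by apply: sqsum_weightV => k; rewrite lexx invr_ge0 ltW// weight_gt0.
(* A factor 4 bounds [a k], and another 2 accounts for the two horizontal edges. *)
apply: (sqsum_le2 (c := 8) _ _ hs ws) => // k.
rewrite mulr_ge0 ?rnorm_ge0//= rnormZ.
have hH : expR pi ^+ k * rnorm (H k) <= 2 * (weight k)^-1.
  have e1 := edge_horizontal k (Tgt0 k) (or_intror erefl) FM.
  have e2 := edge_horizontal k (Tgt0 k) (or_introl erefl) FM.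
  have h1 := ler_wpM2l (ep0 k) e1; have h2 := ler_wpM2l (ep0 k) e2.
  rewrite (le_trans (ler_wpM2l (ep0 k) (rnormB _ _)))// mulrDr mulr_natl mulr2n.
  by rewrite lerD// (le_trans _ (TM k)).
have hL : expR pi ^+ k * rnorm (K0 k *: L k) <= y1 k + y2 k.
  rewrite rnormZ K0n mulrA [_ * expR (- pi) ^+ k]mulrC KK mul1r.
  exact: rnormD.
rewrite mulrCA (le_trans (ler_pM _ _ (a4 k) (ler_wpM2l (ep0 k) (rnormB _ _))))//.
- exact: rnorm_ge0.
- by rewrite mulr_ge0 ?rnorm_ge0.
have w0 : 0 <= (@weight R k)^-1 by rewrite invr_ge0 ltW// weight_gt0.
have yy : 0 <= y1 k + y2 k by rewrite addr_ge0 ?rnorm_ge0.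
rewrite mulrDr; move: hH hL w0 yy; clear.
set A1 := _ * rnorm (H k); set A2 := _ * rnorm (_ *: _); set A3 := _^-1.
move: A1 A2 A3 (y1 k) (y2 k) => A1 A2 A3 B1 B2; clear; lra.
Qed.

End KDecomposition.

(** * Square integrability and weak derivatives of explicit functions *)

Section Bochner.
Context {R : realType}.
Local Notation mu := (@lebesgue_measure R).

(* Measurability is not needed: the integral of a nonnegative function is a
   supremum over the simple functions below it. *)
Lemma ge0_le_integral_dominated (D : set (measurableTypeR R)) (f g : R -> \bar R) :
  (forall x, D x -> (0 <= f x)%E) -> (forall x, D x -> (f x <= g x)%E) ->
  (\int[mu]_(x in D) f x <= \int[mu]_(x in D) g x)%E.
Proof.
move=> f0 fg; rewrite !ge0_integralE//; last first.
  by move=> x Dx; rewrite (le_trans (f0 x Dx))// fg.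
apply: le_ereal_sup => _ /= [h hf <-]; exists h => // x.
rewrite (le_trans (hf x))// /patch; case: ifPn => // /set_mem; exact: fg.
Qed.

Context {V : normedModType R[i]}.
Implicit Types (Y : nsubspace V) (f psi h : R -> V).

Lemma simple_val_map (E : nat -> set R) (x : nat -> V) (s : seq nat) t :
  simple_val [seq (E i, x i) | i <- s] t = \sum_(i <- s) (\1_(E i) t : R)%:C *: x i.
Proof. by rewrite /simple_val big_map. Qed.

Lemma simple_fun_map {J : eqType} (a : R) Y (E : J -> set R) (x : J -> V) (s : seq J) :
  (forall i, i \in s -> [/\ measurable (E i : set (measurableTypeR R)),
     E i `<=` `]0, a[ & car Y (x i)]) ->
  simple_fun a Y [seq (E i, x i) | i <- s].
Proof.
elim: s => [_ p|i s IH H p]; first by rewrite in_nil.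
rewrite in_cons => /orP[/eqP ->/=|]; first by apply: H; rewrite in_cons eqxx.
by apply: IH => j js; apply: H; rewrite in_cons js orbT.
Qed.

Lemma strongly_measurable_continuous (a : R) Y f : 0 < a ->
  (forall t, 0 < t < a -> car Y (f t)) ->
  (forall t, 0 < t < a -> nrm Y (f t - f s) @[s --> t] --> (0 : R)) ->
  strongly_measurable a Y f.
Proof.
move=> a0 fY fc.
pose dl n : R := a / n.+1%:R.
have dl0 n : 0 < dl n by rewrite divr_gt0.
pose E n i : set R := [set t | i%:R * dl n <= t < i.+1%:R * dl n].
have Eitv n i : E n i = [set` `[i%:R * dl n, i.+1%:R * dl n[].
  by apply/seteqP; split => t; rewrite /E/= in_itv.
(* The cell at 0 is left out, as its sample would be [f 0], about which nothing is assumed. Every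
   [t] > 0 is outside that cell once the mesh is below [t]. *)
pose s n := [seq (E n i, f (i%:R * dl n)) | i <- iota 1 n].
have idl n i : (0 < i)%N -> (i <= n)%N -> 0 < i%:R * dl n < a.
  move=> i0 iN; rewrite mulr_gt0// ?ltr0n//= /dl mulrCA gtr_pMr// ltr_pdivrMr//.
  by rewrite mul1r ltr_nat.
exists s.
  move=> k; apply: simple_fun_map => i; rewrite mem_iota add1n ltnS => /andP[i0 ik].
  split.
  - by rewrite Eitv; exact: measurable_itv.
  - move=> t; rewrite /E/= in_itv/= => /andP[t1 t2].
    have /andP[h1 _] := idl k i i0 ik; rewrite (lt_le_trans h1 t1)/=.
    rewrite (lt_le_trans t2)// /dl mulrCA ger_pMr// ler_pdivrMr// mul1r ler_nat.
    by rewrite ltnS.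
  - by apply: fY; exact: idl.
apply: aeW => t t0a; split; first exact: fY.
have /andP[t0 ta] := t0a.
pose i n := Num.truncn (t / dl n).
have iP n : (i n)%:R * dl n <= t < (i n).+1%:R * dl n.
  have /truncn_itv : 0 <= t / dl n by rewrite divr_ge0 ?ltW.
  by rewrite ler_pdivlMr// ltr_pdivrMr.
have iN n : (i n <= n)%N.
  have /andP[h _] := iP n; rewrite -ltnS -(ltr_nat R) -(ltr_pM2r (dl0 n)).
  by rewrite (le_lt_trans h)// /dl mulrCA divff ?mulr1.
have sv n : (0 < i n)%N -> simple_val (s n) t = f ((i n)%:R * dl n).
  move=> i0; rewrite simple_val_map (bigD1_seq (i n)) ?iota_uniq//=; last first.
    by rewrite mem_iota i0 add1n ltnS iN.
  rewrite big1 ?addr0; last first.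
    move=> j jn; rewrite indicE memNset ?scale0r// /E/= => /andP[h1 h2].
    have /andP[h3 h4] := iP n.
    move/negP: jn; apply; rewrite eqn_leq; apply/andP; split.
      by rewrite -ltnS -(ltr_nat R) -(ltr_pM2r (dl0 n)) (le_lt_trans h1).
    by rewrite -ltnS -(ltr_nat R) -(ltr_pM2r (dl0 n)) (le_lt_trans h3).
  by rewrite indicE mem_set ?scale1r// /E/=; exact: iP.
have dlc : dl n @[n --> \oo] --> (0 : R).
  rewrite -[X in _ --> X](mulr0 a); apply: cvgM; first exact: cvg_cst.
  exact: (@cvg_harmonic R).
have ic : (i n)%:R * dl n @[n --> \oo] --> t.
  apply/cvgrPdist_lt => e e0; move/cvgrPdist_lt : dlc => /(_ _ e0).
  apply: filterS => n; rewrite sub0r normrN ger0_norm ?(ltW (dl0 n))//.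
  apply: le_lt_trans; have := iP n; rewrite -natr1 mulrDl mul1r => h.
  by rewrite ger0_norm; lra.
have i0 : \forall n \near \oo, (0 < i n)%N.
  move/cvgrPdist_lt : dlc => /(_ _ t0); apply: filterS => n.
  rewrite sub0r normrN ger0_norm ?(ltW (dl0 n))// => dt.
  rewrite lt0n; apply/negP => /eqP in0; have := iP n; rewrite in0 mul1r.
  by rewrite ltNge (ltW dt) andbF.
have := cvg_comp _ _ ic (fc t t0a); apply: cvg_trans; apply: near_eq_cvg.
by apply: filterS i0 => n /sv; rewrite /= => ->.
Qed.

Lemma strongly_measurable_full (a : R) f : 0 < a ->
  (forall t, 0 < t < a -> f s @[s --> t] --> f t) ->
  strongly_measurable a (full V) f.
Proof.
move=> a0 fc; apply: strongly_measurable_continuous => // t t0a.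
have : f t - f s @[s --> t] --> f t - f t by apply: cvgB; [exact: cvg_cst|exact: fc].
by move=> /cvg_rnorm; rewrite subrr rnorm0.
Qed.

(** The squared norm is at most the sum of [b j ^+ 2] times the indicator of [J j], whether or not
    these sets overlap, and this series is integrated term by term. *)
Lemma L2_dominated (a : R) Y f (J : nat -> set R) (m b : nat -> R) (C : R) :
  strongly_measurable a Y f -> (forall j, measurable (J j)) ->
  (forall j, (mu (J j) <= (m j)%:E)%E) -> (forall j, 0 <= b j) ->
  (forall t, 0 < t < a -> exists2 j, J j t & 0 <= nrm Y (f t) <= b j) ->
  (forall K, \sum_(j < K) b j ^+ 2 * m j <= C) ->
  L2 a Y f.
Proof.
move=> fs mJ Jm b0 fb bC; split => //.
pose D : set R := `]0%R, a[%classic.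
have mD : measurable D by exact: measurable_itv.
pose g j (t : R) : \bar R := ((b j ^+ 2)%:E * (\1_(J j) t)%:E)%E.
have g0 j t : (0 <= g j t)%E.
  by rewrite mule_ge0// lee_fin ?sqr_ge0// indicE.
have mg j : measurable_fun D (g j).
  apply: measurable_funeM; apply/measurable_EFinP.
  by apply: measurable_indic; exact: mJ.
have le1 : (\int[mu]_(t in `]0%R, a[) ((nrm Y (f t)) ^+ 2)%:E <=
    \int[mu]_(t in D) \big[+%E/0%R]_(0 <= j <oo) g j t)%E.
  apply: ge0_le_integral_dominated => t; first by rewrite lee_fin sqr_ge0.
  rewrite /= in_itv/= => /fb[j Jt /andP[n0 nb]].
  apply: (@le_trans _ _ (\sum_(0 <= i < j.+1) g i t)%E); last first.
    by apply: nneseries_lim_ge => i _ _.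
  rewrite big_nat_recr//=; apply: (@le_trans _ _ (g j t)); last first.
    by apply: leeDr; apply: sume_ge0.
  by rewrite /g indicE mem_set// mule1 lee_fin ler_sqr ?nnegrE.
apply: (le_lt_trans le1); rewrite integral_nneseries//.
apply: (@le_lt_trans _ _ C%:E); last exact: ltry.
apply: lime_le; first by apply: is_cvg_nneseries => n _ _; exact: integral_ge0.
apply: nearW => K; apply: (@le_trans _ _ (\sum_(j < K) b j ^+ 2 * m j)%:E); last first.
  by rewrite lee_fin.
rewrite big_mkord -sumEFin; apply: lee_sum => j _.
have mI : measurable_fun D (fun t => (\1_(J j) t)%:E : \bar R).
  by apply/measurable_EFinP; apply: measurable_indic; exact: mJ.
rewrite (ge0_integralZl mu mD mI) ?lee_fin ?sqr_ge0//.
rewrite integral_indic//; last exact: mJ.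
rewrite [X in (_ <= X)%E]EFinM.
apply: lee_wpmul2l; first by rewrite lee_fin sqr_ge0.
apply: le_trans (Jm j); apply: le_measure; rewrite ?inE//.
  by apply: measurableI => //; exact: mJ.
exact: mJ.
Qed.

End Bochner.

(** * Bochner integrals of finite sums of scalar functions times vectors *)

Section BochnerSums.
Import HBSimple.
Context {R : realType}.
Local Notation mu := (@lebesgue_measure R).
Variable a : R.
Local Notation D := (`]0%R, a[%classic : set R).

Let mD : measurable (D : set (measurableTypeR R)). Proof. exact: measurable_itv. Qed.

(** Real step functions in the same list form as vector-valued ones, so that multiplying the
    coefficients by a vector yields a simple function for [has_integral]. *)
Definition step_val (l : seq (set R * R)) (t : R) : R := \sum_(p <- l) p.2 * \1_(p.1) t.
Definition step_int (l : seq (set R * R)) : R := \sum_(p <- l) p.2 * fine (mu p.1).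

Definition step_list (l : seq (set R * R)) := forall p, p \in l ->
  measurable (p.1 : set (measurableTypeR R)) /\ p.1 `<=` D.

Lemma mu_sub_finite (E : set R) :
  measurable (E : set (measurableTypeR R)) -> E `<=` D -> mu E \is a fin_num.
Proof.
move=> mE ED; rewrite ge0_fin_numE//.
apply: (@le_lt_trans _ _ (mu D)); first by apply: le_measure; rewrite ?inE.
by rewrite lebesgue_measure_itv/=; case: ifP => // _; rewrite ltry.
Qed.

Lemma integrable_step1 (E : set R) (c : R) : measurable (E : set (measurableTypeR R)) -> E `<=` D ->
  mu.-integrable D (fun t => (c * \1_E t)%:E) /\
  (\int[mu]_(t in D) (c * \1_E t)%:E = (c * fine (mu E))%:E)%E.
Proof.
move=> mE ED.
have iE : mu.-integrable D (fun t => (\1_E t)%:E).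
  apply/integrableP; split.
    by apply/measurable_EFinP; apply: measurable_indic.
  under eq_integral do rewrite gee0_abs ?lee_fin ?indicE//.
  rewrite integral_indic; [|exact: mD|exact: mE].
  apply: (@le_lt_trans _ _ (mu E)).
    by apply: le_measure; rewrite ?inE//; exact: measurableI.
  by rewrite -ge0_fin_numE//; exact: mu_sub_finite.
split; first exact: (integrableZl mD c iE).
have -> : (\int[mu]_(t in D) (c * \1_E t)%:E = \int[mu]_(t in D) (c%:E * (\1_E t)%:E))%E by [].
rewrite integralZl// integral_indic; [|exact: mD|exact: mE].
rewrite [RHS]EFinM fineK; last exact: mu_sub_finite.
by congr (_ * mu _)%E; apply/seteqP; split => [t []//|t Et]; split => //; exact: ED.
Qed.

Lemma integral_step l : step_list l ->
  mu.-integrable D (fun t => (step_val l t)%:E) /\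
  (\int[mu]_(t in D) (step_val l t)%:E = (step_int l)%:E)%E.
Proof.
elim: l => [_|p l IH lP].
  have -> : (fun t => (step_val [::] t)%:E) = cst 0%E.
    by apply/funext => t; rewrite /step_val big_nil.
  by rewrite integral0 /step_int big_nil; split => //; exact: integrable0.
have [mp pD] : measurable (p.1 : set (measurableTypeR R)) /\ p.1 `<=` D by apply: lP; rewrite in_cons eqxx.
have [i1 e1] := integrable_step1 p.2 mp pD.
have [i2 e2] : mu.-integrable D (fun t => (step_val l t)%:E) /\
  (\int[mu]_(t in D) (step_val l t)%:E = (step_int l)%:E)%E.
  by apply: IH => q ql; apply: lP; rewrite in_cons ql orbT.
have E : (fun t => (step_val (p :: l) t)%:E) =
    (fun t => ((p.2 * \1_(p.1) t)%:E + (step_val l t)%:E)%E).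
  by apply/funext => t; rewrite /step_val big_cons EFinD.
rewrite E; split; first exact: integrableD.
by rewrite integralD// e1 e2 /step_int big_cons EFinD.
Qed.

Lemma sfun_step (g : {sfun (measurableTypeR R) >-> R}) : exists l, step_list l /\
  forall t, D t -> step_val l t = g t.
Proof.
pose r : seq R := finmap.enum_fset (fset_set (range g)).
exists [seq (g @^-1` [set y] `&` D, y) | y <- r]; split.
  elim: r => [p|y r IH p]; first by rewrite in_nil.
  rewrite in_cons => /orP[/eqP ->/=|]; last exact: IH.
  split; last by move=> t [].
  by apply: measurableI => //; exact: measurable_sfunP.
move=> t Dt; rewrite /step_val big_map [RHS]fimfunE fsbig_finite//=.
apply: eq_bigr => y _; congr (_ * _); rewrite !indicE; congr (_%:R); congr nat_of_bool.
by apply/idP/idP; rewrite !inE => // -[].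
Qed.

Context {V : normedModType R[i]}.

(** Scalar simple functions approximating each [th k] pointwise and in L^1, multiplied by the fixed
    vectors, are admissible in the definition of the Bochner integral; everything reduces to scalar
    integration. *)
Lemma has_integral_sum n (th : nat -> R -> R) (x : nat -> V) (v : nat -> R) :
  (forall k, mu.-integrable D (EFin \o th k)) ->
  (forall k, \int[mu]_(t in D) (th k t)%:E = (v k)%:E)%E ->
  has_integral a (fun t => \sum_(k < n) (th k t)%:C *: x k)
    (\sum_(k < n) (v k)%:C *: x k).
Proof.
move=> thi thv.
have /choice[l lP] : forall k, exists l : nat -> seq (set R * R),
    [/\ forall m, step_list (l m),
      forall t, D t -> step_val (l m) t @[m --> \oo] --> th k t &
      (\int[mu]_(t in D) `|(th k t)%:E - (step_val (l m) t)%:E|)%E @[m --> \oo] --> 0%E].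
  move=> k; have [g [gi gt gL]] := approximation_sfun_integrable mD (thi k).
  have /choice[l lP] := fun m => sfun_step (g m).
  exists l; split.
  - by move=> m; case: (lP m).
  - move=> t Dt.
    have /fine_cvgP[_] : (g m t)%:E @[m --> \oo] --> (th k t)%:E by exact: gt.
    apply: cvg_trans; apply: near_eq_cvg; apply: nearW => m /=.
    by rewrite (proj2 (lP m)).
  - apply: cvg_trans gL; apply: near_eq_cvg; apply: nearW => m /=.
    by apply: eq_integral => t; rewrite inE => Dt; rewrite (proj2 (lP m)).
(* The m-th approximation of the whole sum: the scalar lists, with coefficients turned into
   multiples of the vectors, are concatenated. *)
pose fix vl (n m : nat) {struct n} : seq (set R * V) := if n is n'.+1 then
  vl n' m ++ [seq (p.1, (p.2)%:C *: x n') | p <- l n' m] else [::].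
have vl_fun m : simple_fun a (full V) (vl n m).
  elim: n => [p|n' IH p]; first by rewrite in_nil.
  rewrite /= mem_cat => /orP[/IH//|].
  have [/(_ m) lm _ _] := lP n'; elim: (l n' m) lm => [_|q s IHs ls].
    by rewrite in_nil.
  rewrite in_cons => /orP[/eqP ->/=|].
    by have [|mq qD] := ls q; rewrite ?in_cons ?eqxx.
  by apply: IHs => p' p's; apply: ls; rewrite in_cons p's orbT.
have vl_val m t : simple_val (vl n m) t = \sum_(k < n) (step_val (l k m) t)%:C *: x k.
  rewrite /simple_val; elim: n {vl_fun} => [|n' IH]; first by rewrite big_nil big_ord0.
  rewrite big_ord_recr/= big_cat/= IH big_map; congr (_ + _).
  rewrite /step_val rmorph_sum/= scaler_suml; apply: eq_bigr => p _.
  by rewrite scalerA -rmorphM/= mulrC.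
have vl_int m : simple_int (vl n m) = \sum_(k < n) (step_int (l k m))%:C *: x k.
  rewrite /simple_int; elim: n {vl_fun vl_val} => [|n' IH]; first by rewrite big_nil big_ord0.
  rewrite big_ord_recr/= big_cat/= IH big_map; congr (_ + _).
  rewrite /step_int rmorph_sum/= scaler_suml; apply: eq_bigr => p _.
  by rewrite scalerA -rmorphM/= mulrC.
have scale_cvg (s : nat -> R) (r : R) (y : V) : s m @[m --> \oo] --> r ->
    (s m)%:C *: y @[m --> \oo] --> r%:C *: y.
  move=> sr; have := cvg_comp _ _ sr (@continuous_real_complex R r) => sC.
  exact: (cvgZr_tmp (a := y) sC).
exists (vl n); split => //.
- apply: aeW => t t0a; under eq_fun do rewrite vl_val.
  apply: cvg_big => [|k _]; first exact: add_continuous.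
  by apply: scale_cvg; case: (lP k) => _ + _; apply; rewrite /= in_itv.
- pose B m t : \bar R := (\sum_(k <- index_enum 'I_n)
    ((rnorm (x k))%:E * `|(th k t)%:E - (step_val (l k m) t)%:E|)%E)%R.
  have mB k m : measurable_fun D (fun t => `|(th k t)%:E - (step_val (l k m) t)%:E|%E).
    have /measurable_int H1 := thi k.
    have /measurable_int H2 := (integral_step (let: And3 a _ _ := lP k in a m)).1.
    by apply: measurableT_comp => //; exact: emeasurable_funB.
  have B0 : (\int[mu]_(t in D) B m t)%E @[m --> \oo] --> 0%E.
    have E m : (\int[mu]_(t in D) B m t = (\sum_(k <- index_enum 'I_n)
      ((rnorm (x k))%:E * \int[mu]_(t in D) `|(th k t)%:E - (step_val (l k m) t)%:E|)%E)%R)%E.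
      rewrite /B ge0_integral_sum//.
      + apply: eq_bigr => k _.
        by rewrite (ge0_integralZl mu mD (mB k m)) ?lee_fin ?rnorm_ge0.
      + move=> k; apply: measurable_funeM; exact: mB.
      + by move=> k t _; rewrite mule_ge0 ?lee_fin ?rnorm_ge0.
    under eq_fun do rewrite E.
    have Z : (\sum_(k <- index_enum 'I_n) ((rnorm (x k))%:E * 0)%E)%R = 0%E :> \bar R.
      by rewrite big1// => k _; rewrite mule0.
    have H := @cvg_nnesum _ \oo _ R 'I_n (index_enum 'I_n) (fun k m => (rnorm (x k))%:E *
      \int[mu]_(t in D) `|(th k t)%:E - (step_val (l k m) t)%:E|)%E
      (fun k => (rnorm (x k))%:E * 0)%E xpredT.
    rewrite Z in H; apply: H => k _.
      apply: nearW => m; rewrite mule_ge0 ?lee_fin ?rnorm_ge0//.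
      by apply: integral_ge0.
    by apply: cvgeZl => //; case: (lP k).
  apply: squeeze_cvge (cvg_cst 0%E) B0; apply: nearW => m.
  rewrite integral_ge0/=; last by move=> t _; rewrite lee_fin rnorm_ge0.
  apply: ge0_le_integral_dominated => t Dt; first by rewrite lee_fin rnorm_ge0.
  rewrite vl_val -sumrB /B; apply: (@le_trans _ _
    (\sum_(k < n) rnorm (x k) * `|th k t - step_val (l k m) t|)%:E).
    rewrite lee_fin (le_trans (rnorm_sum _ _ _))//; apply: ler_sum => k _.
    by rewrite -scalerBl -rmorphB/= rnormZ cabsR mulrC.
  by rewrite -sumEFin; apply: lee_sum => k _; rewrite EFinM.
- under eq_fun do rewrite vl_int.
  apply: cvg_big => [|k _]; first exact: add_continuous.
  apply: scale_cvg; have [ls _ lL] := lP k.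
  have H m : (`|(v k)%:E - (step_int (l k m))%:E| <=
      \int[mu]_(t in D) `|(th k t)%:E - (step_val (l k m) t)%:E|)%E.
    have [si se] := integral_step (ls m).
    rewrite -thv -se -integralB//; last exact: thi.
    apply: le_abse_integral => //.
    by apply: emeasurable_funB; [have /measurable_int := thi k|have /measurable_int := si].
  have : (`|(v k)%:E - (step_int (l k m))%:E|)%E @[m --> \oo] --> 0%E.
    by apply: squeeze_cvge (cvg_cst 0%E) lL; apply: nearW => m; rewrite abse_ge0/=; exact: H.
  move=> /fine_cvgP[_ /cvgrPdist_lt vs]; apply/cvgrPdist_lt => e /vs.
  apply: filterS => m; rewrite /= sub0r normrN; apply: le_lt_trans.
  exact: ler_norm.
Qed.

End BochnerSums.

(** * The lifting *)

Section Ramp.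
Context {R : realType}.
Implicit Types x y : R.

Definition hinge x : R := Num.max x 0.

Lemma hinge_ge x : 0 <= x -> hinge x = x.
Proof. by move=> x0; rewrite /hinge max_l. Qed.

Lemma hinge_le x : x <= 0 -> hinge x = 0.
Proof. by move=> x0; rewrite /hinge max_r. Qed.

(** The derivative 2 [hinge] is 2-Lipschitz, which is why the remainder is at most h^2 even across
    the kink. *)
Lemma hinge_sqr_taylor x h : `|hinge (x + h) ^+ 2 - hinge x ^+ 2 - 2 * hinge x * h| <= h ^+ 2.
Proof.
rewrite ler_norml; have [x0|x0] := leP 0 x; have [h0|h0] := leP 0 (x + h).
- by rewrite !hinge_ge//; apply/andP; split; nra.
- by rewrite (hinge_ge x0) (hinge_le (ltW h0)); apply/andP; split; nra.
- by rewrite (hinge_ge h0) (hinge_le (ltW x0)); apply/andP; split; nra.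
- by rewrite (hinge_le (ltW h0)) (hinge_le (ltW x0)); apply/andP; split; nra.
Qed.

Lemma is_derive_hinge_sqr x : is_derive x 1 (fun y => hinge y ^+ 2 : R) (2 * hinge x).
Proof.
have H : h^-1 *: (hinge (h *: 1 + x) ^+ 2 - hinge x ^+ 2 : R) @[h --> 0^'] --> 2 * hinge x.
  apply/cvgrPdist_le => e e0; near=> h.
  have h0 : h != 0 by near: h; exact: nbhs_dnbhs_neq.
  rewrite [h *: 1]mulr1 distrC -[X in `|_ - X|](mulKf h0) -[_ *: _]/(_ * _).
  rewrite -mulrBr normrM normfV ler_pdivrMl ?normr_gt0//.
  rewrite [h + x]addrC [h * _]mulrC; apply: (le_trans (hinge_sqr_taylor x h)).
  rewrite -real_normK ?num_real// expr2 ler_wpM2l//.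
  by near: h; apply: dnbhs0_le.
split; first by apply/cvg_ex; exists (2 * hinge x).
exact: cvg_lim H.
Unshelve. all: by end_near. Qed.

(* The C^1 quadratic spline that rises from 0 at x = 0 to 1 at x = 1. *)
Definition ramp x : R := 2 * hinge x ^+ 2 - 4 * hinge (x - 2^-1) ^+ 2 + 2 * hinge (x - 1) ^+ 2.
Definition dramp x : R := 4 * hinge x - 8 * hinge (x - 2^-1) + 4 * hinge (x - 1).

Let rampP x : [/\ 0 <= ramp x <= 1, `|dramp x| <= 2, x <= 0 -> ramp x = 0 /\ dramp x = 0
  & 1 <= x -> ramp x = 1 /\ dramp x = 0].
Proof.
rewrite ler_norml /ramp /dramp.
have [x0|x0] := leP x 0; first by rewrite !hinge_le; [split; lra|lra..].
have [x1|x1] := leP x 2^-1.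
  by rewrite (hinge_ge (ltW x0)) !hinge_le; [split; nra|lra..].
have [x2|x2] := leP x 1.
  by rewrite (hinge_ge (ltW x0)) (@hinge_ge (x - 2^-1)) ?hinge_le; [split; nra|lra..].
by rewrite !hinge_ge; [split; try lra; split; field|lra..].
Qed.

Lemma ramp01 x : 0 <= ramp x <= 1. Proof. by case: (rampP x). Qed.
Lemma dramp_norm x : `|dramp x| <= 2. Proof. by case: (rampP x). Qed.
Lemma ramp_le0 x : x <= 0 -> ramp x = 0. Proof. by case: (rampP x) => _ _ H _ /H[]. Qed.
Lemma ramp_ge1 x : 1 <= x -> ramp x = 1. Proof. by case: (rampP x) => _ _ _ H /H[]. Qed.
Lemma dramp_out x : (x <= 0) || (1 <= x) -> dramp x = 0.
Proof. by case: (rampP x) => _ _ H1 H2 /orP[/H1|/H2] []. Qed.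

Lemma is_derive_ramp_affine (c d t : R) :
  is_derive t 1 (fun r => ramp (c + d * r)) (d * dramp (c + d * t)).
Proof.
have H (b : R) : is_derive t 1 (fun r => hinge (b + d * r) ^+ 2 : R) (d * (2 * hinge (b + d * t))).
  have A : is_derive t 1 (fun r => b + d * r) d.
    by apply: is_derive_eq; rewrite -![_ *: _]/(_ * _); ring.
  have := @is_derive1_comp _ (fun y => hinge y ^+ 2 : R) (fun r => b + d * r) t _ _ (is_derive_hinge_sqr _) A.
  by rewrite mulrC.
have E b : (fun r => hinge (c + d * r - b) ^+ 2 : R) = (fun r => hinge (c - b + d * r) ^+ 2).
  by apply/funext => r; rewrite addrAC.
have H0 := H c; have H1 := H (c - 2^-1); have H2 := H (c - 1).
rewrite -E in H1; rewrite -E in H2.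
rewrite /ramp; apply: is_derive_eq.
by rewrite /dramp ![c + d * t - _]addrAC; rewrite -![_ *: _]/(_ * _); ring.
Qed.

Lemma continuous_hinge : continuous hinge.
Proof.
move=> x; apply: (@continuous_max R R id (fun=> 0)); [exact: cvg_id|exact: cvg_cst].
Qed.

Lemma continuous_dramp_affine (c d : R) : continuous (fun r => dramp (c + d * r)).
Proof.
have L b : continuous (fun r => hinge (c + d * r - b)).
  move=> t; apply: (@continuous_comp _ _ _ (fun r => c + d * r - b) hinge); last exact: continuous_hinge.
  apply: cvgB; last exact: cvg_cst.
  by apply: cvgD; [exact: cvg_cst|exact: mulrl_continuous].
have E : (fun r => dramp (c + d * r)) = (fun r => 4 * hinge (c + d * r - 0) -
    8 * hinge (c + d * r - 2^-1) + 4 * hinge (c + d * r - 1)).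
  by apply/funext => r; rewrite /dramp subr0.
rewrite E => t; apply: cvgD; first apply: cvgB.
all: apply: cvgM; [exact: cvg_cst|exact: L].
Qed.

End Ramp.

(** * Locally finite sums over geometric nodes *)

Section Layers.
Context {R : realType} {V : completeNormedModType R[i]}.
Variables (a r : R).
Hypotheses (a0 : 0 < a) (r01 : 0 < r < 1).
Implicit Types (s : R) (c : nat -> R -> R) (x z : nat -> V).

Let r0 : 0 < r. Proof. by case/andP: r01. Qed.
Let r1 : r < 1. Proof. by case/andP: r01. Qed.

(** The square makes [r ^+ k], up to a constant, the square root of the length of the k-th gap, that
    is, the weight of an L^2 norm there. Later r = e^(- pi). *)
Definition node (k : nat) : R := a * (r ^+ k) ^+ 2.
Definition gap (k : nat) : R := node k - node k.+1.

Lemma gapE k : gap k = a * (1 - r ^+ 2) * (r ^+ k) ^+ 2.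
Proof. by rewrite /gap /node [r ^+ k.+1]exprS; ring. Qed.

Lemma gap_gt0 k : 0 < gap k.
Proof.
rewrite gapE; have := exprn_gt0 k r0 => rk.
by rewrite !mulr_gt0// ?exprn_gt0// subr_gt0 expr_lt1// ltW.
Qed.

Lemma node0 : node 0 = a. Proof. by rewrite /node expr0 expr1n mulr1. Qed.

Lemma node_gt0 k : 0 < node k.
Proof. by rewrite /node mulr_gt0// !exprn_gt0. Qed.

Lemma node_nincr m k : (m <= k)%N -> node k <= node m.
Proof.
move=> mk; rewrite /node ler_pM2l// lerXn2r ?nnegrE ?exprn_ge0 ?(ltW r0)//.
by rewrite ler_wiXn2l// ltW.
Qed.

Lemma expr_eventually_lt e : 0 < e -> exists n, r ^+ n < e.
Proof.
move=> e0; have H : r ^+ n @[n --> \oo] --> (0 : R).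
  by apply: cvg_expr; rewrite ger0_norm// ltW.
move/cvgrPdist_lt : H => /(_ e e0) [n _ /(_ n (leqnn n))].
by rewrite /= sub0r normrN ger0_norm ?exprn_ge0 ?ltW// => ?; exists n.
Qed.

Lemma node_below s : 0 < s -> exists n, node n <= s.
Proof.
move=> s0; have [n rn] := @expr_eventually_lt (s / a) (divr_gt0 s0 a0).
exists n; rewrite /node mulrC -ler_pdivlMr//; apply: le_trans (ltW rn).
by rewrite expr2 ler_piMl ?exprn_ge0 ?exprn_ile1 ?(ltW r0) ?(ltW r1).
Qed.

Lemma between_nodes s : 0 < s < a -> exists j, node j.+1 <= s < node j.
Proof.
case/andP=> s0 sa; have ex := node_below s0.
case: (ex_minnP ex) => -[|j] js jmin; first by move: js; rewrite node0 leNgt sa.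
exists j; rewrite js/= ltNge; apply/negP => /jmin; by rewrite ltnn.
Qed.

(** The argument is (node k - s) / gap k, spelled as an affine function to fit
    [is_derive_ramp_affine]. So [chi k] decreases from 1 at node k + 1 to 0 at node k. *)
Definition chi k s : R := ramp (node k / gap k + - (gap k)^-1 * s).
Definition dchi k s : R := - (gap k)^-1 * dramp (node k / gap k + - (gap k)^-1 * s).

Let argE k s : node k / gap k + - (gap k)^-1 * s = (node k - s) / gap k.
Proof. by rewrite mulrBl mulNr [s / _]mulrC. Qed.

Lemma chi_above k s : node k <= s -> chi k s = 0.
Proof.
move=> ks; rewrite /chi argE ramp_le0// pmulr_lle0 ?invr_gt0 ?gap_gt0//; lra.
Qed.

Lemma dchi_above k s : node k <= s -> dchi k s = 0.
Proof.
move=> ks; rewrite /dchi argE dramp_out ?mulr0// pmulr_lle0 ?invr_gt0 ?gap_gt0//.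
by rewrite subr_le0 ks.
Qed.

Let below k s : s <= node k.+1 -> 1 <= (node k - s) / gap k.
Proof. by move=> sk; rewrite ler_pdivlMr ?gap_gt0// mul1r /gap; lra. Qed.

Lemma chi_below k s : s <= node k.+1 -> chi k s = 1.
Proof. by move=> sk; rewrite /chi argE ramp_ge1// below. Qed.

Lemma dchi_below k s : s <= node k.+1 -> dchi k s = 0.
Proof. by move=> sk; rewrite /dchi argE dramp_out ?mulr0// below// orbT. Qed.

Lemma chi01 k s : 0 <= chi k s <= 1. Proof. exact: ramp01. Qed.

Lemma dchi_norm k s : `|dchi k s| <= 2 / gap k.
Proof.
have g0 : 0 < (gap k)^-1 by rewrite invr_gt0 gap_gt0.
rewrite /dchi normrM normrN (gtr0_norm g0) [leRHS]mulrC; apply: ler_wpM2l; first exact: ltW.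
exact: dramp_norm.
Qed.

Lemma is_derive_chi k s : is_derive s 1 (chi k) (dchi k s).
Proof. exact: is_derive_ramp_affine. Qed.

Lemma continuous_chi k : continuous (chi k).
Proof.
move=> s; apply: differentiable_continuous; apply/derivable1_diffP.
exact: (@ex_derive _ _ _ _ _ _ _ (is_derive_chi k s)).
Qed.

Lemma continuous_dchi k : continuous (dchi k).
Proof.
move=> s; apply: cvgM; first exact: cvg_cst.
exact: continuous_dramp_affine.
Qed.

(** Any [n] with [node n <= s] gives the same sum, because the later terms vanish at [s]
    ([layersE]). This makes the infinite sum over layers a finite one at each point of the positive
    half-line. *)
Definition depth s : nat := xget 0%N [set n | node n <= s].

Lemma depthP s : 0 < s -> node (depth s) <= s.
Proof.
move=> s0; rewrite /depth; case: xgetP => [n _ //|H].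
by have [n ns] := node_below s0; case: (H n).
Qed.

Definition layers c x s : V := \sum_(k < depth s) (c k s)%:C *: x k.

Definition vanishing c := forall k s, node k <= s -> c k s = 0.

Let trunc c x m k s : vanishing c -> (m <= k)%N -> node m <= s ->
  \sum_(i < k) (c i s)%:C *: x i = \sum_(i < m) (c i s)%:C *: x i.
Proof.
move=> c0 mk ms; rewrite -(subnKC mk) big_split_ord/= [X in _ + X]big1 ?addr0// => i _.
by rewrite c0 ?scale0r//; apply: le_trans ms; apply: node_nincr; rewrite leq_addr.
Qed.

Lemma layersE c x n s : vanishing c -> 0 < s -> node n <= s ->
  layers c x s = \sum_(k < n) (c k s)%:C *: x k.
Proof.
move=> c0 s0 ns; have ds := depthP s0; rewrite /layers.
by have [h|h] := leqP n (depth s); [rewrite (trunc _ c0 h)|rewrite -(trunc _ c0 (ltnW h))].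
Qed.

Lemma continuous_layers c x s : vanishing c -> (forall k, continuous (c k)) ->
  0 < s -> layers c x t @[t --> s] --> layers c x s.
Proof.
move=> c0 cc s0; have [n ns] : exists n, node n <= s / 2 by apply: node_below; rewrite divr_gt0.
have s2s : node n <= s by lra.
rewrite (layersE _ c0 s0 s2s).
have H : \sum_(k < n) (c k t)%:C *: x k @[t --> s] --> \sum_(k < n) (c k s)%:C *: x k.
  apply: cvg_big => [|k _]; first exact: add_continuous.
  have sC := cvg_comp _ _ (cc k s) (@continuous_real_complex R (c k s)).
  exact: (cvgZr_tmp (a := x k) sC).
apply: cvg_trans H; apply: near_eq_cvg; near=> t.
have t2 : s / 2 < t.
  near: t; apply: lt_nbhsr; lra.
by apply/esym/layersE => //; lra.
Unshelve. all: by end_near. Qed.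

(** The functions [chi k] with k < j are already 1 at [s], so these increments telescope to [z j];
    only layer [j] is in transition. *)
Lemma layers_chi z j s : z 0%N = 0 -> node j.+1 <= s < node j ->
  layers chi (fun k => z k.+1 - z k) s = z j + (chi j s)%:C *: (z j.+1 - z j).
Proof.
move=> z0 /andP[js sj]; rewrite (layersE _ chi_above (lt_le_trans (node_gt0 _) js) js).
rewrite big_ord_recr/=; congr (_ + _); rewrite (eq_bigr (fun k : 'I_j => z k.+1 - z k)).
  by rewrite -(big_mkord xpredT (fun k => z k.+1 - z k)) telescope_sumr// z0 subr0.
move=> k _; rewrite chi_below ?scale1r//; apply: (le_trans (ltW sj)).
by apply: node_nincr; exact: ltn_ord.
Qed.

Lemma layers_dchi x j s : node j.+1 <= s < node j ->
  layers dchi x s = (dchi j s)%:C *: x j.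
Proof.
move=> /andP[js sj]; rewrite (layersE _ dchi_above (lt_le_trans (node_gt0 _) js) js).
rewrite big_ord_recr/= big1 ?add0r// => k _.
rewrite dchi_below ?scale0r//; apply: (le_trans (ltW sj)).
by apply: node_nincr; exact: ltn_ord.
Qed.

Lemma layers_chi_ge z s : a <= s -> layers chi (fun k => z k.+1 - z k) s = 0.
Proof.
move=> as_; rewrite (@layersE _ _ 0) ?big_ord0 ?node0//; first exact: chi_above.
exact: lt_le_trans as_.
Qed.

End Layers.

Section Lift.
Context {R : realType} {V : completeNormedModType R[i]}.
Local Notation mu := (@lebesgue_measure R).
Variables (a r b sg : R).
Hypotheses (a0 : 0 < a) (r01 : 0 < r < 1).
Hypothesis sgb : (sg = 1 /\ b = 0) \/ (sg = -1 /\ b = a).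

Let r0 : 0 < r. Proof. by case/andP: r01. Qed.
Let r1 : r < 1. Proof. by case/andP: r01. Qed.

(* t or a - t: the profile below is run forwards or backwards. *)
Let clock (t : R) : R := b + sg * t.

Let clock_in t : 0 < t < a -> 0 < clock t < a.
Proof. by rewrite /clock; case: sgb => -[-> ->]; lra. Qed.

Let continuous_clock : continuous clock.
Proof. by move=> t; apply: cvgD; [exact: cvg_cst|exact: mulrl_continuous]. Qed.

(** The clock spends a time of at most a r^(2 j) between consecutive nodes, so the squared L^2 norm
    is at most [a] times the sum of the (r^j x_j)^2. *)
Lemma L2_layered (Y : nsubspace V) f (x : nat -> R) :
  strongly_measurable a Y f -> (forall j, 0 <= x j) ->
  (forall t j, 0 < t < a -> node a r j.+1 <= clock t < node a r j -> 0 <= nrm Y (f t) <= x j) ->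
  sqsum (fun j => r ^+ j * x j) -> L2 a Y f.
Proof.
move=> fm x0 fx [C xC].
pose J j : set R := [set t | node a r j.+1 <= clock t < node a r j].
have muJ j : measurable (J j) /\ (mu (J j) <= (gap a r j)%:E)%E.
  have g0 := ltW (gap_gt0 a0 r01 j).
  case: sgb => -[sE bE].
    have -> : J j = [set` `[node a r j.+1, node a r j[].
      by apply/seteqP; split => t; rewrite /J/= in_itv/= /clock sE bE add0r mul1r.
    split; first exact: measurable_itv.
    by rewrite lebesgue_measure_itv/=; case: ifP => _; rewrite ?lee_fin.
  have -> : J j = [set` `]a - node a r j, a - node a r j.+1]].
    by apply/seteqP; split => t; rewrite /J/= in_itv/= /clock sE bE; lra.
  split; first exact: measurable_itv.
  rewrite lebesgue_measure_itv/=; case: ifP => _; rewrite ?lee_fin// /gap; lra.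
apply: (@L2_dominated _ _ _ _ _ J (gap a r) x (a * C)) => //.
- by move=> j; case: (muJ j).
- by move=> j; case: (muJ j).
- move=> t t0a; have [j jP] := between_nodes a0 r01 (clock_in t0a).
  by exists j => //; exact: fx.
move=> K; apply: (le_trans _ (ler_wpM2l (ltW a0) (xC K))); rewrite mulr_sumr.
apply: ler_sum => j _.
have -> : a * (r ^+ j * x j) ^+ 2 = x j ^+ 2 * (a * (r ^+ j) ^+ 2) by ring.
apply: ler_wpM2l; first exact: sqr_ge0.
have -> : gap a r j = (a * (r ^+ j) ^+ 2) * (1 - r ^+ 2) by rewrite gapE; ring.
have h1 : 0 <= a * (r ^+ j) ^+ 2 by rewrite mulr_ge0 ?sqr_ge0// ltW.
by have := sqr_ge0 r => h2; rewrite ler_piMr//; lra.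
Qed.

Lemma sqsum_shift (x : nat -> R) : sqsum x -> sqsum (fun k => x k.+1).
Proof.
move=> [C xC]; exists C => K; apply: le_trans (xC K.+1).
by rewrite big_ord_recl/= lerDr sqr_ge0.
Qed.

Lemma sqsum_shift_weight (q c : R) (x : nat -> R) : 0 < q -> 0 <= c -> (forall k, 0 <= x k) ->
  sqsum (fun k => q ^+ k * x k) -> sqsum (fun k => q ^+ k * (c * (x k + x k.+1))).
Proof.
move=> q0 c0 x0 xs; have qn k : 0 <= q ^+ k := exprn_ge0 k (ltW q0).
apply: (@sqsum_le2 _ (c * (1 + q^-1)) _ _ _ _ _ xs (sqsum_shift xs)).
  by rewrite mulr_ge0// addr_ge0// invr_ge0 ltW.
move=> k /=; rewrite mulr_ge0 ?mulr_ge0 ?addr_ge0//= mulrCA -mulrA ler_wpM2l//.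
have qk : q^-1 * q ^+ k.+1 = q ^+ k by rewrite exprS mulrA mulVf ?mul1r// gt_eqF.
have h1 : 0 <= q^-1 * (q ^+ k * x k) by rewrite !mulr_ge0// invr_ge0 ltW.
have h2 : 0 <= q ^+ k.+1 * x k.+1 by rewrite mulr_ge0// exprn_ge0// ltW.
by rewrite !mulrDl !mulrDr !mul1r [q^-1 * (q ^+ k.+1 * _)]mulrA qk; lra.
Qed.

End Lift.

(** * The profile that interpolates the sequence P *)

Section Profile.
Context {R : realType} {V : completeNormedModType R[i]}.
Variables (A : linop V) (a r : R) (u : V) (P Q : nat -> V).
Hypotheses (a0 : 0 < a) (r01 : 0 < r < 1) (P0 : P 0%N = 0).
Hypotheses (PQ : forall k, u = P k + Q k) (dP : forall k, dom A (P k)).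
Hypothesis (sQ : sqsum (fun k => r^-1 ^+ k * rnorm (Q k))).

Let r0 : 0 < r. Proof. by case/andP: r01. Qed.

Let inc k : V := P k.+1 - P k.

Let incQ k : inc k = Q k - Q k.+1.
Proof.
have PE i : P i = u - Q i by rewrite (PQ i) addrK.
by rewrite /inc !PE opprB addrC addrA subrK.
Qed.

(* By telescoping, [profile] equals P k at node k; it tends to u at 0. *)
Definition profile (s : R) : V := if 0 < s then layers a r (chi a r) inc s else u.
Definition slope (s : R) : V := layers a r (dchi a r) inc s.
Definition op_profile (s : R) : V := layers a r (chi a r) (fun k => A (P k.+1) - A (P k)) s.

Let dinc k : dom A (inc k). Proof. exact: domB. Qed.

Lemma profile_dom s : 0 < s -> dom A (profile s) /\ A (profile s) = op_profile s.
Proof.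
move=> s0; rewrite /profile s0 /op_profile /layers.
have D (k : 'I_(depth a r s)) : true -> dom A ((chi a r k s)%:C *: inc k) by move=> _; exact: domZ.
split; first exact: dom_sum.
rewrite op_sum//; apply: eq_bigr => k _.
by rewrite opZ// /inc opB.
Qed.

Lemma profile_end : profile a = 0.
Proof. by rewrite /profile a0; apply: layers_chi_ge. Qed.

Lemma profile_start : profile 0 = u.
Proof. by rewrite /profile ltxx. Qed.

Let chiC k s : rnorm ((chi a r k s)%:C : R[i]^o) <= 1.
Proof. by rewrite cabsR ger0_norm; have /andP[] := chi01 a r k s. Qed.

Let rnormZ_chi k s (x : V) : rnorm ((chi a r k s)%:C *: x) <= rnorm x.
Proof. by rewrite rnormZ ler_piMl ?rnorm_ge0. Qed.

(** As P + Q is constant, the increments of [P] are those of [Q] with the opposite sign ([incQ]):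
    the profile is measured by [P], while its slope and its distance to [u] only see [Q]. *)
Lemma profile_bound j s : node a r j.+1 <= s < node a r j ->
  [/\ rnorm (profile s) <= 2 * (rnorm (P j) + rnorm (P j.+1)),
      rnorm (op_profile s) <= 2 * (rnorm (A (P j)) + rnorm (A (P j.+1))),
      rnorm (slope s) <= 2 / gap a r j * (rnorm (Q j) + rnorm (Q j.+1)) &
      rnorm (profile s - u) <= 2 * (rnorm (Q j) + rnorm (Q j.+1))].
Proof.
move=> js; have s0 : 0 < s by case/andP: js => /(lt_le_trans (node_gt0 a0 r01 _)).
have B (z : nat -> V) : rnorm (z j + (chi a r j s)%:C *: (z j.+1 - z j)) <=
    2 * (rnorm (z j) + rnorm (z j.+1)).
  have h1 := rnormD (z j) ((chi a r j s)%:C *: (z j.+1 - z j)).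
  have h2 := rnormZ_chi j s (z j.+1 - z j).
  have := rnormB (z j.+1) (z j); have := rnorm_ge0 (z j); have := rnorm_ge0 (z j.+1).
  by move: h1 h2; lra.
have E : profile s = P j + (chi a r j s)%:C *: inc j.
  by rewrite /profile s0; exact: (layers_chi a0 r01 (z := P)).
split.
- by rewrite E; exact: B.
- have AP0 : (A \o P) 0%N = 0 by rewrite /= P0 op0.
  by rewrite /op_profile (layers_chi a0 r01 (z := A \o P) AP0 js); exact: (B (A \o P)).
- rewrite /slope (layers_dchi a0 r01 _ js) rnormZ cabsR incQ; apply: ler_pM; rewrite ?rnorm_ge0//.
    exact: (dchi_norm a0 r01).
  exact: rnormB.
- rewrite E incQ (PQ j) opprD addrACA subrr add0r.
  have h1 := rnormB ((chi a r j s)%:C *: (Q j - Q j.+1)) (Q j).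
  have h2 := rnormZ_chi j s (Q j - Q j.+1).
  have := rnormB (Q j) (Q j.+1); have := rnorm_ge0 (Q j); have := rnorm_ge0 (Q j.+1).
  by move: h1 h2; lra.
Qed.

(** The terms of a square-summable sequence are bounded. The resulting geometric decay of [Q] gives
    the continuity of the profile at 0. *)
Let Q_small : exists C, forall k, rnorm (Q k) <= C * r ^+ k.
Proof.
case: sQ => C QC; exists (1 + C) => k; have := QC k.+1.
rewrite big_ord_recr/= => h.
have q0 : 0 <= r^-1 ^+ k * rnorm (Q k) by rewrite mulr_ge0 ?rnorm_ge0 ?exprn_ge0 ?invr_ge0 ?ltW.
have h2 : (r^-1 ^+ k * rnorm (Q k)) ^+ 2 <= C.
  by apply: le_trans h; rewrite lerDr; apply: sumr_ge0 => i _; exact: sqr_ge0.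
have h3 : r^-1 ^+ k * rnorm (Q k) <= 1 + C by nra.
by move: h3; rewrite exprVn mulrC ler_pdivrMr// exprn_gt0.
Qed.

Lemma continuous_profile : continuous profile.
Proof.
move=> s; change (profile t @[t --> s] --> profile s); have [s0|s0|->] := ltgtP s 0.
- have : (fun=> u) t @[t --> s] --> u by exact: cvg_cst.
  rewrite [profile s]/profile ltNge (ltW s0)/=; apply: cvg_trans; apply: near_eq_cvg.
  near=> t; rewrite /profile ltNge.
  have t0 : t < 0 by near: t; exact: lt_nbhsl.
  by rewrite (ltW t0).
- have : layers a r (chi a r) inc t @[t --> s] --> layers a r (chi a r) inc s.
    apply: continuous_layers => //; first exact: chi_above.
    exact: continuous_chi.
  rewrite [profile s]/profile s0; apply: cvg_trans; apply: near_eq_cvg; near=> t.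
  rewrite /profile; have -> // : 0 < t by near: t; exact: lt_nbhsr.
- rewrite profile_start; apply/rcvgP => e e0.
  have [C QC] := Q_small.
  (* The distance to [u] is at most 2 (|Q j| + |Q (j + 1)|), hence at most 4 |C| r^n below node n;
     adding 1 keeps the divisor positive. *)
  have c0 : 0 < 4 * (1 + `|C|) by have := normr_ge0 C; lra.
  have [n rn] := expr_eventually_lt r01 (divr_gt0 e0 c0); near=> t.
  have tn : t < node a r n by near: t; exact: lt_nbhsl (node_gt0 a0 r01 n).
  have [t0|t0] := leP t 0; first by rewrite /profile [0 < t]ltNge t0/= subrr rnorm0.
  have ta : 0 < t < a.
    by rewrite t0/= (lt_le_trans tn)// -[leRHS](node0 a r) node_nincr.
  have [j jt] := between_nodes a0 r01 ta.
  have [_ _ _ /le_lt_trans] := profile_bound jt; apply.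
  have nj : (n <= j)%N.
    rewrite leqNgt; apply/negP => jn; have := node_nincr a0 r01 jn.
    by case/andP: jt => jt _; rewrite leNgt (le_lt_trans jt).
  have rj k : (n <= k)%N -> r ^+ k <= r ^+ n.
    by move=> nk; rewrite ler_wiXn2l ?ltW//; case/andP: r01.
  have h k : (n <= k)%N -> rnorm (Q k) <= `|C| * r ^+ n.
    move=> nk; apply: (le_trans (QC k)); apply: (@le_trans _ _ (`|C| * r ^+ k)).
      by rewrite ler_wpM2r ?exprn_ge0 ?ler_norm// ltW.
    by rewrite ler_wpM2l ?rj.
  move: rn; rewrite ltr_pdivlMr// => h3.
  have := h j nj; have := h j.+1 (leqW nj).
  have := exprn_gt0 n r0; move: h3.
  by move: (rnorm (Q j)) (rnorm (Q j.+1)) (r ^+ n) => x y z; lra.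
Unshelve. all: by end_near. Qed.

End Profile.

(** * Weak derivatives of locally finite sums *)

Section WeakDerivative.
Context {R : realType} {V : completeNormedModType R[i]}.
Local Notation mu := (@lebesgue_measure R).
Variable a : R.
Hypothesis a0 : 0 < a.
Local Notation D := (`]0%R, a[%classic : set R).

Lemma derivable_continuous (f : R -> R) : (forall t, derivable f t 1) -> continuous f.
Proof. by move=> df t; apply: differentiable_continuous; apply/derivable1_diffP. Qed.

Let derivable_oo (f : R -> R) : (forall t, derivable f t 1) -> derivable_oo_LRcontinuous f 0 a.
Proof.
move=> df; have cf := derivable_continuous df; split => [t _||]; first exact: df.
  by apply: cvg_at_right_filter; exact: cf.
by apply: cvg_at_left_filter; exact: cf.
Qed.

Lemma continuous_integral_oo (f : R -> R) : continuous f ->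
  mu.-integrable D (EFin \o f) /\
  (\int[mu]_(t in `[0%R, a]) (f t)%:E = \int[mu]_(t in D) (f t)%:E)%E.
Proof.
move=> cf; have I : mu.-integrable D (EFin \o f).
  apply: (@integrableS _ _ _ mu `[0%R, a]%classic D); try exact: measurable_itv.
    by apply: subset_itv_oo_cc.
  apply: continuous_compact_integrable; first exact: segment_compact.
  exact: continuous_subspaceT.
split => //; apply: integral_itv_bndoo.
by have /measurable_int := I.
Qed.

Lemma integral_by_parts_vanishing (eta c dc : R -> R) : (forall t, derivable eta t 1) ->
  continuous (derive1 eta) -> eta 0 = 0 -> eta a = 0 ->
  (forall t : R, is_derive t 1 c (dc t)) -> continuous dc ->
  exists v : R, [/\ mu.-integrable D (EFin \o (fun t => derive1 eta t * c t)),
    (\int[mu]_(t in D) (derive1 eta t * c t)%:E = v%:E)%E,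
    mu.-integrable D (EFin \o (fun t => eta t * dc t)) &
    (\int[mu]_(t in D) (eta t * dc t)%:E = (- v)%:E)%E].
Proof.
move=> de ce e0 ea Dc cdc.
have dcv t : derivable c t 1 by apply: (@ex_derive _ _ _ _ _ _ _ (Dc t)).
have C1 : continuous (fun t => derive1 eta t * c t).
  by move=> t; apply: cvgM; [exact: ce|exact: (derivable_continuous dcv)].
have C2 : continuous (fun t => eta t * dc t).
  by move=> t; apply: cvgM; [exact: (derivable_continuous de)|exact: cdc].
have [I1 E1] := continuous_integral_oo C1; have [I2 E2] := continuous_integral_oo C2.
have mD : measurable (D : set (measurableTypeR R)) by exact: measurable_itv.
have fi := integrable_fin_num mD I1.
exists (fine (\int[mu]_(t in D) (derive1 eta t * c t)%:E)%E); split => //.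
  by rewrite fineK.
have dE : {in `]0, a[, derive1 c =1 dc}.
  by move=> t _; rewrite derive1E; exact: derive_val.
have := integration_by_parts a0 (@continuous_subspaceT _ _ _ (derive1 eta) ce)
  (derivable_oo de) (fun t _ => erefl) (@continuous_subspaceT _ _ _ dc cdc) (derivable_oo dcv) dE.
by rewrite E2 E1 e0 ea !mul0r subrr sub0e => ->; rewrite EFinN fineK.
Qed.

Lemma test_fun_props (eta : R -> R) : test_fun a eta ->
  [/\ forall t, derivable eta t 1, continuous (derive1 eta), eta 0 = 0, eta a = 0 &
    exists c d : R, [/\ 0 < c, c < d, d < a &
      forall t, ~~ (c <= t <= d) -> eta t = 0 /\ derive1 eta t = 0]].
Proof.
move=> [de [c [d [c0 cd da etacd]]]].
have out t : ~~ (c <= t <= d) -> eta t = 0.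
  by move=> cdt; apply/eqP; apply: contraNT cdt => /etacd.
split.
- exact: (de 0%N).
- exact: (derivable_continuous (de 1%N)).
- by apply: out; rewrite leNgt c0.
- by apply: out; rewrite [a <= d]leNgt da andbF.
exists c, d; split => // t tcd; split; first exact: out.
(* The complement of [c, d] is open, so [eta] vanishes in a neighbourhood of [t]. *)
rewrite -(@derive1_cst R _ (0 : R) t) !derive1E; apply: near_eq_derive.
move: tcd; rewrite negb_and -!ltNge => /orP[tc|dt]; near=> s; apply: out.
  by rewrite negb_and -!ltNge; apply/orP; left; near: s; exact: lt_nbhsl.
by rewrite negb_and -!ltNge; apply/orP; right; near: s; exact: lt_nbhsr.
Unshelve. all: by end_near. Qed.

(** A test function lives on some [c0, d0] inside the open interval, where both sums are finite.
    Integration by parts is therefore scalar and term by term, and no convergence at the endpoints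
    is involved. *)
Lemma weak_derivative_locally_finite (c dc : nat -> R -> R) (x : nat -> V) (psi h : R -> V) :
  (forall k (t : R), is_derive t 1 (c k) (dc k t)) -> (forall k, continuous (dc k)) ->
  (forall c0 d0 : R, 0 < c0 -> c0 < d0 -> d0 < a -> exists n, forall t, c0 <= t <= d0 ->
     psi t = \sum_(k < n) (c k t)%:C *: x k /\ h t = \sum_(k < n) (dc k t)%:C *: x k) ->
  weak_derivative a psi h.
Proof.
move=> Dc cdc loc eta /test_fun_props[de ce e0 ea [c0 [d0 [c00 cd d0a out]]]].
have [n nE] := loc c0 d0 c00 cd d0a.
have /choice[v vP] := fun k => integral_by_parts_vanishing de ce e0 ea (Dc k) (cdc k).
exists (\sum_(k < n) (v k)%:C *: x k).
  have -> : (fun t => (derive1 eta t)%:C *: psi t) =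
      (fun t => \sum_(k < n) (derive1 eta t * c k t)%:C *: x k).
    apply/funext => t; have [/nE[-> _]|/out[_ ->]] := boolP (c0 <= t <= d0).
      by rewrite scaler_sumr; apply: eq_bigr => k _; rewrite scalerA rmorphM.
    by rewrite scale0r big1// => k _; rewrite mul0r scale0r.
  by apply: (@has_integral_sum R a V n (fun k t => derive1 eta t * c k t)) => k; case: (vP k).
have -> : (fun t => (eta t)%:C *: h t) = (fun t => \sum_(k < n) (eta t * dc k t)%:C *: x k).
  apply/funext => t; have [/nE[_ ->]|/out[-> _]] := boolP (c0 <= t <= d0).
    by rewrite scaler_sumr; apply: eq_bigr => k _; rewrite scalerA rmorphM.
  by rewrite scale0r big1// => k _; rewrite mul0r scale0r.
have -> : - (\sum_(k < n) (v k)%:C *: x k) = \sum_(k < n) (- v k)%:C *: x k.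
  by rewrite -sumrN; apply: eq_bigr => k _; rewrite rmorphN scaleNr.
by apply: (@has_integral_sum R a V n (fun k t => eta t * dc k t) x (fun k => - v k)) => k; case: (vP k).
Qed.

End WeakDerivative.

Section ProfileLift.
Context {R : realType} {V : completeNormedModType R[i]}.
Variables (A : linop V) (a r b sg : R) (u : V) (P Q : nat -> V).
Hypotheses (a0 : 0 < a) (r01 : 0 < r < 1) (P0 : P 0%N = 0).
Hypotheses (PQ : forall k, u = P k + Q k) (dP : forall k, dom A (P k)).
Hypothesis (sP : sqsum (fun k => r ^+ k * rnorm (P k))).
Hypothesis (sAP : sqsum (fun k => r ^+ k * rnorm (A (P k)))).
Hypothesis (sQ : sqsum (fun k => r^-1 ^+ k * rnorm (Q k))).
Hypothesis sgb : (sg = 1 /\ b = 0) \/ (sg = -1 /\ b = a).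

Let r0 : 0 < r. Proof. by case/andP: r01. Qed.
Let clock (t : R) : R := b + sg * t.

Let clock_in t : 0 < t < a -> 0 < clock t < a.
Proof. by rewrite /clock; case: sgb => -[-> ->]; lra. Qed.

Let clock_gt0 t : 0 < t < a -> 0 < clock t.
Proof. by case/clock_in/andP. Qed.

Let continuous_clock : continuous clock.
Proof. by move=> t; apply: cvgD; [exact: cvg_cst|exact: mulrl_continuous]. Qed.

Let is_derive_clock (t : R) : is_derive t 1 clock sg.
Proof. by apply: is_derive_eq; rewrite -![_ *: _]/(_ * _); ring. Qed.

Let psi t : V := profile a r u P (clock t).
Let apsi t : V := op_profile A a r P (clock t).
Let h t : V := sg%:C *: slope a r P (clock t).

Let profile_cvg t : psi s @[s --> t] --> psi t.
Proof.
have c : profile a r u P y @[y --> clock t] --> profile a r u P (clock t).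
  exact: (@continuous_profile _ _ A _ _ _ _ _ a0 r01 P0 PQ sQ (clock t)).
exact: (@continuous_comp _ _ _ clock (profile a r u P) t (@continuous_clock t) c).
Qed.

Let op_profile_cvg t : 0 < t < a -> apsi s @[s --> t] --> apsi t.
Proof.
move=> /clock_gt0 t0.
have c : op_profile A a r P y @[y --> clock t] --> op_profile A a r P (clock t).
  by apply: continuous_layers => //; [exact: chi_above|exact: continuous_chi].
exact: (@continuous_comp _ _ _ clock (op_profile A a r P) t (@continuous_clock t) c).
Qed.

Let h_cvg t : 0 < t < a -> h s @[s --> t] --> h t.
Proof.
move=> /clock_gt0 t0; apply: cvgZl_tmp.
have c : slope a r P y @[y --> clock t] --> slope a r P (clock t).
  by apply: continuous_layers => //; [exact: dchi_above|exact: continuous_dchi].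
exact: (@continuous_comp _ _ _ clock (slope a r P) t (@continuous_clock t) c).
Qed.

Let bP j := 2 * (rnorm (P j) + rnorm (P j.+1)).
Let bAP j := 2 * (rnorm (A (P j)) + rnorm (A (P j.+1))).
Let bQ j := 2 / gap a r j * (rnorm (Q j) + rnorm (Q j.+1)).

Let bP0 j : 0 <= bP j. Proof. by rewrite mulr_ge0// addr_ge0 ?rnorm_ge0. Qed.
Let bAP0 j : 0 <= bAP j. Proof. by rewrite mulr_ge0// addr_ge0 ?rnorm_ge0. Qed.
Let bQ0 j : 0 <= bQ j.
Proof. by rewrite mulr_ge0 ?addr_ge0 ?rnorm_ge0// divr_ge0// ltW// gap_gt0. Qed.

Let sbP : sqsum (fun j => r ^+ j * bP j).
Proof. by apply: sqsum_shift_weight => // k; exact: rnorm_ge0. Qed.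
Let sbAP : sqsum (fun j => r ^+ j * bAP j).
Proof. by apply: sqsum_shift_weight => // k; exact: rnorm_ge0. Qed.
Let sbQ : sqsum (fun j => r ^+ j * bQ j).
Proof.
have c0 : 0 <= 2 / (a * (1 - r ^+ 2)).
  by rewrite divr_ge0// mulr_ge0 ?(ltW a0)// subr_ge0 exprn_ile1 ?(ltW r0)// ltW//; case/andP: r01.
(* Dividing by the gap, a multiple of r^(2 j), turns the weight r^j into r^(- j), precisely the
   weight for which [Q] is summable. *)
have -> : (fun j => r ^+ j * bQ j) =
    (fun j => r^-1 ^+ j * (2 / (a * (1 - r ^+ 2)) * (rnorm (Q j) + rnorm (Q j.+1)))).
  apply/funext => j; rewrite /bQ gapE exprVn; field.
  rewrite !gt_eqF ?exprn_gt0//= subr_gt0 exprn_ilt1 ?(ltW r0)//; by case/andP: r01.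
by apply: sqsum_shift_weight => //; [rewrite invr_gt0|move=> k; exact: rnorm_ge0].
Qed.

Let bound t j (jt : node a r j.+1 <= clock t < node a r j) :
  [/\ rnorm (psi t) <= bP j, rnorm (apsi t) <= bAP j & rnorm (h t) <= bQ j].
Proof.
have [h1 h2 h3 _] := profile_bound A a0 r01 P0 PQ jt; split => //.
rewrite /h rnormZ cabsR; have -> : `|sg| = 1; last by rewrite mul1r.
by case: sgb => -[-> _]; rewrite ?normrN normr1.
Qed.

Let sq_sum (x y : nat -> R) : (forall j, 0 <= x j) -> (forall j, 0 <= y j) ->
  sqsum (fun j => r ^+ j * x j) -> sqsum (fun j => r ^+ j * y j) ->
  sqsum (fun j => r ^+ j * (x j + y j)).
Proof.
move=> x0 y0 xs ys; apply: (sqsum_le2 ler01 _ xs ys) => k.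
by rewrite mul1r mulrDr lexx andbT addr_ge0// mulr_ge0// exprn_ge0// ltW.
Qed.

Let L2_psi : L2 a (full V) psi.
Proof.
apply: (@L2_layered _ _ a r b sg a0 r01 sgb _ _ bP) => //.
  by apply: strongly_measurable_full => // t _; exact: profile_cvg.
by move=> t j _ /bound[+ _ _]; rewrite rnorm_ge0.
Qed.

Let L2_h : L2 a (full V) h.
Proof.
apply: (@L2_layered _ _ a r b sg a0 r01 sgb _ _ bQ) => //.
  by apply: strongly_measurable_full => // t t0a; exact: h_cvg.
by move=> t j _ /bound[_ _ +]; rewrite rnorm_ge0.
Qed.

Let L2_f : L2 a (full V) (fun t => h t - apsi t).
Proof.
apply: (@L2_layered _ _ a r b sg a0 r01 sgb _ _ (fun j => bQ j + bAP j)) => //.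
- apply: strongly_measurable_full => // t t0a; apply: cvgB; first exact: h_cvg.
  exact: op_profile_cvg.
- by move=> j; rewrite addr_ge0.
- move=> t j _ /bound[_ h1 h2]; rewrite rnorm_ge0/= (le_trans (rnormB _ _))// lerD//.
- exact: sq_sum.
Qed.

Let op_psi t : 0 < t < a -> dom A (psi t) /\ A (psi t) = apsi t.
Proof. by move=> /clock_gt0 t0; exact: (profile_dom a r u dP t0). Qed.

Let L2_graph : L2 a (graph_space A) psi.
Proof.
apply: (@L2_layered _ _ a r b sg a0 r01 sgb _ _ (fun j => bP j + bAP j)) => //.
- apply: strongly_measurable_continuous => // t t0a; first by case: (op_psi t0a).
  have N : rnorm (psi t - psi s) + rnorm (apsi t - apsi s) @[s --> t] --> (0 : R).
    have c1 : psi t - psi s @[s --> t] --> psi t - psi t.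
      by apply: cvgB; [exact: cvg_cst|exact: profile_cvg].
    have c2 : apsi t - apsi s @[s --> t] --> apsi t - apsi t.
      by apply: cvgB; [exact: cvg_cst|exact: op_profile_cvg].
    have H := cvgD (cvg_rnorm c1) (cvg_rnorm c2).
    rewrite !subrr rnorm0 addr0 in H; exact: H.
  apply: cvg_trans N; apply: near_eq_cvg; near=> s.
  have s0a : 0 < s < a.
    apply/andP; split; near: s; [apply: lt_nbhsr|apply: lt_nbhsl]; by case/andP: t0a.
  have [d1 e1] := op_psi t0a; have [d2 e2] := op_psi s0a.
  by rewrite /graph_space/= opB// e1 e2.
- by move=> j; rewrite addr_ge0.
- move=> t j t0a /bound[h1 h2 _]; have [_ e] := op_psi t0a.
  by rewrite /graph_space/= e addr_ge0 ?rnorm_ge0//= lerD.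
- exact: sq_sum.
Unshelve. all: by end_near. Qed.

Let weak_psi : weak_derivative a psi h.
Proof.
apply: (@weak_derivative_locally_finite _ _ _ a0 (fun k t => chi a r k (clock t))
  (fun k t => sg * dchi a r k (clock t)) (fun k => P k.+1 - P k)).
- move=> k t; have := @is_derive1_comp _ (chi a r k) clock t _ _ (is_derive_chi _ _ _ _) (is_derive_clock t).
  by rewrite mulrC.
- move=> k t; apply: cvgM; first exact: cvg_cst.
  apply: (@continuous_comp _ _ _ clock (dchi a r k) t); first exact: continuous_clock.
  exact: continuous_dchi.
(* Since the clock may run backwards, either end of [c, d] can be the one closer to the accumulation
   of nodes. *)
move=> c d c0 cd da; have : exists n, node a r n <= Num.min (clock c) (clock d).
  by apply: node_below => //; rewrite lt_min !clock_gt0//; lra.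
case=> n; rewrite le_min => /andP[nc nd]; exists n => t /andP[ct td].
have t0a : 0 < t < a by lra.
have nt : node a r n <= clock t.
  by move: nc nd; rewrite /clock; case: sgb => -[-> _]; lra.
have t0 := clock_gt0 t0a; split.
  by rewrite /psi /profile t0 (layersE a0 r01 _ (chi_above a0 r01) t0 nt).
rewrite /h /slope (layersE a0 r01 _ (dchi_above a0 r01) t0 nt) scaler_sumr.
by apply: eq_bigr => k _; rewrite scalerA/= -rmorphM.
Qed.

(** The datum is taken to be [h - apsi], so the equation holds by construction; only its square
    integrability has to be checked. *)
Lemma profile_lift : exists psi f, [/\ evolution_eq a A f psi, L2 a (full V) f,
  boundary_value a psi 0 (profile a r u P b) &
  boundary_value a psi a (profile a r u P (b + sg * a))].
Proof.
have bv t : boundary_value a psi t (psi t).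
  exists psi; split => //; first by apply: continuous_subspaceT => s; exact: profile_cvg.
  by apply: aeW.
exists psi, (fun t => h t - apsi t); split => //.
- split; first by split => //; split => //; exists h.
  exists h => //; split => //; apply: aeW => t t0a.
  by case: (op_psi t0a) => _ ->.
- by have := bv 0; rewrite /psi /clock mulr0 addr0.
Qed.

End ProfileLift.

Section InterpLift.
Context {R : realType} {V : completeNormedModType R[i]}.

(** The form in which the inner product enters: this identity is what drives [RS_parseval]. *)
Lemma hilbert_parallelogram : is_hilbert V -> forall x y : V,
  rnorm (x + y) ^+ 2 + rnorm (x - y) ^+ 2 = 2 * (rnorm x ^+ 2 + rnorm y ^+ 2).
Proof.
move=> [ip ipE] x y.
have E z : ip z z = (rnorm z ^+ 2)%:C by rewrite rmorphXn/= -rnormE ipE.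
have : ip (x + y) (x + y) + ip (x - y) (x - y) = 2 * (ip x x + ip y y).
  by rewrite !linearDl/= !linearDr/= !linearNl/= !linearNr/= opprK; ring.
have -> : (2 : R[i]) = 2%:C by rewrite rmorph_nat.
by rewrite !E -!rmorphD -rmorphM => /complexI.
Qed.

Lemma sqsum_pick (x y : nat -> R) : (forall k, y k.+1 = x k.+1) -> sqsum x -> sqsum y.
Proof.
move=> xy [C xC]; exists (y 0%N ^+ 2 + C) => -[|K].
  rewrite big_ord0 addr_ge0 ?sqr_ge0//.
  by have := xC 0%N; rewrite big_ord0.
rewrite big_ord_recl/= lerD2l; apply: le_trans (xC K.+1).
rewrite big_ord_recl/= -[leLHS]add0r lerD ?sqr_ge0//.
by apply: ler_sum => k _; rewrite xy.
Qed.

Lemma interp_lift (A : linop V) (a : R) (u : V) (last : bool) : 0 < a -> is_hilbert V ->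
  closed_op (opp_linop A) -> car (interp (graph_space A) 2^-1) u ->
  exists psi f, [/\ evolution_eq a A f psi, L2 a (full V) f,
    boundary_value a psi 0 (if last then 0 else u) &
    boundary_value a psi a (if last then u else 0)].
Proof.
move=> a0 /hilbert_parallelogram par Acl [F FC Fu].
have [p [q [dp pq sp sAp sq]]] := K_decomposition Acl par FC.
(* Node 0 is [a], so setting the first term to 0 makes the profile vanish there; changing one term
   does not affect summability. *)
pose P k := if k is 0%N then 0 else p k.
pose r := expR (- pi) : R.
have r01 : 0 < r < 1.
  by rewrite expR_gt0/= -expR0 ltr_expR oppr_lt0 pi_gt0.
have rV : r^-1 = expR pi by rewrite /r expRN invrK.
have dP k : dom A (P k) by case: k => [|k]; [exact: dom0|exact: dp].
have PQ k : u = P k + (u - P k) by rewrite addrC subrK.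
have [sP sAP] : sqsum (fun k => r ^+ k * rnorm (P k)) /\ sqsum (fun k => r ^+ k * rnorm (A (P k))).
  by split; [apply: sqsum_pick sp|apply: sqsum_pick sAp].
have sQ : sqsum (fun k => r^-1 ^+ k * rnorm (u - P k)).
  apply: sqsum_pick sq => k; rewrite rV /P -Fu (pq k.+1) addrAC subrr add0r//.
have lift b sg sgb := @profile_lift R V A a r b sg u P (fun k => u - P k) a0 r01 erefl PQ dP sP sAP sQ sgb.
have [S E] : profile a r u P 0 = u /\ profile a r u P a = 0.
  by split; [exact: profile_start|exact: profile_end].
case: last.
  (* With the clock a - t the profile, whose value at 0 is [u], is read backwards, and [u] becomes
     the final value. *)
  have [|psi [f [e l b1 b2]]] := lift a (-1); first by right.
  by exists psi, f; split => //; [rewrite -E|rewrite mulN1r subrr S in b2].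
have [|psi [f [e l b1 b2]]] := lift 0 1; first by left.
by exists psi, f; split => //; [rewrite S in b1|rewrite add0r mul1r E in b2].
Qed.

End InterpLift.

(** * The interpolation space as a vector space *)

Section InterpSpace.
Context {R : realType} {V : completeNormedModType R[i]}.
Variable A : linop V.
Local Notation G := (graph_space A).

Lemma graph_nrm_ge0 x : 0 <= nrm G x.
Proof. by rewrite addr_ge0 ?rnorm_ge0. Qed.

Lemma graph_nrm_lin (c : R[i]) x y : dom A x -> dom A y ->
  nrm G (c *: x + y) <= rnorm (c : R[i]^o) * nrm G x + nrm G y.
Proof.
move=> dx dy; rewrite /= opP// mulrDr addrACA lerD// (le_trans (rnormD _ _))//.
  by rewrite rnormZ.
by rewrite rnormZ.
Qed.

Lemma calderon_lin (c : R[i]) F F' : calderon G F -> calderon G F' ->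
  calderon G (fun z => c *: F z + F' z).
Proof.
move=> [Fc [M FM] Fd FA [[N FN] Ft]] [Fc' [M' FM'] Fd' FA' [[N' FN'] Ft']].
have c0 : 0 <= rnorm (c : R[i]^o) := rnorm_ge0 _.
split.
- by move=> z; apply: cvgD; [apply: cvgZl_tmp; exact: Fc|exact: Fc'].
- exists (rnorm (c : R[i]^o) * M + M') => z zs; rewrite (le_trans (rnormD _ _))// lerD ?FM'//.
  by rewrite rnormZ ler_wpM2l ?FM.
- by move=> z zs; apply: derivableD; [apply: derivableZ; exact: Fd|exact: Fd'].
- by move=> t; exact: (@domP _ _ A c _ _ (FA t) (FA' t)).
split.
  exists (rnorm (c : R[i]^o) * N + N') => t; apply: (le_trans (graph_nrm_lin _ (FA t) (FA' t))).
  by rewrite lerD// ler_wpM2l.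
move=> t.
have H : rnorm (c : R[i]^o) * nrm G (F (1 +i* s) - F (1 +i* t)) +
    nrm G (F' (1 +i* s) - F' (1 +i* t)) @[s --> t] --> rnorm (c : R[i]^o) * 0 + 0.
  by apply: cvgD; [apply: cvgM; [exact: cvg_cst|exact: Ft]|exact: Ft'].
rewrite mulr0 addr0 in H.
apply: squeeze_cvgr (cvg_cst 0) H; apply: nearW => s; rewrite graph_nrm_ge0/=.
have -> : c *: F (1 +i* s) + F' (1 +i* s) - (c *: F (1 +i* t) + F' (1 +i* t)) =
    c *: (F (1 +i* s) - F (1 +i* t)) + (F' (1 +i* s) - F' (1 +i* t)).
  by rewrite opprD addrACA scalerBr.
by apply: graph_nrm_lin; apply: domB; [exact: FA|exact: FA|exact: FA'|exact: FA'].
Qed.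

Lemma interp_lin s (c : R[i]) u v : car (interp G s) u -> car (interp G s) v ->
  car (interp G s) (c *: u + v).
Proof.
by move=> [F FC <-] [F' FC' <-]; exists (fun z => c *: F z + F' z) => //; exact: calderon_lin.
Qed.

Lemma interp0 s : car (interp G s) 0.
Proof.
exists (fun=> 0) => //; split.
- by apply: continuous_subspaceT; exact: cst_continuous.
- by exists 0 => z _; rewrite rnorm0.
- by move=> z _; exact: derivable_cst.
- by move=> t; exact: dom0.
split; first by exists (nrm G 0).
by move=> t; rewrite subrr/= op0 rnorm0 addr0; exact: cvg_cst.
Qed.

End InterpSpace.

(** * Uniqueness and linearity of boundary values *)

Section BoundaryValue.
Context {R : realType} {V : completeNormedModType R[i]}.
Local Notation mu := (@lebesgue_measure R).
Variable a : R.
Hypothesis a0 : 0 < a.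

Lemma ae_and (P Q : R -> Prop) : {ae mu, forall t, P t} -> {ae mu, forall t, Q t} ->
  {ae mu, forall t, P t /\ Q t}.
Proof. exact: (@filterI _ _ (ae_filter_ringOfSetsType mu)). Qed.

Lemma ae_imp (P Q : R -> Prop) : (forall t, P t -> Q t) ->
  {ae mu, forall t, P t} -> {ae mu, forall t, Q t}.
Proof. exact: (@filterS _ _ (ae_filter_ringOfSetsType mu)). Qed.

Lemma ae_itv (P : R -> Prop) (l h : R) : {ae mu, forall t, P t} -> l < h ->
  exists2 t, l < t < h & P t.
Proof.
move=> [N [mN N0 PN]] lh; apply: contrapT => none.
have sub : [set` `]l, h[] `<=` N.
  by move=> t /=; rewrite in_itv/= => tlh; apply: PN => /= Pt; apply: none; exists t.
have : (mu [set` `]l, h[] <= mu N)%E.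
  by apply: le_measure => //; rewrite inE//; exact: measurable_itv.
rewrite N0 lebesgue_measure_itv/= lte_fin lh -EFinD lee_fin subr_le0.
by rewrite leNgt lh.
Qed.

(** If two continuous representatives differed at [t], they would differ on a nonempty open interval
    near [t], which is not a null set. *)
Lemma boundary_value_unique (psi psi' : R -> V) t u v : 0 <= t <= a ->
  {ae mu, forall s : R, 0 < s < a -> psi s = psi' s} ->
  boundary_value a psi t u -> boundary_value a psi' t v -> u = v.
Proof.
move=> t0a pp [c [cc cp <-]] [c' [cc' cp' <-]]; apply/eqP; rewrite -subr_eq0.
apply/negPn/negP => ctn.
have w0 : 0 < rnorm (c t - c' t) by rewrite lt_neqAle eq_sym rnorm_eq0 ctn rnorm_ge0.
have tin : `[0, a]%classic t by rewrite /= in_itv.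
have dc : c s - c' s @[s --> within `[0, a]%classic (nbhs t)] --> c t - c' t.
  move/subspace_continuousP : cc => /(_ _ tin) cc.
  move/subspace_continuousP : cc' => /(_ _ tin) cc'.
  by apply: cvgB; [exact: cc|exact: cc'].
move/rcvgP : dc => /(_ _ w0); rewrite near_withinE => /nbhs_ballP[d /= d0 dP].
(* The interval lies to the right of [t], except at [t] = a, where it lies to the left. *)
have [l [h [lh sub]]] : exists l h : R, l < h /\
    forall s, l < s < h -> 0 < s < a /\ `|t - s| < d.
  have [ta|ta] := ltP t a.
    exists t, (Num.min a (t + d)); split; first by rewrite lt_min ta ltrDl.
    by move=> s; rewrite lt_min ltr_norml => /and3P[*]; split; lra.
  exists (Num.max 0 (a - d)), a; split; first by rewrite gt_max a0 gtrBl.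
  by move=> s; rewrite gt_max ltr_norml => /andP[/andP[*]]; split; lra.
have [s sl [s1 s2 s3]] : exists2 s, l < s < h & [/\ 0 < s < a -> psi s = psi' s,
    0 < s < a -> c s = psi s & 0 < s < a -> c' s = psi' s].
  apply: ae_itv lh; apply: ae_imp (ae_and pp (ae_and cp cp')) => s [? []]; by split.
have [s0a std] := sub s sl.
have sin : `[0, a]%classic s by case/andP: s0a => s0 sa; rewrite /= in_itv/= !ltW.
by have := dP s std sin; rewrite /= s2// s3// s1// subrr sub0r rnormN ltxx.
Qed.

Lemma boundary_value_lin (z : R[i]) (psi psi' : R -> V) t u v :
  boundary_value a psi t u -> boundary_value a psi' t v ->
  boundary_value a (fun s => z *: psi s + psi' s) t (z *: u + v).
Proof.
move=> [c [cc cp <-]] [c' [cc' cp' <-]]; exists (fun s => z *: c s + c' s); split => //.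
  by move=> s; apply: cvgD; [apply: cvgZl_tmp; exact: cc|exact: cc'].
by apply: ae_imp (ae_and cp cp') => s [h1 h2] sa; rewrite h1// h2.
Qed.

Lemma boundary_value0 t : boundary_value a (fun=> 0 : V) t 0.
Proof.
exists (fun=> 0); split => //; last by apply: aeW.
by apply: continuous_subspaceT; exact: cst_continuous.
Qed.

Lemma L2_zero (Y : nsubspace V) : car Y 0 -> nrm Y 0 = 0 -> L2 a Y (fun=> 0).
Proof.
move=> Y0 n0; split.
  apply: strongly_measurable_continuous => // t _; rewrite subrr n0; exact: cvg_cst.
rewrite (@integral0_eq _ _ _ mu)// => t _; by rewrite n0 expr0n.
Qed.

Lemma evolution_zero (A : linop V) : evolution_eq a A (fun=> 0) (fun=> 0).
Proof.
have L0 : L2 a (full V) (fun=> 0) by apply: L2_zero => //; exact: rnorm0.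
have W0 : weak_derivative a (fun=> 0 : V) (fun=> 0).
  apply: (@weak_derivative_locally_finite _ _ _ a0 (fun _ _ => 0) (fun _ _ => 0) (fun=> 0)).
  - by move=> _; exact: cst_continuous.
  - by move=> c d _ _ _; exists 0%N => t _; rewrite !big_ord0.
split; last first.
  by exists (fun=> 0) => //; split => //; apply: aeW => t _; rewrite op0 subrr.
split; first by split => //; exists (fun=> 0).
by apply: L2_zero; [exact: dom0|rewrite /= op0 rnorm0 addr0].
Qed.

End BoundaryValue.

(** * Traces and block triangularity *)

Section LinearExtension.
Context {k : fieldType} {V W : lmodType k}.
Variable (S : set W).
Implicit Types (G H : set (V * W)) (c : k).

(** Partial linear maps with values in [S], encoded by their graphs so that inclusion is the order
    for Zorn's lemma. The third clause expresses single-valuedness. *)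
Definition linear_graph G := [/\ G (0, 0),
  forall c x y w z, G (x, w) -> G (y, z) -> G (c *: x + y, c *: w + z),
  forall w, G (0, w) -> w = 0 & forall x w, G (x, w) -> S w].

(* The empty set is admitted because the union of the empty chain is empty. *)
Let linear_graph_bigcup G (F : set (set (V * W))) :
  F `<=` [set H | H = set0 \/ G `<=` H /\ linear_graph H] ->
  total_on F subset -> let U := \bigcup_(X in F) X in U = set0 \/ G `<=` U /\ linear_graph U.
Proof.
move=> FG Ftot U; have [->|/set0P[xw [H FH Hxw]]] := eqVneq U set0; [by left|right].
have good H' p : F H' -> H' p -> G `<=` H' /\ linear_graph H'.
  by move=> /FG[->|//].
have [GH [H0 _ _ _]] := good H xw FH Hxw.
split; first by move=> p /GH Hp; exists H.
split.
- by exists H.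
- move=> c x y w z [H1 F1 h1] [H2 F2 h2].
  have [le|le] := Ftot _ _ F1 F2.
    have [_ [_ lin _ _]] := good _ _ F2 h2; exists H2 => //; apply: lin => //; exact: le.
  have [_ [_ lin _ _]] := good _ _ F1 h1; exists H1 => //; apply: lin => //; exact: le.
- by move=> w [H1 F1 h1]; have [_ [_ _ + _]] := good _ _ F1 h1; apply.
- by move=> x w [H1 F1 h1]; have [_ [_ _ _ +]] := good _ _ F1 h1; apply; exact: h1.
Qed.

Lemma linear_graph_extension G : linear_graph G -> exists T : V -> W,
  [/\ forall c x y, T (c *: x + y) = c *: T x + T y,
      forall x w, G (x, w) -> T x = w & forall x, S (T x)].
Proof.
move=> gG; have [H [PH Hmax]] := Zorn_bigcup (@linear_graph_bigcup G).
have [GH gH] : G `<=` H /\ linear_graph H.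
  (* The maximal element cannot be empty, because [G] itself is admissible and strictly larger. *)
  case: PH => // H0; exfalso; apply: (Hmax G); last by right; split => //; exact: subset_refl.
  by rewrite H0; split => // G0; have [g0 _ _ _] := gG; exact: (G0 _ g0).
have [H0 Hlin Hfun HS] := gH.
have total x : exists w, H (x, w).
  apply: contrapT => nx.
  (* Extension by 0 along [x]: no new values appear, so they remain in [S]. *)
  pose H' : set (V * W) := [set p | exists c y, p.1 = c *: x + y /\ H (y, p.2)].
  have HH' : H `<=` H' by move=> [y w] h; exists 0, y; rewrite scale0r add0r.
  apply: (Hmax H'); last (right; split; first exact: subset_trans GH HH').
    split => // H'H; apply: nx; exists 0; apply: H'H.
    by exists 1, 0; rewrite scale1r addr0.
  split; first exact: HH'.
  - move=> c y1 y2 w1 w2 [/= c1 [z1 [-> h1]]] [/= c2 [z2 [-> h2]]].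
    exists (c * c1 + c2), (c *: z1 + z2); split; last exact: Hlin.
    by rewrite /= scalerDr scalerA scalerDl addrACA.
  - move=> w [/= c [y [cy h]]]; have [c0|c0] := eqVneq c 0.
      by apply: Hfun; move: cy; rewrite c0 scale0r add0r => ->.
    (* A relation c x + y = 0 with c nonzero would already place [x] in the domain of [H]. *)
    case: nx; exists (- c^-1 *: w + 0).
    have -> : x = - c^-1 *: y + 0.
      apply: (scalerI c0); apply/eqP; rewrite addr0 scaleNr scalerN scalerA divff// scale1r.
      by rewrite -addr_eq0 -cy.
    exact: Hlin.
  - by move=> y w [/= c [z [_ /HS]]].
have uniq x w z : H (x, w) -> H (x, z) -> w = z.
  move=> h1 h2; have := Hlin (-1) _ _ _ _ h1 h2.
  rewrite !scaleN1r addNr => /Hfun/eqP; rewrite addrC subr_eq0 => /eqP ->//.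
have /choice[T TP] := total; exists T; split.
- by move=> c x y; apply: (uniq (c *: x + y)) => //; exact: Hlin.
- by move=> x w /GH; apply: uniq.
- by move=> x; exact: HS (TP x).
Qed.

End LinearExtension.

Section Trace.
Context {R : realType} {V : completeNormedModType R[i]}.
Variables (A : linop V) (a s : R).
Hypothesis a0 : 0 < a.

(* The maps phi must be defined on the whole solution space; a purely algebraic
   extension of psi |-> psi(a) dispenses with a proof that every element of this
   space has boundary values in K. *)
Lemma trace_extension : exists T : (R -> V) -> V,
  [/\ forall c x y, T (c *: x + y) = c *: T x + T y,
      forall psi u, boundary_value a psi a u -> car (interp (graph_space A) s) u -> T psi = u,
      forall psi, car (interp (graph_space A) s) (T psi) &
      forall psi psi', {ae @lebesgue_measure R, forall t : R, 0 < t < a -> psi t = psi' t} ->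
        T psi = T psi'].
Proof.
pose G : set ((R -> V) * V) := [set p | boundary_value a p.1 a p.2 /\
  car (interp (graph_space A) s) p.2].
have gG : linear_graph (car (interp (graph_space A) s)) G.
  split.
  - split; [exact: boundary_value0|exact: interp0].
  - move=> c x y w z [/= b1 k1] [/= b2 k2].
    split; [exact: boundary_value_lin|exact: interp_lin].
  - move=> w [/= bw _]; apply: (@boundary_value_unique _ _ a a0 (0 : R -> V) (0 : R -> V) a) bw _.
    + by rewrite ltW//= lexx.
    + by apply: aeW.
    + exact: boundary_value0.
  - by move=> x w [].
have [T [Tl TG TK]] := linear_graph_extension gG; exists T; split => // [psi u b k|psi psi' pp].
  by apply: TG.
(* The difference vanishes almost everywhere, so it has boundary value 0 and [T] sends it to 0. *)
have -> : psi = 1 *: (psi - psi') + psi' by rewrite scale1r subrK.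
rewrite Tl scale1r (TG _ 0) ?add0r//; split; last exact: interp0.
exists (fun=> 0); split => //; first by apply: continuous_subspaceT; exact: cst_continuous.
by apply: ae_imp pp => t h /h; rewrite /= => E; rewrite -[(psi - psi') t]/(psi t - psi' t) E subrr.
Qed.

End Trace.

Section TimeGraphProof.
Context {R : realType} {I : finType}.
Context (X : I -> completeNormedModType R[i]).
Context (A : forall j, linop (X j)).
Variable (B : (forall j, X j) -> forall j, X j).
Hypothesis hB : bounded_KA A B.
Local Notation KA := (KA A).

Definition single (j : I) (u : X j) : forall k, X k := @eqtype.dfwith I X (fun=> 0) j u.

Lemma single_in j (u : X j) : single u j = u.
Proof. exact: eqtype.dfwith_in. Qed.

Lemma single_out j k (u : X j) : j != k -> single u k = 0.
Proof. exact: eqtype.dfwith_out. Qed.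

Lemma single_lin j (c : R[i]) (u v : X j) :
  single (c *: u + v) = (fun k => c *: single u k + single v k) .
Proof.
apply: functional_extensionality_dep => k; have [<-|jk] := eqVneq j k.
  by rewrite !single_in.
by rewrite !single_out// scaler0 addr0.
Qed.

Lemma K0 j : car (K A j) 0. Proof. exact: interp0. Qed.

Lemma KA_single j (u : X j) : car (K A j) u -> KA (single u).
Proof.
move=> Ku k; have [<-|jk] := eqVneq j k; first by rewrite single_in.
by rewrite single_out//; exact: K0.
Qed.

Lemma KA_lin (c : R[i]) u v : KA u -> KA v -> KA (fun k => c *: u k + v k).
Proof. by move=> Ku Kv k; apply: interp_lin; [exact: Ku|exact: Kv]. Qed.

Lemma KA0 : KA (fun=> 0). Proof. by move=> j; exact: K0. Qed.

Lemma block_K i j (u : X j) : car (K A j) u -> car (K A i) (block B i u).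
Proof. by move=> /KA_single; case: hB => + _ _ => /[apply]; exact. Qed.

Lemma block_lin i j (c : R[i]) (u v : X j) : car (K A j) u -> car (K A j) v ->
  block B i (c *: u + v) = c *: block B i u + block B i v.
Proof.
move=> Ku Kv; rewrite /block -/(single _) single_lin.
by case: hB => _ Bl _; apply: Bl; exact: KA_single.
Qed.

Lemma B0 i : B (fun=> 0) i = 0.
Proof.
case: hB => _ Bl _; have := Bl 1 _ _ KA0 KA0 i.
have -> : (fun k => 1 *: (0 : X k) + 0) = (fun=> 0).
  by apply: functional_extensionality_dep => k; rewrite scaler0 addr0.
by rewrite scale1r => /eqP; rewrite -[X in X == _]addr0 (inj_eq (addrI _)) => /eqP.
Qed.

Lemma block0 i j : block B i (0 : X j) = 0.
Proof.
rewrite /block -/(single _); have -> : single (0 : X j) = (fun=> 0); last exact: B0.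
apply: functional_extensionality_dep => k; have [<-|jk] := eqVneq j k; first by rewrite single_in.
by rewrite single_out.
Qed.

Lemma B_blocks u i : KA u -> B u i = \sum_j block B i (u j).
Proof.
move=> Ku; pose U (r : seq I) : forall k, X k := fun k => \sum_(j <- r) single (u j) k.
have [KU BU] : KA (U (index_enum I)) /\ B (U (index_enum I)) i = \sum_j block B i (u j).
  elim: (index_enum I) => [|j r [Kr IH]].
    have -> : U [::] = (fun=> 0) by apply: functional_extensionality_dep => k; rewrite /U big_nil.
    by rewrite B0 big_nil; split => //; exact: KA0.
  have -> : U (j :: r) = (fun k => 1 *: single (u j) k + U r k).
    by apply: functional_extensionality_dep => k; rewrite /U big_cons scale1r.
  have Ks := KA_single (Ku j); split; first exact: KA_lin.
  by case: hB => _ Bl _; rewrite Bl// scale1r IH big_cons.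
rewrite -BU; congr (B _ i); apply: functional_extensionality_dep => k.
rewrite /U (bigD1 k)//= big1 ?addr0; first by rewrite single_in.
by move=> j jk; rewrite single_out.
Qed.

End TimeGraphProof.

(** * Equivalence of iterative solvability and triangular form *)

Section Solvability.
Context {R : realType} {I : finType} (a : I -> R).
Context (X : I -> completeNormedModType R[i]).
Context (A : forall j, linop (X j)).
Variable (B : (forall j, X j) -> forall j, X j).
Hypothesis ha : forall j, 0 < a j.
Hypothesis hB : bounded_KA A B.
Local Notation KA := (KA A).
Local Notation block i u := (@block R I X B i _ u).

Lemma rev_ord_lt n (k l : 'I_n) : (k < l)%N -> (rev_ord l < rev_ord k)%N.
Proof.
by move=> kl; apply: ltn_sub2l => //; exact: leq_ltn_trans kl (ltn_ord l).
Qed.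

Lemma K_sum j (J : Type) (r : seq J) (P : pred J) (F : J -> X j) :
  (forall k, P k -> car (K A j) (F k)) -> car (K A j) (\sum_(k <- r | P k) F k).
Proof.
move=> FK; elim/big_ind: _ => //; first exact: K0.
by move=> x y Kx Ky; rewrite -[x]scale1r; exact: interp_lin.
Qed.

Lemma block_triangular_solvable n : block_triangular A B n -> iteratively_solvable a A B n.
Proof.
move=> [e eb tri].
(* Triangularity makes row k depend on positions up to k, whereas the iteration solves the last
   position first; the order has to be reversed. *)
pose e' (i : 'I_n) := e (rev_ord i).
have e'b : bijective e' by exact: bij_comp eb (inv_bij (@rev_ordK n)).
have tri' (i k : 'I_n) : (k < i)%N -> block_zero A B (e' i) (e' k).
  by move=> ki; apply: tri; exact: rev_ord_lt.
pose T j := sval (cid (trace_extension (A j) 2^-1 (ha j))).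
have TP j := svalP (cid (trace_extension (A j) 2^-1 (ha j))).
pose phi (i : 'I_n) (psi : forall j, R -> X j) (g : forall j, X j) : X (e' i) :=
  g (e' i) + \sum_(k : 'I_n | (i < k)%N) block (e' i) (T (e' k) (psi (e' k))).
have TK j psi : car (K A j) (T j psi) by have [_ _ TK _] := TP j; exact: TK.
have phiK (i k : 'I_n) psi : car (K A (e' i)) (block (e' i) (T (e' k) psi)).
  by apply: block_K => //; exact: TK.
exists e' => //; exists phi.
  move=> i _; split.
  - move=> psi g _ Kg; rewrite /phi -[g (e' i)]scale1r; apply: interp_lin; first exact: Kg.
    by apply: K_sum => k _; exact: phiK.
  - move=> psi psi' g _ _ _ pp; congr (_ + _); apply: eq_bigr => k ik; congr (block _ _).
    by case: (TP (e' k)) => _ _ _; apply; exact: pp.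
  - move=> c psi psi' g g' _ _ _ _; rewrite /phi scalerDr addrACA; congr (_ + _).
    rewrite scaler_sumr -big_split/=; apply: eq_bigr => k _.
    have [Tl _ _ _] := TP (e' k).
    by rewrite -(block_lin hB); [congr (block _ _); exact: Tl|exact: TK|exact: TK].
move=> f g _ Kg psi [ev [um [up [Kum Kup b0 b1 eq]]]].
(* Row i of the transmission condition: the blocks towards positions before i vanish, the diagonal
   one stays on the left, and those after i are computed by the maps [T], which agree with the
   actual final values. *)
have E (i : 'I_n) : um (e' i) - block (e' i) (up (e' i)) = phi i psi g.
  have := eq (e' i); rewrite (B_blocks hB _ Kup) (reindex e'); last exact: onW_bij.
  rewrite (bigD1 i)//= (bigID (fun k : 'I_n => i < k)%N)/= [X in _ + (_ + X)]big1 ?addr0.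
    rewrite /phi => <-; rewrite opprD addrA.
    suff -> : \sum_(k < n | (k != i) && (i < k)%N) block (e' i) (up (e' k)) =
      \sum_(k : 'I_n | (i < k)%N) block (e' i) (T (e' k) (psi (e' k))) by rewrite subrK.
    apply: eq_big => [k|k _]; first by rewrite -(inj_eq val_inj) neq_ltn/=; case: ltngtP.
    have [_ TB _ _] := TP (e' k).
    by congr (block _ _); apply/esym/TB; [exact: b1|exact: Kup].
  move=> k /andP[ki nik]; apply: tri'; last exact: Kup.
  by move: ki nik; rewrite -(inj_eq val_inj)/=; case: ltngtP.
split=> i hi; (split; first exact: ev); exists (um (e' i)), (up (e' i)); split => //.
(* Nothing follows the last position, so the sum in [phi] is empty and [g] remains. *)
rewrite E /phi big1 ?addr0// => k ik.
by have := leq_ltn_trans ik (ltn_ord k); rewrite hi ltnn.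
Qed.

Hypothesis hX : forall j, is_hilbert (X j).
Hypothesis Acl : forall j, closed_op (opp_linop (A j)).

(** For a zero datum the zero function is chosen. The converse needs this: a lift must vanish
    identically on the edges where its datum does. *)
Lemma edge_lift (last : bool) j (u : X j) : car (K A j) u -> exists p : (R -> X j) * (R -> X j),
  [/\ evolution_eq (a j) (A j) p.2 p.1, L2 (a j) (full (X j)) p.2,
    boundary_value (a j) p.1 0 (if last then 0 else u),
    boundary_value (a j) p.1 (a j) (if last then u else 0) & u = 0 -> p.1 = (fun=> 0)].
Proof.
have [-> _|u0 Ku] := eqVneq u 0; last first.
  have [psi [f [? ? ? ?]]] := interp_lift last (ha j) (hX j) (@Acl j) Ku.
  by exists (psi, f); split => // uE; rewrite uE eqxx in u0.
exists (fun=> 0, fun=> 0); rewrite !if_same; split => //=.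
- exact: evolution_zero.
- by apply: L2_zero => //; exact: rnorm0.
- exact: boundary_value0.
- exact: boundary_value0.
Qed.

Lemma system_lift (last : bool) u : KA u -> exists psi f : forall j, R -> X j,
  [/\ forall j, evolution_eq (a j) (A j) (f j) (psi j),
      forall j, L2 (a j) (full (X j)) (f j),
      forall j, boundary_value (a j) (psi j) 0 (if last then 0 else u j),
      forall j, boundary_value (a j) (psi j) (a j) (if last then u j else 0) &
      forall j, u j = 0 -> psi j = (fun=> 0)].
Proof.
move=> Ku; pose p j := sval (cid (edge_lift last (Ku j))).
have pP j := svalP (cid (edge_lift last (Ku j))).
by exists (fun j => (p j).1), (fun j => (p j).2); split => j; case: (pP j).
Qed.

Lemma edge_solution_boundary j f v psi um up : edge_solution a A B f v psi ->
  boundary_value (a j) psi 0 um -> boundary_value (a j) psi (a j) up ->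
  um - block j up = v.
Proof.
move=> [_ [um' [up' [_ _ b0 b1 <-]]]] c0 c1.
have ae : {ae @lebesgue_measure R, forall t, 0 < t < a j -> psi t = psi t} by apply: aeW.
have aj := ltW (ha j).
rewrite (boundary_value_unique (ha j) _ ae c0 b0) ?lexx//.
by rewrite (boundary_value_unique (ha j) _ ae c1 b1) ?lexx ?aj.
Qed.

Lemma solvable_block_triangular n : iteratively_solvable a A B n -> block_triangular A B n.
Proof.
move=> [e eb [phi phil sol]].
have einj := bij_inj eb.
(* Induction on the distance [d] of i from the end, following the order of solution; for [d] = 0
   there is no such position. *)
suff claim d (i l : 'I_n) : (n <= i + d)%N -> (l < i)%N -> block_zero A B (e i) (e l).
  exists (e \o @rev_ord n); first exact: bij_comp eb (inv_bij (@rev_ordK n)).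
  by move=> k l kl; apply: (@claim n); [exact: leq_addl|exact: rev_ord_lt].
elim: d i l => [i l|d IH i l nid li u Ku]; first by rewrite addn0 leqNgt ltn_ord.
pose E := single u; have KE : KA E by exact: KA_single.
pose v j := block j u; have Kv : KA v by move=> j; apply: block_K.
(* The induction hypothesis applies to the rows at later positions. *)
have v0 (k : 'I_n) : (i < k)%N -> v (e k) = 0.
  move=> ik; apply: IH => //; last exact: ltn_trans ik.
  by apply: leq_trans nid _; rewrite addnS -addSn leq_add2r.
have [psi1 [f1 [ev1 L1 s1 t1 z1]]] := system_lift true KE.
have [psi2 [f2 [ev2 L2' s2 t2 z2]]] := system_lift false Kv.
have Ei0 (k : 'I_n) : (i <= k)%N -> E (e k) = 0.
  move=> ik; rewrite /E single_out// (inj_eq einj); apply: contraTneq ik => <-.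
  by rewrite -ltnNge.
have Kmv : KA (fun j => - v j).
  have -> : (fun j => - v j) = (fun j => -1 *: v j + 0).
    by apply: functional_extensionality_dep => j; rewrite scaleN1r addr0.
  by apply: KA_lin => //; exact: KA0.
(* By definition of the blocks, [B E] is [v]; zero initial values and final values [E] thus
   correspond to the datum - v. *)
have S1 : solution a A B f1 (fun j => - v j) psi1.
  split => //; exists (fun=> 0), E; split => //; first exact: KA0.
  by move=> j; rewrite sub0r.
have S2 : solution a A B f2 v psi2.
  split => //; exists v, (fun=> 0); split => //; first exact: KA0.
  by move=> j; rewrite (B0 hB) subr0.
have [last1 rest1] := sol _ _ L1 Kmv _ S1; have [_ rest2] := sol _ _ L2' Kv _ S2.
(* [psi1] has both boundary values equal to 0 on the edge at position i, since l < i. Whatever datum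
   is prescribed there must be 0; at the last position this datum is - v itself and the proof
   ends. *)
have value1 w : edge_solution a A B (f1 (e i)) w (psi1 (e i)) -> w = 0.
  move=> /edge_solution_boundary => /(_ _ _ (s1 _) (t1 _)) <-.
  by rewrite Ei0// (block0 hB) subr0.
have [iN|iN] := eqVneq i.+1 n.
  by apply/eqP; rewrite -oppr_eq0; apply/eqP; apply: value1; exact: last1.
have {}iN : (i.+1 < n)%N by rewrite ltn_neqAle iN ltn_ord.
have p1 := value1 _ (rest1 i iN).
have p2 : phi i psi2 v = v (e i).
  rewrite -(edge_solution_boundary (rest2 i iN) (s2 _) (t2 _)).
  by rewrite (block0 hB) subr0.
have [_ phiE phiL] := phil i iN.
have tail1 : tail_in a A e i psi1 by move=> k _; case: (ev1 (e k)).
have tail2 : tail_in a A e i psi2 by move=> k _; case: (ev2 (e k)).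
pose Z : forall j, R -> X j := fun j _ => 0.
have tailZ : tail_in a A e i Z by move=> k _; case: (evolution_zero (ha (e k)) (A (e k))).
have phiZ : phi i Z (fun=> 0) = 0.
  have := phiL 1 Z Z _ _ tailZ tailZ (KA0 A) (KA0 A).
  have -> : (fun j t => 1 *: Z j t + Z j t) = Z.
    apply: functional_extensionality_dep => j; apply/funext => t.
    by rewrite /Z scaler0 addr0.
  have -> : (fun j => 1 *: (0 : X j) + 0) = (fun=> 0).
    by apply: functional_extensionality_dep => j; rewrite scaler0 addr0.
  by rewrite scale1r => /eqP; rewrite -[X in X == _]addr0 (inj_eq (addrI _)) => /eqP.
(* Both lifts vanish at all positions after i, so [phi i] can be evaluated on the zero tail in both
   cases, leaving only its linear dependence on [g]. *)
have q1 : phi i Z (fun j => - v j) = 0.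
  rewrite -p1; apply: phiE => // k ik; apply: aeW => t _.
  by rewrite z1 ?Ei0// ltnW.
have q2 : phi i Z v = v (e i).
  rewrite -p2; apply: phiE => // k ik; apply: aeW => t _.
  by rewrite z2 ?v0.
have := phiL 1 Z Z _ _ tailZ tailZ Kmv Kv; rewrite q1 q2 scaler0 add0r.
rewrite -[v (e i)]/(block (e i) u) => <-.
rewrite -phiZ; congr (phi i _ _).
  by apply: functional_extensionality_dep => j; apply/funext => t; rewrite /Z scaler0 addr0.
by apply: functional_extensionality_dep => j; rewrite scale1r addNr.
Qed.

End Solvability.

Theorem proposition7p2 (R : realType) (n : nat) (I : finType)
    (hn : #|I| = n)
    (a : I -> R) (ha : forall j, 0 < a j)
    (X : I -> completeNormedModType R[i])
    (hX : forall j, is_hilbert (X j))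
    (A : forall j, linop (X j))
    (hA : forall j, exists2 omega : R, omega < pi / 2 &
            sectorial (opp_linop (A j)) omega)
    (B : (forall j, X j) -> forall j, X j)
    (hB : bounded_KA A B) :
  (iteratively_solvable a A B n <-> block_triangular A B n) /\
  (iteratively_solvable_ivp a A B n <->
     exists2 e : 'I_n -> I, bijective e &
       block_triangular_for A B e /\ forall j, block_zero A B j j).
Proof.
have Acl j : closed_op (opp_linop (A j)) by case: (hA j) => omega _ [].
have iff : iteratively_solvable a A B n <-> block_triangular A B n.
  by split; [exact: solvable_block_triangular|exact: block_triangular_solvable].
split => //; split => [[/iff[e eb et] z]|[e eb [et z]]]; first by exists e.
by split => //; apply/iff; exists e.
Qed.
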